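(* Consider the dynamical system for $(x,y,\lambda)$ given in the context, with parameters $\varepsilon\in\{+1,-1\}$, $\xi$, $w_m$ and function $z(\lambda)$. Suppose $\varepsilon\xi(1-6\xi)>0$, $1-4\xi-w_m\neq0$, and that $\lambda_{3a}^*\in I$ satisfies $z(\lambda_{3a}^* )^2=\frac{1}{6\varepsilon\xi(1-6\xi)}$. Let $$g(x)=\varepsilon(1-4\xi-w_m)x^2+4\varepsilon\xi(1-3w_m)z(\lambda_{3a}^* )\,x+\frac{2\xi}{1-6\xi}(1-3w_m).$$ (i) The solutions of $g(x)=0$ are $$x=\frac{1}{2\varepsilon(1-4\xi-w_m)}\Big\{-4\varepsilon\xi(1-3w_m)z(\lambda_{3a}^* )\pm\sqrt{-\tfrac{16}{3}\varepsilon\xi(1-3w_m)}\Big\},$$ so that for $w_m<\frac13$ they are real only if $\varepsilon\xi<0$ (hence, when $\xi>0$, only for the phantom scalar field $\varepsilon=-1$). (ii) If $x_{3a}^*$ is a real solution of $g(x)=0$, then $(x,y,\lambda)=(x_{3a}^*,0,\lambda_{3a}^* )$ is a critical point of the system, with effective equation of state parameter $w_{\mathrm{eff}}=\frac13$ (a radiation dominated universe). The eigenvalues of the linearization matrix at it are $-a,\ 0,\ a$ with $$a=12\varepsilon\xi(1-6\xi)z(\lambda_{3a}^* )x_{3a}^*,$$ so the critical point is non-hyperbolic. (iii) Let $a\neq0$. Expand the right-hand side of the system up to second order around this point and pass to the variables $(u,v,w)$ defined in the context. The resulting system admits the two invariant submanifolds $v=0$ and $u=0$. On $v=0$ it reduces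 (to leading order) to $u'=-a\,u$, $w'=a\,w$, with solution $u(\tau)=u^{\mathrm{ini}}e^{-a\tau}$, $w(\tau)=w^{\mathrm{ini}}e^{a\tau}$ representing a saddle type critical point. On $u=0$ it has the form $$v'=B_v\,vw,\qquad w'=a\,w+B_w\,v^2+C_w\,w^2,$$ where $B_v,B_w,C_w$ are the corresponding second-order Taylor coefficients. The center manifold of this system is $$w=h(v)=-\frac{B_w}{a}v^2+\frac{B_w^2}{a^3}(2B_v-C_w)v^4+O(v^5),$$ and the vector field restricted to it is $$\eta'=-\frac{B_vB_w}{a}\eta^3+O(\eta^4),\qquad \frac{B_vB_w}{a}=-\varepsilon\frac{\lambda_{3a}^*}{2(1-6\xi)z(\lambda_{3a}^* )}-\frac32(1+w_m).$$ Hence, on the invariant submanifold $u=0$, the critical point is unstable for $\frac{B_vB_w}{a}<0$ and stable for $\frac{B_vB_w}{a}>0$.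
   Context: Let $\varepsilon\in\{+1,-1\}$ ($+1$ canonical, $-1$ phantom scalar field), let $\xi\in\mathbb{R}$ be the non-minimal coupling constant and $w_m\in\mathbb{R}$ the equation of state parameter of the barotropic matter, and let $z:I\to\mathbb{R}$ be a smooth function on an open interval $I$ with nowhere vanishing derivative $z'(\lambda)=\frac{dz}{d\lambda}$ (equivalently $z'(\lambda)=-1/(\lambda^2(\Gamma(\lambda)-1))$ for the function $\Gamma=U''U/U'^2$ determined by the scalar field potential $U$). Put $$D=1-6\varepsilon\xi(1-6\xi)z(\lambda)^2,$$ $$B=-\tfrac43-2\xi\lambda y^2z(\lambda)+\varepsilon(1-6\xi)(1-w_m)x^2+2\varepsilon\xi(1-3w_m)(x+z(\lambda))^2+(1+w_m)(1-y^2).$$ The dynamical system on $\mathbb{R}^2\times I$ is $$\frac{dx}{d\tau}=-\left(x-\tfrac{\varepsilon}{2}\lambda y^2\right)D+\tfrac32\left(x+6\xi z(\lambda)\right)B,\qquad \frac{dy}{d\tau}=y\left(2-\tfrac12\lambda x\right)D+\tfrac32\,yB,\qquad \frac{d\lambda}{d\tau}=\frac{x\,D}{z'(\lambda)}.$$ For $u,v,w,\eta$, as for $x,y,\lambda$, a prime denotes $d/d\tau$. The linearization matrix at a critical point is the Jacobian matrix of the right-hand side with respect to $(x,y,\lambda)$; a critical point is non-hyperbolic if this matrix has an eigenvalue with zero real part. The effective equation of state parameter is $$w_{\mathrm{eff}}=\frac1D\Big[-1+\varepsilon(1-6\xi)(1-w_m)x^2+2\varepsilon\xi(1-3w_m)(x+z)^2+(1+w_m)(1-y^2)-2\varepsilon\xi(1-6\xi)z^2-2\xi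 y^2\lambda z\Big],\quad z=z(\lambda).$$ The variables diagonalizing the linear part are $$u=\lambda-\lambda_{3a}^*,\qquad v=y,\qquad w=(x-x_{3a}^* )+\chi(\lambda-\lambda_{3a}^* ),\qquad \chi=\frac{\partial x'/\partial\lambda}{\partial x'/\partial x-\partial\lambda'/\partial\lambda},$$ the partial derivatives being taken at the critical point (there $\partial x'/\partial x=a$ and $\partial\lambda'/\partial\lambda=-a$).
   Formalization: At the critical point w_eff is 0/0, so w_eff = 1/3 is proved as the limit along B=0, D≠0 (w_eff = 1/3 + B/D). ''Stable for B_vB_w/a>0'' on u=0 fails when a>0 (there w'=aw+C_w w² on v=0), so it is proved for a<0, and on every center manifold for all a≠0. *)

(* Defs.v *)
From HB Require Import structures.
From mathcomp Require Import all_boot all_order all_algebra.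
From mathcomp Require Import all_classical all_reals all_analysis.
From mathcomp Require Import complex.

Set Implicit Arguments.
Unset Strict Implicit.
Unset Printing Implicit Defensive.

Import Order.TTheory GRing.Theory Num.Theory.
Import numFieldNormedType.Exports.

Local Open Scope classical_set_scope.
Local Open Scope ring_scope.

Definition row2 (R : nzRingType) (a b : R) : 'rV[R]_2 :=
  \row_(i < 2) [:: a; b]`_i.

Definition row3 (R : nzRingType) (a b c : R) : 'rV[R]_3 :=
  \row_(i < 3) [:: a; b; c]`_i.

Definition smooth_on (R : realType) (I : set R) (f : R -> R) : Prop :=
  forall (n : nat) (t : R), I t -> derivable (derive1n n f) t 1.

(** * Autonomous systems *)

Definition is_solution (R : realType) (V : normedModType R)
    (G : V -> V) (J : set R) (phi : R -> V) : Prop :=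
  forall t, J t -> is_derive t 1 phi (G (phi t)).

(* Solutions starting in [M] stay in [M], forwards and backwards in time,
   as long as they remain in the region [U]. *)
Definition locally_invariant (R : realType) (V : normedModType R)
    (G : V -> V) (U M : set V) : Prop :=
  forall (J : set R) (phi : R -> V),
    open J -> is_interval J -> J 0 -> is_solution G J phi ->
    (forall t, J t -> U (phi t)) -> M (phi 0) ->
    forall t, J t -> M (phi t).

Definition invariant_set (R : realType) (V : normedModType R)
    (G : V -> V) (M : set V) : Prop :=
  locally_invariant G setT M.

(* Lyapunov stability.  Solutions range over all intervals of existence: a
   locally Lipschitz field has a solution through every point, and one that
   stays in a compact set extends to all positive times. *)
Definition stable (R : realType) (V : normedModType R)
    (G : V -> V) (p : V) : Prop :=
  forall e : R, 0 < e -> exists2 d : R, 0 < d &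
    forall (J : set R) (phi : R -> V),
      open J -> is_interval J -> J 0 -> is_solution G J phi ->
      `|phi 0 - p| < d ->
      forall t, J t -> 0 <= t -> `|phi t - p| < e.

Definition unstable (R : realType) (V : normedModType R)
    (G : V -> V) (p : V) : Prop := ~ stable G p.

Definition critical_point (R : realType) (V : normedModType R)
    (G : V -> V) (p : V) : Prop := G p = 0.

(* Entry [(i, j)] is the derivative of the [i]-th component with respect to the
   [j]-th variable; the library's [jacobian] acts on row vectors, hence the
   transpose. *)
Definition linearization (R : realType) (n : nat)
    (G : 'rV[R]_n.+1 -> 'rV[R]_n.+1) (p : 'rV[R]_n.+1) : 'M[R]_n.+1 :=
  (jacobian G p)^T.

(* [s] lists the eigenvalues of [A] with algebraic multiplicity. *)
Definition eigenvalues_are (R : realType) (n : nat) (A : 'M[R]_n)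
    (s : seq R) : Prop :=
  char_poly A = \prod_(e <- s) ('X - e%:P).

Definition non_hyperbolic (R : realType) (n : nat)
    (G : 'rV[R]_n.+1 -> 'rV[R]_n.+1) (p : 'rV[R]_n.+1) : Prop :=
  critical_point G p /\
  exists2 e : R[i], complex.Re e = 0 &
    eigenvalue (map_mx (real_complex R) (linearization G p)) e.

Definition planar_saddle (R : realType)
    (G : 'rV[R]_2 -> 'rV[R]_2) (p : 'rV[R]_2) : Prop :=
  critical_point G p /\
  exists e1 e2 : R, [/\ e1 < 0, 0 < e2,
    eigenvalue (linearization G p) e1 & eigenvalue (linearization G p) e2].

Definition partial (R : realType) (m n : nat) (j : 'I_m.+1)
    (G : 'rV[R]_m.+1 -> 'rV[R]_n.+1) (p : 'rV[R]_m.+1) : 'rV[R]_n.+1 :=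
  'D_(delta_mx 0 j) G p.

Definition taylor2 (R : realType) (m n : nat)
    (G : 'rV[R]_m.+1 -> 'rV[R]_n.+1) (p d : 'rV[R]_m.+1) : 'rV[R]_n.+1 :=
  G p + \sum_j d 0 j *: partial j G p
  + 2^-1 *: \sum_j \sum_k (d 0 j * d 0 k) *: partial j (partial k G) p.

(* The graph [w = h v] is a local center manifold at the origin of a planar
   system in [(v, w)] whose center eigenspace is the [v]-axis: a C^1 locally
   invariant curve tangent to that axis. *)
Definition center_manifold (R : realType) (G : 'rV[R]_2 -> 'rV[R]_2)
    (h : R -> R) : Prop :=
  exists r : R, [/\ 0 < r,
    h 0 = 0 /\ derive1 h 0 = 0,
    forall v, `|v| < r -> derivable h v 1 /\ {for v, continuous (derive1 h)} &
    locally_invariant G [set q : 'rV[R]_2 | `|q 0 0| < r]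
                        [set q : 'rV[R]_2 | q 0 1 = h (q 0 0)]].

(* The field induced on the graph [w = h v], in the parameter [v]. *)
Definition restricted_field (R : realType) (G : 'rV[R]_2 -> 'rV[R]_2)
    (h : R -> R) (eta : R) : R :=
  G (row2 eta (h eta)) 0 0.

(** * The cosmological system, with state [(x, y, lambda)] *)

Definition Dfun (R : realType) (eps xi : R) (z : R -> R) (p : 'rV[R]_3) : R :=
  let l := p 0 2 in
  1 - 6 * eps * xi * (1 - 6 * xi) * z l ^+ 2.

Definition Bfun (R : realType) (eps xi wm : R) (z : R -> R)
    (p : 'rV[R]_3) : R :=
  let x := p 0 0 in let y := p 0 1 in let l := p 0 2 in
  - (4 / 3) - 2 * xi * l * y ^+ 2 * z l
  + eps * (1 - 6 * xi) * (1 - wm) * x ^+ 2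
  + 2 * eps * xi * (1 - 3 * wm) * (x + z l) ^+ 2
  + (1 + wm) * (1 - y ^+ 2).

Definition field (R : realType) (eps xi wm : R) (z : R -> R)
    (p : 'rV[R]_3) : 'rV[R]_3 :=
  let x := p 0 0 in let y := p 0 1 in let l := p 0 2 in
  let D := Dfun eps xi z p in let B := Bfun eps xi wm z p in
  row3
    (- (x - eps / 2 * l * y ^+ 2) * D + 3 / 2 * (x + 6 * xi * z l) * B)
    (y * (2 - 1 / 2 * l * x) * D + 3 / 2 * y * B)
    (x * D / derive1 z l).

Definition weff (R : realType) (eps xi wm : R) (z : R -> R)
    (p : 'rV[R]_3) : R :=
  let x := p 0 0 in let y := p 0 1 in let l := p 0 2 in
  (Dfun eps xi z p)^-1 *
  (- 1 + eps * (1 - 6 * xi) * (1 - wm) * x ^+ 2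
   + 2 * eps * xi * (1 - 3 * wm) * (x + z l) ^+ 2
   + (1 + wm) * (1 - y ^+ 2)
   - 2 * eps * xi * (1 - 6 * xi) * z l ^+ 2
   - 2 * xi * y ^+ 2 * l * z l).

(* The quadratic [g], with [zs = z lambda*]. *)
Definition gpoly (R : realType) (eps xi wm zs : R) : {poly R} :=
  (eps * (1 - 4 * xi - wm)) *: 'X^2
  + (4 * eps * xi * (1 - 3 * wm) * zs) *: 'X
  + (2 * xi / (1 - 6 * xi) * (1 - 3 * wm))%:P.

(** * Second-order expansion in the diagonalizing variables *)

Definition chi (R : realType) (F : 'rV[R]_3 -> 'rV[R]_3) (p : 'rV[R]_3) : R :=
  let J := linearization F p in J 0 2 / (J 0 0 - J 2 2).

(* With [d = (dx, dy, dlambda)] the displacement from [p], the new variables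
   are [u = dlambda], [v = dy], [w = dx + chi dlambda]. *)
Definition to_uvw (R : realType) (c : R) (d : 'rV[R]_3) : 'rV[R]_3 :=
  row3 (d 0 2) (d 0 1) (d 0 0 + c * d 0 2).

Definition of_uvw (R : realType) (c : R) (q : 'rV[R]_3) : 'rV[R]_3 :=
  row3 (q 0 2 - c * q 0 0) (q 0 1) (q 0 0).

Definition field_uvw (R : realType) (F : 'rV[R]_3 -> 'rV[R]_3)
    (p q : 'rV[R]_3) : 'rV[R]_3 :=
  let c := chi F p in to_uvw c (taylor2 F p (of_uvw c q)).

(* The system induced on [v = 0], in the variables [(u, w)]. *)
Definition field_v0 (R : realType) (G : 'rV[R]_3 -> 'rV[R]_3)
    (q : 'rV[R]_2) : 'rV[R]_2 :=
  let H := G (row3 (q 0 0) 0 (q 0 1)) in row2 (H 0 0) (H 0 2).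

(* The system induced on [u = 0], in the variables [(v, w)]. *)
Definition field_u0 (R : realType) (G : 'rV[R]_3 -> 'rV[R]_3)
    (q : 'rV[R]_2) : 'rV[R]_2 :=
  let H := G (row3 0 (q 0 0) (q 0 1)) in row2 (H 0 1) (H 0 2).

Definition linear_saddle_field (R : realType) (a : R) (q : 'rV[R]_2) : 'rV[R]_2 :=
  row2 (- a * q 0 0) (a * q 0 1).

(* Taylor coefficients of [G = (v', w')] at the origin: of [v w] in [v'], of
   [v^2] in [w'] and of [w^2] in [w']. *)
Definition coefBv (R : realType) (G : 'rV[R]_2 -> 'rV[R]_2) : R :=
  partial 0 (partial 1 G) 0 0 0.

Definition coefBw (R : realType) (G : 'rV[R]_2 -> 'rV[R]_2) : R :=
  2^-1 * partial 0 (partial 0 G) 0 0 1.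

Definition coefCw (R : realType) (G : 'rV[R]_2 -> 'rV[R]_2) : R :=
  2^-1 * partial 1 (partial 1 G) 0 0 1.

(* Main.v *)
Require Import Defs.
From HB Require Import structures.
From mathcomp Require Import all_boot all_order all_algebra.
From mathcomp Require Import all_classical all_reals all_analysis.
From mathcomp Require Import complex ring lra.

Set Implicit Arguments.
Unset Strict Implicit.
Unset Printing Implicit Defensive.

Import Order.TTheory GRing.Theory Num.Theory.
Import numFieldNormedType.Exports.

Local Open Scope classical_set_scope.
Local Open Scope ring_scope.

(** The effective dynamics on [u = 0] is the planar system [v' = B v w],
    [w' = a w + b v^2 + c w^2].  A graph [w = h v] is locally invariant exactly
    when [B v h h' = a h + b v^2 + c h^2] near [0]: one direction is uniqueness
    for a linear equation satisfied by [w - h v], the other differentiates the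
    solution through [(v, h v)], which exists by Picard iteration for a
    truncated field.  Center manifolds exist because the substitution
    [h v = - (b / a) v^2 / (1 + k (1 / v^2))] turns the invariance equation into
    a regular equation for [k] near infinity, whose linearization
    [k' = a^2 / (2 B b) k] is hyperbolic.  Every center manifold agrees with the
    quartic Taylor polynomial up to [O(v^6)], because the sign of the derivative
    of the squared error is known wherever that error exceeds a multiple of
    [v^6].  Stability then follows from a quartic Lyapunov function, instability
    by following the center manifold. *)

(** * Real analysis *)

Section RealAnalysis.
Variable R : realType.
Implicit Types (f g df : R -> R) (x t : R).

(** The invariance equation is singular at [v = 0]: the coefficient [B v h] of [h'] vanishes there,
    to third order when [b != 0], so no standard existence or uniqueness theorem applies at the
    origin. Center manifolds need not be unique, and they are only [C^1]; hence the expansion is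
    proved for every one of them by estimates instead of Taylor's formula. Solutions are needed
    before it is known where they stay. Fields are therefore truncated until they are globally
    Lipschitz, and a solution is used only while it remains where the truncation has no effect. The
    normal form comes from two factorizations: [y'] is divisible by [y], and [lambda'] by [D], which
    vanishes at [ls]. At the critical point [B] vanishes as well, so [w_eff] has the form 0/0 there;
    its value 1/3 is a limit along [B = 0] from outside [D = 0]. For [a > 0] the [w] direction
    expands, so [0 < B b / a] then gives stability only for the restricted field; stability of the
    whole planar system is proved for [a < 0]. Instability needs no sign of [a]. *)

Lemma is_derive_continuous (V : normedModType R) (f : R -> V) (x : R) (d : V) :
  is_derive x 1 f d -> {for x, continuous f}.
Proof. by move=> [df _]; apply/differentiable_continuous/derivable1_diffP. Qed.

Lemma within_cont_of_derive f df (a b : R) :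
  (forall x, a <= x <= b -> is_derive x 1 f (df x)) ->
  {within `[a, b], continuous f}.
Proof.
move=> dfx; apply: derivable_within_continuous => x.
by rewrite in_itv /= => /dfx -[].
Qed.

Lemma MVT_closed f df (a b : R) : a <= b ->
  (forall x, a <= x <= b -> is_derive x 1 f (df x)) ->
  exists2 c, a <= c <= b & f b - f a = df c * (b - a).
Proof.
move=> ab dfx; have [||c] := @MVT_segment _ f df a b ab.
- by move=> x; rewrite in_itv /= => /andP[ax xb]; apply: dfx; rewrite !ltW.
- exact: within_cont_of_derive dfx.
- by rewrite in_itv /= => cab fE; exists c.
Qed.

Lemma is_derive_reflect f x d :
  is_derive (- x) 1 f d -> is_derive x 1 (fun y => f (- y)) (- d).
Proof.
move=> fd; have -> : - d = d * (-1) by rewrite mulrN1.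
exact: (@is_derive1_comp _ f -%R).
Qed.

(* The window [C < f x < C2] makes the lemma usable when the sign of the
   derivative is known only locally. *)
Lemma trap_right f df (x1 x2 C C2 : R) : x1 <= x2 -> C < C2 ->
  (forall x, x1 <= x <= x2 -> is_derive x 1 f (df x)) ->
  (forall x, x1 <= x <= x2 -> C < f x < C2 -> df x <= 0) ->
  f x1 <= C -> f x2 <= C.
Proof.
move=> x12 CC2 dfx dle fx1; rewrite leNgt; apply/negP => fx2.
(* [y], the supremum of [E], is the last point where [f <= C]. Just after it [f] lies strictly
   between [C] and [C2], so [df <= 0] there, and the mean value theorem gives [f z <= f y <= C], a
   contradiction. *)
pose E := [set x | x1 <= x <= x2 /\ f x <= C].
have E1 : E x1 by split=> //; rewrite lexx x12.
have supE : has_sup E by split; [exists x1|exists x2 => y [/andP[]]].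
set y := sup E.
have yub (u : R) : E u -> u <= y by exact: (sup_upper_bound supE).
have x1y : x1 <= y by exact: yub.
have yx2 : y <= x2 by apply: ge_sup; [exists x1|move=> z [/andP[]]].
have yin : x1 <= y <= x2 by rewrite x1y yx2.
have cf := is_derive_continuous (dfx _ yin).
have fy : f y <= C.
  rewrite leNgt; apply/negP => Cfy.
  have /nbhs_ballP[d /= d0 Hd] : \forall z \near y, C < f z.
    by apply: (cf [set z | C < z]); exact: lt_nbhsr.
  have [z [zin fz] zy] := sup_adherent d0 supE.
  have zley : z <= y by apply: (sup_upper_bound supE); split.
  have : C < f z.
    by apply: Hd; rewrite /ball /= ger0_norm ?subr_ge0// ltrBlDr -ltrBlDl.
  by rewrite ltNge fz.
have yltx2 : y < x2.
  by rewrite lt_neqAle yx2 andbT; apply/eqP => yE; rewrite -yE ltNge fy in fx2.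
have /nbhs_ballP[d /= d0 Hd] : \forall z \near y, f z < C2.
  by apply: (cf [set z | z < C2]); apply: lt_nbhsl; exact: le_lt_trans CC2.
pose z : R := Num.min x2 (y + d / 2).
have yz : y < z by rewrite lt_min yltx2 ltrDl divr_gt0.
have zx2 : z <= x2 by rewrite ge_min lexx.
have zd : z <= y + d / 2 by rewrite ge_min lexx orbT.
clearbody y z; have inE' (u : R) : y < u <= z -> C < f u < C2.
  move=> /andP[yu uz]; apply/andP; split.
    rewrite ltNge; apply/negP => fu; move: (yu); rewrite ltNge => /negP; apply.
    apply: yub; split=> //.
    by apply/andP; split; lra.
  apply: Hd; rewrite /ball /= ltr_distlC.
  by apply/andP; split; lra.
have [||c] := @MVT _ f df y z yz.
- move=> u; rewrite in_itv /= => /andP[yu uz].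
  by apply: dfx; apply/andP; split; lra.
- apply: (@within_cont_of_derive f df) => u /andP[yu uz].
  by apply: dfx; apply/andP; split; lra.
rewrite in_itv /= => /andP[yc cz] fE.
have /andP[fz _] : C < f z < C2 by apply: inE'; rewrite yz lexx.
suff : df c * (z - y) <= 0 by lra.
rewrite mulr_le0_ge0 ?subr_ge0 ?(ltW yz)//; apply: dle; last first.
  by apply: inE'; rewrite yc ltW.
by apply/andP; split; lra.
Qed.

Lemma trap_left f df (x1 x2 C C2 : R) : x1 <= x2 -> C < C2 ->
  (forall x, x1 <= x <= x2 -> is_derive x 1 f (df x)) ->
  (forall x, x1 <= x <= x2 -> C < f x < C2 -> 0 <= df x) ->
  f x2 <= C -> f x1 <= C.
Proof.
move=> x12 CC2 dfx dge fx2.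
have := @trap_right (fun x => f (- x)) (fun x => - df (- x)) (- x2) (- x1) C C2.
rewrite !opprK; apply => //; first by rewrite lerN2.
- move=> x xin; apply: is_derive_reflect; apply: dfx.
  by rewrite lerNr lerNl andbC.
- move=> x xin fx; rewrite oppr_le0; apply: dge => //.
  by rewrite lerNr lerNl andbC.
Qed.

Lemma nonincreasing_closed f df (x1 x2 : R) : x1 <= x2 ->
  (forall x, x1 <= x <= x2 -> is_derive x 1 f (df x)) ->
  (forall x, x1 <= x <= x2 -> df x <= 0) -> f x2 <= f x1.
Proof.
move=> x12 dfx dle; have [c cin fE] := MVT_closed x12 dfx.
by rewrite -subr_le0 fE mulr_le0_ge0 ?subr_ge0// dle.
Qed.

(** Gronwall's inequality: the factor [expR (- K * (x - x1))] turns the growth hypothesis into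
    monotonicity. *)
Lemma expR_bound f df (K x1 x2 : R) : x1 <= x2 ->
  (forall x, x1 <= x <= x2 -> is_derive x 1 f (df x)) ->
  (forall x, x1 <= x <= x2 -> df x <= K * f x) ->
  f x2 <= f x1 * expR (K * (x2 - x1)).
Proof.
move=> x12 dfx dle.
pose F x := f x * expR (- K * (x - x1)).
have : F x2 <= F x1.
  apply: (@nonincreasing_closed F (fun x => (df x - K * f x) * expR (- K * (x - x1)))) => //.
    move=> x xin; have := dfx _ xin => dfx'; apply: is_derive_eq.
    by rewrite /GRing.scale /=; ring.
  by move=> x xin; rewrite mulr_le0_ge0 ?expR_ge0// subr_le0 dle.
rewrite /F subrr mulr0 expR0 mulr1 -ler_pdivlMr ?expR_gt0//.
by rewrite -expRN !mulNr opprK.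
Qed.

(** Gronwall applies to [f ^+ 2] with the constant [2 * N c], where [N c] is the maximum of [N] on
    the compact interval. *)
Lemma zero_linear_right f (N : R -> R) (x1 x2 : R) : x1 <= x2 ->
  (forall x, x1 <= x <= x2 -> is_derive x 1 f (N x * f x)) ->
  (forall x, x1 <= x <= x2 -> {for x, continuous N}) ->
  f x1 = 0 -> f x2 = 0.
Proof.
move=> x12 dfx cN f0.
have cN' : {within `[x1, x2], continuous N}.
  by apply: continuous_in_subspaceT => x; rewrite inE /= in_itv /=; apply: cN.
have [c cin Nle] := EVT_max x12 cN'.
have : f x2 ^+ 2 <= f x1 ^+ 2 * expR ((2 * N c) * (x2 - x1)).
  apply: (@expR_bound (fun x => f x ^+ 2) (fun x => 2 * N x * f x ^+ 2)) => //.
    move=> x xin; have dfx' := dfx _ xin; apply: is_derive_eq.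
    by rewrite /GRing.scale /=; ring.
  move=> x xin; rewrite ler_wpM2r ?sqr_ge0// ler_wpM2l//.
  by apply: Nle; rewrite in_itv.
by rewrite f0 expr0n mul0r real_exprn_even_le0//= ?num_real// => /eqP.
Qed.

(** All invariance assertions rest on this: along a solution, the quantity whose vanishing defines
    the set satisfies a homogeneous linear equation. Negative times are reached by reflection. *)
Lemma zero_linear f (N : R -> R) (J : set R) : is_interval J -> J 0 ->
  (forall x, J x -> is_derive x 1 f (N x * f x)) ->
  (forall x, J x -> {for x, continuous N}) ->
  f 0 = 0 -> forall x, J x -> f x = 0.
Proof.
move=> Ji J0 dfx cN f0 x Jx; have [x0|x0] := leP 0 x.
  apply: (@zero_linear_right f N 0 x) => // y yin.
    by apply: dfx; apply: (Ji 0 x).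
  by apply: cN; apply: (Ji 0 x).
rewrite -[x]opprK.
have Jm y : 0 <= y <= - x -> J (- y).
  by move=> yin; apply: (Ji x 0) => //; rewrite lerNr lerNl oppr0 andbC.
apply: (@zero_linear_right (fun y => f (- y)) (fun y => - N (- y)) 0 (- x)).
- by rewrite oppr_ge0 ltW.
- by move=> y /Jm Jy; rewrite mulNr; apply/is_derive_reflect/dfx.
- move=> y /Jm Jy; apply: continuousN; apply: continuous_comp; last exact: cN.
  exact: oppr_continuous.
- by rewrite oppr0.
Qed.

Lemma is_derive_component n (f : R -> 'rV[R]_n) (t : R) (d : 'rV[R]_n) (i : 'I_n) :
  is_derive t 1 f d -> is_derive t 1 (fun s => f s 0 i) (d 0 i).
Proof.
move=> [df dE]; move: dE; rewrite derive_mx// => <-; rewrite mxE.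
by apply/derivableP; move/derivable_mxP : df; exact.
Qed.

Lemma is_derive_row (V : normedModType R) n (f : V -> 'rV[R]_n) (x v : V) (d : 'rV[R]_n) :
  (forall i, is_derive x v (fun s => f s 0 i) (d 0 i)) -> is_derive x v f d.
Proof.
move=> df; have dfd : derivable f x v.
  by apply/derivable_mxP => i j; rewrite ord1; case: (df j).
apply: DeriveDef => //; rewrite derive_mx//; apply/matrixP => i j.
by rewrite mxE ord1; case: (df j).
Qed.

End RealAnalysis.

(** * Picard iteration *)

Section Antiderivative.
Variable R : realType.
Notation mu := (@lebesgue_measure R).

(** The base point [- M] lies to the left of both [0] and [y], so that negative arguments need no
    signed integral. [primitive] lets [M] vary with the argument, which [segment_integral_agree]
    makes harmless. *)
Definition segment_integral (f : R -> R) (M y : R) : R :=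
  \int[mu]_(t in `[- M, y]) f t - \int[mu]_(t in `[- M, 0]) f t.

Definition primitive (f : R -> R) (x : R) : R :=
  segment_integral f (`|x| + 1) x.

Lemma is_derive_segment_integral (f : R -> R) (M x : R) : continuous f ->
  `|x| < M -> is_derive x 1 (segment_integral f M) (f x).
Proof.
move=> cf; rewrite ltr_norml => /andP[Mx xM].
have intf : mu.-integrable `[- M, M] (EFin \o f).
  apply: continuous_compact_integrable; first exact: segment_compact.
  exact: continuous_subspaceT.
have [dI IE] := @continuous_FTC1_closed R f (- M) x M xM intf Mx (cf x).
have dIx : is_derive x 1 (fun y => \int[mu]_(t in `[- M, y]) f t) (f x).
  by apply: DeriveDef; [exact: dI|rewrite -derive1E].
by apply: is_derive_eq; rewrite subr0.
Qed.

Lemma segment_integral0 (f : R -> R) (M : R) : segment_integral f M 0 = 0.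
Proof. exact: subrr. Qed.

Lemma segment_integral_agree (f : R -> R) (M M' x : R) : continuous f ->
  `|x| < M -> `|x| < M' -> segment_integral f M x = segment_integral f M' x.
Proof.
move=> cf xM xM'.
pose D y := segment_integral f M y - segment_integral f M' y.
have dD (y : R) : `|y| <= `|x| -> is_derive y 1 D (f y - f y).
  move=> yx; apply: is_deriveB; apply: is_derive_segment_integral => //;
  exact: le_lt_trans yx _.
have D0 : D 0 = 0 by rewrite /D !segment_integral0 subrr.
suff : D x = 0 by move/eqP; rewrite subr_eq0 => /eqP.
have [x0|x0] := leP 0 x.
  have [|c _] := @MVT_closed _ D (fun y => f y - f y) 0 x x0.
    by move=> y /andP[y0 yx]; apply: dD; rewrite !ger0_norm.
  by rewrite D0 subrr mul0r subr0.
have [|c _] := @MVT_closed _ D (fun y => f y - f y) x 0 (ltW x0).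
  by move=> y /andP[y0 yx]; apply: dD; rewrite !ler0_norm ?lerN2 // ltW.
by rewrite D0 subrr mul0r sub0r => /eqP; rewrite oppr_eq0 => /eqP.
Qed.

Lemma is_derive_primitive (f : R -> R) (x : R) : continuous f ->
  is_derive x 1 (primitive f) (f x).
Proof.
move=> cf; apply: (@near_eq_is_derive _ _ _ (segment_integral f (`|x| + 2))).
  have x1 : `|x| < `|x| + 1 by rewrite ltrDl.
  have : \forall y \near x, `|y| < `|x| + 1.
    by apply: (@norm_continuous R R x [set r | r < `|x| + 1]); exact: lt_nbhsl.
  apply: filterS => y /= yx.
  apply: segment_integral_agree => //; last by rewrite ltrDl.
  by rewrite (lt_trans yx)// ltrD2l ltr1n.
by apply: is_derive_segment_integral => //; rewrite ltrDl.
Qed.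

Lemma primitive0 (f : R -> R) : primitive f 0 = 0.
Proof. exact: segment_integral0. Qed.

End Antiderivative.

Section Picard.
Variable R : realType.

Lemma geometric_limit (u : nat -> R) (C : R) :
  (forall n, `|u n.+1 - u n| <= C / 2 ^+ n) ->
  exists l, forall n, `|u n - l| <= 2 * C / 2 ^+ n.
Proof.
move=> du.
(* The intervals [[b n, a n]] are nested, because [2 * C / 2 ^+ n] is the sum of all steps still to
   come; their common point is the limit. *)
pose a n := u n + 2 * C / 2 ^+ n; pose b n := u n - 2 * C / 2 ^+ n.
have halve n : 2 * C / 2 ^+ n.+1 = C / 2 ^+ n.
  by rewrite exprS invfM mulrACA divff ?mul1r ?pnatr_eq0.
have dbl n : 2 * C / 2 ^+ n = C / 2 ^+ n + C / 2 ^+ n by rewrite -!mulrA -mulr2n mulr_natl.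
have aS n : a n.+1 <= a n.
  by have := du n; rewrite ler_norml /a halve dbl => /andP[]; lra.
have bS n : b n <= b n.+1.
  by have := du n; rewrite ler_norml /b halve dbl => /andP[]; lra.
have C0 n : 0 <= C / 2 ^+ n by apply: le_trans (du n).
have ba n : b n <= a n by have := C0 n; rewrite /a /b dbl; lra.
have am m n : (m <= n)%N -> a n <= a m.
  elim: n => [|n IH]; first by rewrite leqn0 => /eqP ->.
  by rewrite leq_eqVlt => /predU1P[->//|/IH]; apply: le_trans.
have bm m n : (m <= n)%N -> b m <= b n.
  elim: n => [|n IH]; first by rewrite leqn0 => /eqP ->.
  by rewrite leq_eqVlt => /predU1P[->//|/IH] h; apply: le_trans h _.
have bam m n : b m <= a n.
  apply: (le_trans (bm m (maxn m n) (leq_maxl _ _))).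
  exact: (le_trans (ba _) (am n (maxn m n) (leq_maxr _ _))).
have supb : has_sup (range b).
  by split; [exists (b 0%N), 0%N|exists (a 0%N) => _ [n _ <-]].
exists (sup (range b)) => n.
have lb : b n <= sup (range b) by apply: (sup_upper_bound supb); exists n.
have ub : sup (range b) <= a n by apply: ge_sup; [exists (b 0%N), 0%N|move=> _ [m _ <-]].
by rewrite ler_norml; move: lb ub; rewrite /a /b; lra.
Qed.

Lemma exp_growth_right (F g : R -> R) (M lam t : R) : 0 < lam -> 0 <= t ->
  0 <= M ->
  F 0 = 0 -> (forall s : R, is_derive s 1 F (g s)) ->
  (forall s, 0 <= s -> g s <= M * expR (lam * s)) ->
  F t <= M / lam * expR (lam * t).
Proof.
move=> lam0 t0 M0 F0 dF gM.
have : F t - M / lam * expR (lam * t) <= F 0 - M / lam * expR (lam * 0).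
  apply: (@nonincreasing_closed R (fun s => F s - M / lam * expR (lam * s))
    (fun s => g s - M * expR (lam * s)) 0 t) => // s /andP[s0 _]; last first.
    by rewrite subr_le0 gM.
  have dFs := dF s; apply: is_derive_eq; rewrite /GRing.scale /=; field.
  exact: lt0r_neq0.
rewrite F0 mulr0 expR0 mulr1 sub0r => H.
have : 0 <= M / lam by rewrite divr_ge0// ltW.
by lra.
Qed.

(** Integration divides a bound in the weight [expR (lam * |s|)] by [lam]. This makes Picard's
    operator a contraction on the whole line, without shrinking the time interval. *)
Lemma exp_growth (F g : R -> R) (M lam : R) : 0 < lam ->
  F 0 = 0 -> (forall s : R, is_derive s 1 F (g s)) ->
  (forall s, `|g s| <= M * expR (lam * `|s|)) ->
  forall t, `|F t| <= M / lam * expR (lam * `|t|).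
Proof.
move=> lam0 F0 dF gM t.
have M0 : 0 <= M.
  by have := le_trans (normr_ge0 _) (gM 0); rewrite normr0 mulr0 expR0 mulr1.
have dFm (s : R) : is_derive s 1 (fun y => F (- y)) (- g (- s)) by exact: is_derive_reflect.
have dN (f h : R -> R) : (forall s : R, is_derive s 1 f (h s)) ->
    forall s : R, is_derive s 1 (fun y => - f y) (- h s).
  by move=> df s; apply: is_deriveN.
rewrite ler_norml lerNl; apply/andP.
have [t0|t0] := leP 0 t.
  rewrite [`|t|]ger0_norm//; split.
    apply: (@exp_growth_right (fun y => - F y) (fun y => - g y)) => //.
    - by rewrite F0 oppr0.
    - move=> s s0; have := gM s; rewrite ler_norml [`|s|]ger0_norm// => /andP[]; lra.
  apply: (@exp_growth_right F g) => // s s0.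
  by have := gM s; rewrite ler_norml [`|s|]ger0_norm// => /andP[].
rewrite ltr0_norm// -{1 3}(opprK t); split.
  apply: (@exp_growth_right (fun y => - F (- y)) (fun y => - (- g (- y)))) => //.
  - by rewrite oppr_ge0 ltW.
  - by rewrite oppr0 F0 oppr0.
  - move=> s s0; rewrite opprK; have := gM (- s).
    by rewrite normrN ler_norml [`|s|]ger0_norm// => /andP[].
apply: (@exp_growth_right (fun y => F (- y)) (fun y => (- g (- y)))) => //.
- by rewrite oppr_ge0 ltW.
- by rewrite oppr0 F0.
- move=> s s0; have := gM (- s).
  by rewrite normrN ler_norml [`|s|]ger0_norm// => /andP[]; lra.
Qed.

Variables (f1 f2 : R -> R -> R) (L : R).
Hypothesis L0 : 0 < L.
Definition lipschitz2 (f : R -> R -> R) (K : R) := forall x y x' y',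
  `|f x y - f x' y'| <= K * (`|x - x'| + `|y - y'|).
Hypothesis f1L : lipschitz2 f1 L.
Hypothesis f2L : lipschitz2 f2 L.

Lemma lipschitz2_continuous f (x y : R -> R) : lipschitz2 f L ->
  continuous x -> continuous y -> continuous (fun t => f (x t) (y t)).
Proof.
move=> fL cx cy t; apply/cvgrPdist_le => /= e e0.
have e' : 0 < e / (2 * L) by rewrite divr_gt0// mulr_gt0.
move/cvgrPdist_le : (cx t) => /(_ _ e') hx; move/cvgrPdist_le : (cy t) => /(_ _ e').
move: hx; apply: filterS2 => s xs ys; apply: (le_trans (fL _ _ _ _)).
have -> : e = L * (e / (2 * L) + e / (2 * L)) by field; exact: lt0r_neq0.
by rewrite ler_pM2l// lerD.
Qed.

Variables p q : R.

Fixpoint picard (n : nat) : (R -> R) * (R -> R) :=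
  if n is m.+1 then
    (fun t => p + primitive (fun s => f1 ((picard m).1 s) ((picard m).2 s)) t,
     fun t => q + primitive (fun s => f2 ((picard m).1 s) ((picard m).2 s)) t)
  else (fun=> p, fun=> q).

Lemma continuous_primitiveD (c : R) (f : R -> R) : continuous f ->
  continuous (fun t => c + primitive f t).
Proof.
move=> cf t; apply: (@is_derive_continuous _ _ _ _ (0 + f t)).
by apply: is_deriveD; exact: is_derive_primitive.
Qed.

Lemma picard_continuous n : continuous (picard n).1 /\ continuous (picard n).2.
Proof.
elim: n => [|n [IH1 IH2]] /=; first by split=> t; exact: cvg_cst.
by split; apply: continuous_primitiveD; exact: lipschitz2_continuous.
Qed.

(* In the weight [expR (lam * `|t|)] Picard's operator contracts by a factor 2. *)
Let lam := 4 * L.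
Let C0 := (`|f1 p q| + `|f2 p q|) / lam.

Let lam0 : 0 < lam. Proof. by rewrite mulr_gt0. Qed.

Lemma primitive_dist (c M : R) (f g : R -> R) : continuous f -> continuous g ->
  (forall s, `|f s - g s| <= M * expR (lam * `|s|)) ->
  forall t, `|(c + primitive f t) - (c + primitive g t)| <= M / lam * expR (lam * `|t|).
Proof.
move=> cf cg fg t; rewrite opprD addrACA subrr add0r.
apply: (@exp_growth (fun t => primitive f t - primitive g t)
  (fun t => f t - g t)) => //.
  by rewrite !primitive0 subrr.
by move=> s; apply: is_deriveB; exact: is_derive_primitive.
Qed.

Lemma picard_step n t :
  `|(picard n.+1).1 t - (picard n).1 t| + `|(picard n.+1).2 t - (picard n).2 t|
  <= C0 * expR (lam * `|t|) / 2 ^+ n.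
Proof.
elim: n t => [t|n IH t].
  have e1 s : 1 <= expR (lam * `|s|) by rewrite -expR0 ler_expR mulr_ge0// ltW.
  have H (c k : R) : `|c + primitive (fun=> k) t - c| <= `|k| / lam * expR (lam * `|t|).
    rewrite addrC addKr.
    apply: (@exp_growth _ (fun=> k)) => //; first exact: primitive0.
      by move=> s; apply: is_derive_primitive => x; exact: cvg_cst.
    by move=> s; rewrite ler_peMr.
  rewrite expr0 divr1 /= {1}/C0 !mulrDl; exact: lerD (H p (f1 p q)) (H q (f2 p q)).
have [cn1 cn2] := picard_continuous n; have [cm1 cm2] := picard_continuous n.+1.
pose M := L * (C0 / 2 ^+ n).
have H (f : R -> R -> R) (c : R) : lipschitz2 f L ->
    `|(c + primitive (fun s => f ((picard n.+1).1 s) ((picard n.+1).2 s)) t) -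
      (c + primitive (fun s => f ((picard n).1 s) ((picard n).2 s)) t)|
    <= M / lam * expR (lam * `|t|).
  move=> fL; apply: primitive_dist; [exact: lipschitz2_continuous..|].
  move=> s; apply: (le_trans (fL _ _ _ _)); rewrite /M -mulrA ler_pM2l//.
  by apply: (le_trans (IH s)); rewrite mulrAC.
(* Since [L / lam = 1 / 4], each component contributes a quarter of the previous distance, and the
   two together a half. *)
have -> : C0 * expR (lam * `|t|) / 2 ^+ n.+1 =
    M / lam * expR (lam * `|t|) + M / lam * expR (lam * `|t|).
  rewrite /M exprS; have l0 := lt0r_neq0 L0; rewrite /lam; field.
  by rewrite l0 expf_neq0 // pnatr_eq0.
exact: lerD (H f1 p f1L) (H f2 q f2L).
Qed.

Let bnd (n : nat) (t : R) := 2 * (C0 * expR (lam * `|t|)) / 2 ^+ n.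

Lemma picard_limit : exists x y : R -> R, forall n t,
  `|(picard n).1 t - x t| <= bnd n t /\ `|(picard n).2 t - y t| <= bnd n t.
Proof.
have H1 (t : R) : exists l, forall n, `|(picard n).1 t - l| <= bnd n t.
  apply: geometric_limit => n; apply: le_trans (picard_step n t).
  by rewrite lerDl.
have H2 (t : R) : exists l, forall n, `|(picard n).2 t - l| <= bnd n t.
  apply: geometric_limit => n; apply: le_trans (picard_step n t).
  by rewrite lerDr.
have [x Hx] := choice H1; have [y Hy] := choice H2.
by exists x, y => n t.
Qed.

Lemma small_over_pow2 (c e : R) : 0 < e -> exists n : nat, c / 2 ^+ n <= e.
Proof.
move=> e0; have [n cn] : exists n : nat, c / e <= n%:R.
  exists (Num.bound (c / e)); have [c0|c0] := leP 0 (c / e).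
    by rewrite ltW// archi_boundP.
  by rewrite (le_trans (ltW c0)).
exists n; rewrite ler_pdivrMr ?exprn_gt0// mulrC -ler_pdivrMr//.
apply: (le_trans cn); rewrite -natrX ler_nat; exact: ltnW (ltn_expl _ _).
Qed.

Lemma C0_ge0 : 0 <= C0.
Proof. by rewrite divr_ge0 ?addr_ge0// ltW. Qed.

Lemma picard_limit_continuous (u : nat -> R -> R) (x : R -> R) :
  (forall n, continuous (u n)) -> (forall n t, `|u n t - x t| <= bnd n t) ->
  continuous x.
Proof.
move=> cu ux t; apply/cvgrPdist_le => /= e e0.
have e3 : 0 < e / 3 by rewrite divr_gt0.
(* The index is chosen for the weight at [|t| + 1], which bounds the error uniformly for all [s]
   near [t]; the usual three-term estimate follows. *)
have [n nP] := small_over_pow2 (2 * (C0 * expR (lam * (`|t| + 1)))) e3.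
have near_bnd s : `|s| <= `|t| + 1 -> `|u n s - x s| <= e / 3.
  move=> st; apply: (le_trans (ux n s)); apply: le_trans nP.
  rewrite ler_wpM2r ?invr_ge0 ?exprn_ge0// ler_wpM2l// ler_wpM2l ?C0_ge0//.
  by rewrite ler_expR ler_pM2l.
move/cvgrPdist_le : (cu n t) => /(_ _ e3).
have : \forall s \near t, `|s| < `|t| + 1.
  apply: (@norm_continuous R R t [set r | r < `|t| + 1]); apply: lt_nbhsl.
  by rewrite ltrDl.
apply: filterS2 => s /ltW st uts.
have h1 := near_bnd s st; have h2 : `|u n t - x t| <= e / 3.
  by apply: near_bnd; rewrite lerDl.
have -> : x t - x s = (u n s - x s) - (u n t - x t) + (u n t - u n s) by ring.
have -> : e = e / 3 + e / 3 + e / 3 by field.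
apply: (le_trans (ler_normD _ _)); apply: lerD => //.
by apply: (le_trans (ler_normB _ _)); apply: lerD.
Qed.

(** [w] stands for the component under consideration: the lemma is used with [w = x] for [f1] and
    with [w = y] for [f2]. *)
Lemma picard_fixpoint (f : R -> R -> R) (c : R) (u v : nat -> R -> R) (x y : R -> R) :
  lipschitz2 f L ->
  (forall n, continuous (u n)) -> (forall n, continuous (v n)) ->
  continuous x -> continuous y ->
  (forall n t, `|u n t - x t| <= bnd n t) -> (forall n t, `|v n t - y t| <= bnd n t) ->
  forall w : R -> R,
  (forall n t, `|c + primitive (fun s => f (u n s) (v n s)) t - w t| <= bnd n.+1 t) ->
  w = (fun t => c + primitive (fun s => f (x s) (y s)) t).
Proof.
move=> fL cu cv cx cy ux vy w wP; apply/funext => t; apply/eqP.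
rewrite -subr_eq0 -normr_le0; apply/ler_addgt0Pl => e e0; rewrite addr0.
have [n nP] := small_over_pow2 (2 * (C0 * expR (lam * `|t|))) e0.
apply: le_trans nP.
have fuv : continuous (fun s => f (u n s) (v n s)) by exact: lipschitz2_continuous.
have fxy : continuous (fun s => f (x s) (y s)) by exact: lipschitz2_continuous.
(* The Lipschitz bound gives [L * (bnd n s + bnd n s)], that is [4 * L * (C0 / 2 ^+ n)] times the
   weight; division by [lam = 4 * L] leaves half of the target, and [bnd n.+1] is the other half. *)
have := @primitive_dist c (4 * L * (C0 / 2 ^+ n)) _ _ fuv fxy.
move=> /(_ _ t); set A := c + _; set B := c + _ => H.
have -> : w t - B = (A - B) - (A - w t) by ring.
apply: (le_trans (ler_normB _ _)); apply: (le_trans (lerD (H _) (wP n t))).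
  move=> s; apply: (le_trans (fL _ _ _ _)).
  apply: (@le_trans _ _ (L * (bnd n s + bnd n s))).
    by rewrite ler_pM2l// lerD.
  by rewrite /bnd le_eqVlt; apply/orP; left; apply/eqP; ring.
rewrite /bnd exprS; have l0 := lt0r_neq0 L0; rewrite /lam.
rewrite le_eqVlt; apply/orP; left; apply/eqP; field.
by rewrite l0 expf_neq0 // pnatr_eq0.
Qed.

Theorem picard_lindelof : exists x y : R -> R, [/\ x 0 = p, y 0 = q,
  forall t : R, is_derive t 1 x (f1 (x t) (y t)) &
  forall t : R, is_derive t 1 y (f2 (x t) (y t))].
Proof.
have [x [y xy]] := picard_limit.
have ux n t : `|(picard n).1 t - x t| <= bnd n t by case: (xy n t).
have vy n t : `|(picard n).2 t - y t| <= bnd n t by case: (xy n t).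
have cu n : continuous (picard n).1 by case: (picard_continuous n).
have cv n : continuous (picard n).2 by case: (picard_continuous n).
have cx := picard_limit_continuous cu ux; have cy := picard_limit_continuous cv vy.
have xE := picard_fixpoint f1L cu cv cx cy ux vy (fun n t => ux n.+1 t : `|p + _ - _| <= _).
have yE := picard_fixpoint f2L cu cv cx cy ux vy (fun n t => vy n.+1 t : `|q + _ - _| <= _).
have dP (f : R -> R -> R) (c t : R) : lipschitz2 f L ->
    is_derive t 1 (fun t => c + primitive (fun s => f (x s) (y s)) t) (f (x t) (y t)).
  move=> fL; rewrite -[X in is_derive _ _ _ X]add0r; apply: is_deriveD.
  by apply: (@is_derive_primitive R (fun s => f (x s) (y s))); exact: lipschitz2_continuous.
exists x, y; split.
- by rewrite xE primitive0 addr0.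
- by rewrite yE primitive0 addr0.
- by move=> t; rewrite [X in is_derive _ _ X _]xE; exact: dP.
- by move=> t; rewrite [X in is_derive _ _ X _]yE; exact: dP.
Qed.

End Picard.

(** * Bounded Lipschitz fields and truncation *)

Section BoundedLipschitz.
Variable R : realType.
Implicit Types f g : R -> R -> R.

(** Boundedness closes the class under products, so that every polynomial in clamped variables is a
    globally Lipschitz field. *)
Definition bounded_lipschitz f := exists K M : R,
  [/\ 0 <= K, 0 <= M, lipschitz2 f K & forall x y, `|f x y| <= M].

Lemma bounded_lipschitz_cst (k : R) : bounded_lipschitz (fun _ _ => k).
Proof.
exists 0, `|k|; split=> // x y x' y'.
by rewrite subrr normr0 mul0r.
Qed.

Lemma bounded_lipschitzD f g : bounded_lipschitz f -> bounded_lipschitz g ->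
  bounded_lipschitz (fun x y => f x y + g x y).
Proof.
move=> [K [M [K0 M0 fK fM]]] [K' [M' [K'0 M'0 gK gM]]].
exists (K + K'), (M + M'); split; rewrite ?addr_ge0//.
  move=> x y x' y'; rewrite opprD addrACA mulrDl.
  by apply: (le_trans (ler_normD _ _)); apply: lerD.
by move=> x y; apply: (le_trans (ler_normD _ _)); apply: lerD.
Qed.

Lemma bounded_lipschitzM f g : bounded_lipschitz f -> bounded_lipschitz g ->
  bounded_lipschitz (fun x y => f x y * g x y).
Proof.
move=> [K [M [K0 M0 fK fM]]] [K' [M' [K'0 M'0 gK gM]]].
exists (K * M' + M * K'), (M * M'); split; rewrite ?addr_ge0 ?mulr_ge0//.
  move=> x y x' y' /=; set d := `|x - x'| + _.
  have -> : f x y * g x y - f x' y' * g x' y' =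
    (f x y - f x' y') * g x y + f x' y' * (g x y - g x' y') by ring.
  apply: (le_trans (ler_normD _ _)); rewrite !normrM mulrDl; apply: lerD.
    by rewrite mulrAC ler_pM.
  by rewrite -mulrA ler_pM.
by move=> x y; rewrite normrM ler_pM.
Qed.

Definition clamp (l u x : R) : R := Num.max l (Num.min u x).

Lemma clamp_id (l u x : R) : l <= x <= u -> clamp l u x = x.
Proof. by move=> /andP[lx xu]; rewrite /clamp min_r// max_r. Qed.

Lemma clamp_in (l u x : R) : l <= u -> l <= clamp l u x <= u.
Proof. by move=> lu; rewrite /clamp le_max lexx ge_max lu ge_min lexx. Qed.

Lemma clamp_dist (l u x y : R) : `|clamp l u x - clamp l u y| <= `|x - y|.
Proof.
have [le1 le2] : y - x <= `|x - y| /\ x - y <= `|x - y|.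
  by split; [rewrite distrC|]; exact: ler_norm.
rewrite ler_norml /clamp /Num.max /Num.min.
case: (ltP u x) => ux; case: (ltP u y) => uy; do ![case: (ltP l _) => ?];
by apply/andP; split; lra.
Qed.

Lemma bounded_lipschitz_comp1 (l u : R) (f : R -> R) (K : R) : l <= u -> 0 <= K ->
  (forall x y, l <= x <= u -> l <= y <= u -> `|f x - f y| <= K * `|x - y|) ->
  bounded_lipschitz (fun x _ => f (clamp l u x)) /\
  bounded_lipschitz (fun _ y => f (clamp l u y)).
Proof.
move=> lu K0 fK.
have bd x : `|f (clamp l u x)| <= `|f l| + K * (u - l).
  have cx := clamp_in x lu; have ll : l <= l <= u by rewrite lexx.
  have := fK _ _ cx ll; rewrite -[X in `|X| <= _ -> _]addr0 => H.
  have -> : f (clamp l u x) = f l + (f (clamp l u x) - f l) by ring.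
  apply: (le_trans (ler_normD _ _)); rewrite lerD2l.
  rewrite addr0 in H; apply: (le_trans H); rewrite ler_wpM2l//.
  by case/andP: cx => ? ?; rewrite ger0_norm ?subr_ge0// lerD2r.
have b0 : 0 <= `|f l| + K * (u - l) by apply: le_trans (bd l).
have lip x y : `|f (clamp l u x) - f (clamp l u y)| <= K * `|x - y|.
  apply: (le_trans (fK _ _ (clamp_in _ lu) (clamp_in _ lu))).
  by rewrite ler_wpM2l// clamp_dist.
by split; exists K, (`|f l| + K * (u - l)); split=> // x y x' y';
  apply: (le_trans (lip _ _)); rewrite ler_wpM2l// (lerDl, lerDr).
Qed.

Lemma bounded_lipschitz_clamp (l u : R) : l <= u ->
  bounded_lipschitz (fun x _ => clamp l u x) /\
  bounded_lipschitz (fun _ y => clamp l u y).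
Proof.
by move=> lu; apply: (@bounded_lipschitz_comp1 l u id 1) => // x y _ _; rewrite mul1r.
Qed.

Lemma picard_bounded_lipschitz f g : bounded_lipschitz f -> bounded_lipschitz g ->
  forall p q, exists x y : R -> R, [/\ x 0 = p, y 0 = q,
  forall t : R, is_derive t 1 x (f (x t) (y t)) &
  forall t : R, is_derive t 1 y (g (x t) (y t))].
Proof.
move=> [K [_ [K0 _ fK _]]] [K' [_ [K'0 _ gK _]]] p q.
apply: (@picard_lindelof R f g (K + K' + 1)); first by rewrite ltr_wpDl ?addr_ge0.
  move=> x y x' y'; apply: (le_trans (fK _ _ _ _)).
  by rewrite ler_wpM2r ?addr_ge0// -addrA lerDl addr_ge0.
move=> x y x' y'; apply: (le_trans (gK _ _ _ _)).
by rewrite ler_wpM2r ?addr_ge0// addrAC lerDr addr_ge0.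
Qed.

End BoundedLipschitz.

(** * Entries, norms and derivatives of row vectors *)

Section Rows.
Variable R : realType.

Lemma row2E0 (a b : R) : row2 a b 0 0 = a. Proof. by rewrite mxE. Qed.
Lemma row2E1 (a b : R) : row2 a b 0 1 = b. Proof. by rewrite mxE. Qed.
Definition row2E := (row2E0, row2E1).

Lemma ord2_cases (P : 'I_2 -> Prop) : P 0 -> P 1 -> forall i, P i.
Proof.
move=> P0 P1 [[|[|m]] i] //.
  by have -> : Ordinal i = 0 by apply: val_inj.
by have -> : Ordinal i = 1 by apply: val_inj.
Qed.

Lemma row2_eta (q : 'rV[R]_2) : q = row2 (q 0 0) (q 0 1).
Proof.
by apply/rowP; apply: ord2_cases; rewrite row2E.
Qed.

Lemma norm_row_entry n (q : 'rV[R]_n) (i : 'I_n) : `|q 0 i| <= `|q|.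
Proof.
rewrite [leRHS]/Num.Def.normr /= mx_normrE.
exact: (le_bigmax _ (fun i => `|q i.1 i.2|) (0, i)).
Qed.

Lemma norm_row_le n (q : 'rV[R]_n) (d : R) : 0 <= d ->
  (forall i, `|q 0 i| <= d) -> `|q| <= d.
Proof.
move=> d0 qd; rewrite [leLHS]/Num.Def.normr /= mx_normrE.
by apply: bigmax_le => // -[i j] _; rewrite ord1.
Qed.

Lemma norm_row_lt n (q : 'rV[R]_n) (d : R) : 0 < d ->
  (forall i, `|q 0 i| < d) -> `|q| < d.
Proof.
move=> d0 qd; rewrite [ltLHS]/Num.Def.normr /= mx_normrE.
by apply: bigmax_lt => // -[i j] _; rewrite ord1.
Qed.

Lemma is_derive_row2 (V : normedModType R) (f g : V -> R) (x v : V) (df dg : R) :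
  is_derive x v f df -> is_derive x v g dg ->
  is_derive x v (fun s => row2 (f s) (g s)) (row2 df dg).
Proof.
move=> fd gd; apply: is_derive_row; apply: ord2_cases; rewrite row2E;
by under eq_fun do rewrite row2E.
Qed.

End Rows.

(** * Invariant graphs of the planar system *)

Section PlanarSystem.
Variable R : realType.
Variables a B b c : R.

Definition planar (q : 'rV[R]_2) : 'rV[R]_2 :=
  row2 (B * q 0 0 * q 0 1) (a * q 0 1 + b * q 0 0 ^+ 2 + c * q 0 1 ^+ 2).

Definition invariance_equation (h : R -> R) (v : R) :=
  B * v * h v * derive1 h v = a * h v + b * v ^+ 2 + c * h v ^+ 2.

Definition invariant_graph (h : R -> R) (r : R) := [/\ 0 < r,
  h 0 = 0 /\ derive1 h 0 = 0,
  forall v, `|v| < r -> derivable h v 1 /\ {for v, continuous (derive1 h)} &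
  forall v, `|v| < r -> invariance_equation h v].

Lemma planar_solution (J : set R) (phi : R -> 'rV[R]_2) (t : R) :
  is_solution planar J phi -> J t ->
  is_derive t 1 (fun s => phi s 0 0) (B * phi t 0 0 * phi t 0 1) /\
  is_derive t 1 (fun s => phi s 0 1)
    (a * phi t 0 1 + b * phi t 0 0 ^+ 2 + c * phi t 0 1 ^+ 2).
Proof.
move=> sol Jt; have := sol t Jt => d.
have := is_derive_component 0 d; have := is_derive_component 1 d.
by rewrite !row2E.
Qed.

Lemma is_derive_of_derivable (h : R -> R) (v : R) :
  derivable h v 1 -> is_derive v 1 h (derive1 h v).
Proof. by move=> /derivableP; rewrite derive1E. Qed.

Lemma center_manifold_of_graph (h : R -> R) (r : R) :
  invariant_graph h r -> center_manifold planar h.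
Proof.
move=> [r0 h0 dh inv]; exists r; split=> // J phi _ Ji J0 sol Jr /= phi0 t Jt.
pose v s := phi s 0 0; pose w s := phi s 0 1.
apply/eqP; rewrite -subr_eq0; apply/eqP.
(* After subtraction of the invariance equation at [v s], the derivative of [w - h v] is divisible
   by [w - h v]; [N] is the cofactor. *)
pose N s := a + c * (w s + h (v s)) - derive1 h (v s) * B * v s.
have dv s : J s -> is_derive s 1 v (B * v s * w s).
  by move=> Js; case: (planar_solution sol Js).
have dw s : J s -> is_derive s 1 w (a * w s + b * v s ^+ 2 + c * w s ^+ 2).
  by move=> Js; case: (planar_solution sol Js).
have dhv s : J s -> is_derive s 1 (fun s => h (v s)) (derive1 h (v s) * (B * v s * w s)).
  move=> Js; have [dhs _] := dh _ (Jr s Js).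
  exact: (is_derive1_comp (is_derive_of_derivable dhs) (dv s Js)).
apply: (@zero_linear R (fun s => w s - h (v s)) N J) => //.
- move=> s Js.
  have -> : N s * (w s - h (v s)) =
    (a * w s + b * v s ^+ 2 + c * w s ^+ 2) - derive1 h (v s) * (B * v s * w s).
    have := inv _ (Jr s Js); rewrite /N /invariance_equation -/(v s) => iE.
    have -> : b * v s ^+ 2 = B * v s * h (v s) * derive1 h (v s) - a * h (v s) - c * h (v s) ^+ 2.
      by rewrite iE; ring.
    by ring.
  by apply: is_deriveB; [exact: dw|exact: dhv].
- move=> s Js; have cv := is_derive_continuous (dv s Js); have cw := is_derive_continuous (dw s Js).
  have chv := is_derive_continuous (dhv s Js).
  have [_ cdh] := dh _ (Jr s Js).
  have cdhv : {for s, continuous (fun s => derive1 h (v s))}.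
    exact: (continuous_comp cv cdh).
  apply: cvgB.
    by apply: cvgD; [exact: cvg_cst|apply: cvgM; [exact: cvg_cst|exact: cvgD]].
  by apply: cvgM => //; apply: cvgM => //; exact: cvg_cst.
- by rewrite /w /v phi0 subrr.
Qed.

Lemma near_ball_lt (x : R -> R) (d : R) : {for 0, continuous x} -> `|x 0| < d ->
  \forall t \near (0 : R), `|x t| < d.
Proof.
move=> cx xd; have cn : {for 0, continuous (fun t => `|x t|)}.
  by apply: continuous_comp cx _; exact: norm_continuous.
by apply: (cn [set r | r < d]); exact: lt_nbhsl.
Qed.

Lemma planar_local_solution (p q r : R) : `|p| < r ->
  exists (J : set R) (phi : R -> 'rV[R]_2), [/\ open J, is_interval J /\ J 0,
    is_solution planar J phi, phi 0 = row2 p q &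
    forall t, J t -> `|phi t 0 0| < r].
Proof.
(* Both initial coordinates lie strictly inside [[- k, k]]. As long as the solution of the clamped
   field stays there it solves the planar system, and [J] is an interval on which this holds
   together with the bound by [r]. *)
move=> pr; pose k := `|p| + `|q| + 1.
have k0 : - k <= k.
  have : 0 <= `|p| by []. have : 0 <= `|q| by []. rewrite /k; lra.
have [blx bly] := bounded_lipschitz_clamp k0.
have blc (e : R) := bounded_lipschitz_cst e.
have bl1 := bounded_lipschitzM (bounded_lipschitzM (blc B) blx) bly.
have bl2 := bounded_lipschitzD (bounded_lipschitzD (bounded_lipschitzM (blc a) bly)
  (bounded_lipschitzM (blc b) (bounded_lipschitzM blx blx)))
  (bounded_lipschitzM (blc c) (bounded_lipschitzM bly bly)).
have [x [y [x0 y0 dx dy]]] := picard_bounded_lipschitz bl1 bl2 p q.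
have cx := is_derive_continuous (dx 0); have cy := is_derive_continuous (dy 0).
have xr : \forall t \near (0 : R), `|x t| < r by apply: near_ball_lt; rewrite ?x0.
have xk : \forall t \near (0 : R), `|x t| < k.
  by apply: near_ball_lt => //; rewrite x0 /k -addrA ltrDl ltr_wpDl.
have yk : \forall t \near (0 : R), `|y t| < k.
  by apply: near_ball_lt => //; rewrite y0 /k addrAC ltrDr ltr_wpDl.
have /nbhs_ballP[d /= d0 Hd] : \forall t \near (0 : R), [/\ `|x t| < r, `|x t| < k & `|y t| < k].
  by near=> t; split; near: t.
have dP t : `|t| < d -> [/\ `|x t| < r, `|x t| < k & `|y t| < k].
  by move=> td; apply: Hd; rewrite /ball /= sub0r normrN.
exists `]- d, d[%classic, (fun t => row2 (x t) (y t)).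
have Jd t : `]- d, d[%classic t -> `|t| < d by rewrite /= in_itv /= ltr_norml.
split.
- exact: interval_open.
- split; first exact: interval_is_interval.
  by rewrite /= in_itv /= oppr_lt0 d0.
- move=> t /Jd /dP[_ xtk ytk]; rewrite /planar !row2E; apply: is_derive_row2.
    by have := dx t; rewrite !clamp_id // -?ler_norml ltW.
  by have := dy t; rewrite !clamp_id // -?ler_norml ?ltW // -!expr2.
- by rewrite x0 y0.
- by move=> t /Jd /dP[]; rewrite row2E.
Unshelve. all: by end_near. Qed.

Lemma graph_of_center_manifold (h : R -> R) :
  center_manifold planar h -> exists r, invariant_graph h r.
Proof.
move=> [r [r0 h0 dh inv]]; exists r; split=> // v0 v0r.
have [J [phi [Jo [Ji J0] sol phi0 Jr]]] := planar_local_solution (h v0) v0r.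
have graph := inv J phi Jo Ji J0 sol Jr; rewrite /= phi0 !row2E in graph.
have {}graph t : J t -> phi t 0 1 = h (phi t 0 0) by apply: graph.
have [dv dw] := planar_solution sol J0.
have [dhv _] := dh _ v0r.
rewrite phi0 !row2E in dv dw.
have dhc : is_derive (0 : R) 1 (fun s => h (phi s 0 0)) (derive1 h v0 * (B * v0 * h v0)).
  apply: (@is_derive1_comp _ h (fun s => phi s 0 0)) => //.
  by rewrite phi0 row2E; exact: is_derive_of_derivable.
(* The two coordinates are linked by [h] throughout [J], so both computations of the derivative at
   time 0 agree; this is the invariance equation at [v0]. *)
have dhc' : is_derive (0 : R) 1 (fun s => phi s 0 1) (derive1 h v0 * (B * v0 * h v0)).
  apply: near_eq_is_derive dhc.
  have : \forall t \near (0 : R), J t by exact: open_nbhs_nbhs.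
  by apply: filterS => t /graph.
rewrite /invariance_equation -(@derive_val _ _ _ _ _ _ _ dw).
by rewrite (@derive_val _ _ _ _ _ _ _ dhc'); ring.
Qed.

End PlanarSystem.

(** * Expansion of invariant graphs at the origin *)

Section Expansion.
Variable R : realType.
Variables a B b c : R.
Hypothesis a0 : a != 0.

(** The planar system is unchanged by [v -> - v], so that estimates for [v > 0] suffice. *)
Lemma invariant_graph_reflect (h : R -> R) (r : R) :
  invariant_graph a B b c h r -> invariant_graph a B b c (fun v => h (- v)) r.
Proof.
move=> [r0 [h0 h'0] dh inv].
have dE v : `|v| < r -> derive1 (fun v => h (- v)) v = - derive1 h (- v).
  move=> vr; have [|d _] := dh (- v); first by rewrite normrN.
  rewrite derive1E; apply: derive_val.
  exact: (is_derive_reflect (is_derive_of_derivable d)).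
split=> //.
- by split; [rewrite oppr0|rewrite dE ?normr0// oppr0 h'0 oppr0].
- move=> v vr; have [|d cd] := dh (- v); first by rewrite normrN.
  split; first by have [] := is_derive_reflect (is_derive_of_derivable d).
  have near_r : \forall s \near v, `|s| < r.
    by apply: (@norm_continuous R R v [set s | s < r]); exact: lt_nbhsl.
  have cd' : {for v, continuous (fun v => - derive1 h (- v))}.
    by apply: cvgN; apply: (continuous_comp (@oppr_continuous _ _ v)).
  suff : (fun v => h (- v))^`()%classic x @[x --> v] --> (fun v => h (- v))^`()%classic v by [].
  have -> := dE _ vr; apply: cvg_trans cd'.
  apply: near_eq_cvg; apply: filterS near_r => s sr; exact/esym/dE.
- move=> v vr; have := inv (- v); rewrite normrN => /(_ vr).
  by rewrite /invariance_equation dE// sqrrN => <-; ring.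
Qed.

(* Since [h] is [C^1] with [h 0 = h' 0 = 0], the terms [c h^2] and [B v h h']
   of the invariance equation are dominated by [a h]. *)
Lemma graph_quadratic_bound (h : R -> R) (r : R) : invariant_graph a B b c h r ->
  exists rho K : R, [/\ 0 < rho <= 1, rho <= r,
    0 <= K, forall v, `|v| < rho -> `|h v| <= 2 * `|b| / `|a| * `|v| ^+ 2 &
    forall v, `|v| < rho -> `|h v + b / a * v ^+ 2| <= K * `|v| ^+ 3].
Proof.
move=> [r0 [h0 h'0] dh inv].
have na : 0 < `|a| by rewrite normr_gt0.
(* With [|h'| <= eta], hence [|h v| <= eta * |v|], the nonlinear terms are at most
   [(|B| + |c|) * eta * |h v|], which is at most half of [|a| * |h v|] and can be absorbed. *)
pose eta := Num.min 1 (`|a| / (2 * (`|B| + `|c| + 1))).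
have s0 : 0 < `|B| + `|c| + 1 by rewrite ltr_wpDl ?addr_ge0.
have eta0 : 0 < eta by rewrite lt_min ltr01 divr_gt0// mulr_gt0.
have eta1 : eta <= 1 by rewrite ge_min lexx.
have etaa : (`|B| + `|c|) * eta <= `|a| / 2.
  apply: (@le_trans _ _ ((`|B| + `|c| + 1) * eta)).
    by rewrite ler_wpM2r ?(ltW eta0)// lerDl.
  have : eta <= `|a| / (2 * (`|B| + `|c| + 1)) by rewrite ge_min lexx orbT.
  move=> /(ler_wpM2l (ltW s0)) H; apply: (le_trans H).
  by rewrite le_eqVlt; apply/orP; left; apply/eqP; field; exact: lt0r_neq0.
have cd0 : {for 0, continuous (derive1 h)} by have [] := dh 0; rewrite ?normr0.
have /nbhs_ballP[d /= d0 Hd] : \forall v \near (0 : R), `|derive1 h v| < eta.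
  by apply: near_ball_lt => //; rewrite h'0 normr0.
pose rho := Num.min (Num.min 1 r) d.
have rho0 : 0 < rho by rewrite !lt_min ltr01 r0 d0.
have rho1 : rho <= 1 by rewrite !ge_min lexx.
have rhor : rho <= r by rewrite !ge_min lexx orbT.
have rhod : rho <= d by rewrite !ge_min lexx orbT.
have h'le v : `|v| < rho -> `|derive1 h v| <= eta.
  by move=> vr; apply/ltW/Hd; rewrite /ball /= sub0r normrN (lt_le_trans vr).
have dh' (v : R) : `|v| < rho -> is_derive v 1 h (derive1 h v).
  by move=> vr; apply: is_derive_of_derivable; have [] := dh v (lt_le_trans vr rhor).
have hle v : `|v| < rho -> `|h v| <= eta * `|v|.
  move=> vr; have [v0|v0] := leP 0 v.
    have [x /andP[x0 xv]|x /andP[x0 xv]] := @MVT_closed _ h (derive1 h) 0 v v0.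
      by apply: dh'; apply: le_lt_trans vr; rewrite !ger0_norm.
    rewrite h0 !subr0 => ->; rewrite normrM ler_wpM2r//; apply: h'le.
    by apply: le_lt_trans vr; rewrite !ger0_norm.
  have [x /andP[x0 xv]|x /andP[x0 xv]] := @MVT_closed _ h (derive1 h) v 0 (ltW v0).
    by apply: dh'; apply: le_lt_trans vr; rewrite !ler0_norm ?lerN2// ltW.
  rewrite h0 !sub0r => /eqP; rewrite eqr_oppLR mulrN opprK => /eqP ->.
  rewrite normrM ler_wpM2r//; apply: h'le.
  by apply: le_lt_trans vr; rewrite !ler0_norm ?lerN2// ltW.
have eqv v : `|v| < rho -> a * h v + b * v ^+ 2 = B * v * h v * derive1 h v - c * h v ^+ 2.
  by move=> vr; have := inv v (lt_le_trans vr rhor); rewrite /invariance_equation => ->; ring.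
have h2 v : `|v| < rho -> `|h v| <= 2 * `|b| / `|a| * `|v| ^+ 2.
  move=> vr; have v1 : `|v| <= 1 by apply: (le_trans (ltW vr)).
  have E : a * h v = B * v * h v * derive1 h v - c * h v ^+ 2 - b * v ^+ 2.
    by rewrite -eqv//; ring.
  have : `|a| * `|h v| <= `|a| / 2 * `|h v| + `|b| * `|v| ^+ 2.
    rewrite -normrM E; apply: (le_trans (ler_normB _ _)).
    rewrite !(normrX, normrM) lerD2r; apply: (le_trans (ler_normB _ _)).
    rewrite !(normrX, normrM); apply: le_trans (ler_wpM2r (normr_ge0 (h v)) etaa).
    rewrite !mulrDl; apply: lerD.
      rewrite mulrAC ler_wpM2r// -mulrA ler_wpM2l//.
      apply: (@le_trans _ _ (1 * `|derive1 h v|)); first by rewrite ler_wpM2r.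
      by rewrite mul1r h'le.
    rewrite expr2 -mulrA ler_wpM2l// ler_wpM2r//.
    by apply: (le_trans (hle v vr)); rewrite ler_piMr // ltW.
  by move=> H; rewrite mulrAC ler_pdivlMr//; lra.
(* Second pass: by the quadratic bound just obtained, [B v h h'] is of order three and [c h^2] of
   order four. Dividing by [a] gives this constant. *)
exists rho, ((`|B| * (2 * `|b| / `|a|) + `|c| * (2 * `|b| / `|a|) ^+ 2) / `|a|).
have k0 : 0 <= 2 * `|b| / `|a| by rewrite divr_ge0// mulr_ge0.
split=> //; first by rewrite rho0 rho1.
move=> v vr; have v1 : `|v| <= 1 by apply: (le_trans (ltW vr)).
have -> : h v + b / a * v ^+ 2 = (a * h v + b * v ^+ 2) / a by field.
rewrite eqv// normrM normfV [leRHS]mulrAC ler_wpM2r ?invr_ge0//.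
apply: (le_trans (ler_normB _ _)); rewrite !(normrX, normrM) [leRHS]mulrDl.
have h2v := h2 v vr; have nv := normr_ge0 v; apply: lerD.
  have -> : `|B| * `|v| * `|h v| * `|derive1 h v| =
    `|B| * (`|h v| * (`|derive1 h v| * `|v|)) by ring.
  have -> : `|B| * (2 * `|b| / `|a|) * `|v| ^+ 3 =
    `|B| * (2 * `|b| / `|a| * `|v| ^+ 2 * `|v|) by ring.
  rewrite ler_wpM2l// ler_pM ?mulr_ge0//.
  by rewrite ler_piMl// (le_trans (h'le v vr)).
apply: (@le_trans _ _ (`|c| * (2 * `|b| / `|a| * `|v| ^+ 2) ^+ 2)).
  by rewrite ler_wpM2l// lerXn2r ?nnegrE// mulr_ge0 ?exprn_ge0.
have -> : `|c| * (2 * `|b| / `|a| * `|v| ^+ 2) ^+ 2 =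
  `|c| * (2 * `|b| / `|a|) ^+ 2 * `|v| ^+ 4 by ring.
rewrite ler_wpM2l ?mulr_ge0 ?exprn_ge0//.
by rewrite exprSr ler_piMr ?exprn_ge0.
Qed.

(** [p] and [q] solve the invariance equation at orders two and four: [a p + b = 0] and
    [a q = (2 B - c) p^2]. The residual left by [psi] is [v ^+ 6 * S v]. *)
Let p := - (b / a).
Let q := b ^+ 2 / a ^+ 3 * (2 * B - c).
Let psi (v : R) := p * v ^+ 2 + q * v ^+ 4.
Let dpsi (v : R) := 2 * p * v + 4 * q * v ^+ 3.
Let S (v : R) := (2 * c * p * q - 6 * B * p * q) + (c * q ^+ 2 - 4 * B * q ^+ 2) * v ^+ 2.

Lemma quartic_residual (v : R) :
  a * psi v + b * v ^+ 2 + c * psi v ^+ 2 - B * v * psi v * dpsi v = v ^+ 6 * S v.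
Proof. by rewrite /psi /dpsi /S /p /q; field. Qed.

Lemma ratio_bounds (k k0 : R) : k0 != 0 -> `|k - k0| <= `|k0| / 2 ->
  1 / 2 <= k / k0 <= 3 / 2.
Proof.
move=> k00 kk0; have : `|k / k0 - 1| <= 1 / 2.
  have -> : k / k0 - 1 = (k - k0) / k0 by field.
  by rewrite normrM normfV ler_pdivrMr ?normr_gt0//; lra.
by rewrite ler_norml => /andP[? ?]; apply/andP; split; lra.
Qed.

(* The error [m = h - psi] satisfies [B v h m' = (a + c (h + psi) - B v psi') m + v^6 S],
   so that where [|m|] exceeds a large multiple of [v^6] the sign of [m m'] is
   that of [- a b B]; either sign confines [m]. *)
Lemma graph_expansion_right (h : R -> R) (r : R) : B != 0 -> b != 0 ->
  invariant_graph a B b c h r ->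
  exists rho M : R, [/\ 0 < rho <= 1, 0 <= M &
    forall v, 0 < v < rho -> `|h v - psi v| <= M * v ^+ 6].
Proof.
move=> B0 b0 hr; have [r0 [h0 _] dh inv] := hr.
have [rho0 [K [/andP[rho00 rho01] rho0r K0 h2 h3]]] := graph_quadratic_bound hr.
have na : 0 < `|a| by rewrite normr_gt0.
have p0 : p != 0 by rewrite oppr_eq0 mulf_neq0// invr_neq0.
have np : 0 < `|p| by rewrite normr_gt0.
pose K2 := 2 * `|b| / `|a|.
have K20 : 0 <= K2 by rewrite divr_ge0// mulr_ge0.
pose A0 := `|c| * (K2 + (`|p| + `|q|)) + `|B| * (2 * `|p| + 4 * `|q|).
have A00 : 0 <= A0 by rewrite addr_ge0// mulr_ge0// !addr_ge0// mulr_ge0.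
pose S0 := `|2 * c * p * q - 6 * B * p * q| + `|c * q ^+ 2 - 4 * B * q ^+ 2|.
have S00 : 0 <= S0 by rewrite addr_ge0.
have S0P v : 0 <= v <= 1 -> `|S v| <= S0.
  move=> /andP[v0 v1]; apply: (le_trans (ler_normD _ _)); rewrite lerD2l normrM.
  by rewrite ler_piMr// ger0_norm ?exprn_ge0// exprn_ile1.
pose beta := `|B * p / a|.
have beta0 : 0 < beta by rewrite normr_gt0 mulf_neq0 ?invr_neq0// mulf_neq0.
(* Besides the validity of the earlier bounds, [rho] ensures three things: [A v] is within [|a| / 4]
   of [a], [h v / v ^+ 2] is within [|p| / 2] of [p], and [24 * beta * v <= 1], which serves the
   case [0 <= B * p / a]. *)
pose rho := Num.min (Num.min rho0 (`|a| / (4 * (A0 + 1))))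
  (Num.min (`|p| / (2 * (K + 1))) (1 / (24 * beta))).
have rhoP (v : R) : 0 < v < rho -> [/\ `|v| < rho0, v <= 1, (A0 + 1) * v <= `|a| / 4,
    (K + 1) * v <= `|p| / 2 & 24 * beta * v <= 1].
  move=> /andP[v0]; rewrite /rho !lt_min => /andP[/andP[v1 v2] /andP[v3 v4]].
  split.
  - by rewrite gtr0_norm.
  - by rewrite (le_trans (ltW v1)).
  - by move: v2; rewrite ltr_pdivlMr ?mulr_gt0 ?ltr_wpDl// => /ltW; lra.
  - by move: v3; rewrite ltr_pdivlMr ?mulr_gt0 ?ltr_wpDl// => /ltW; lra.
  - by move: v4; rewrite ltr_pdivlMr ?mulr_gt0 // => /ltW; lra.
have rhogt0 : 0 < rho.
  by rewrite !lt_min rho00 !divr_gt0 ?mulr_gt0 ?ltr_wpDl.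
have rhole1 : rho <= 1 by rewrite !ge_min rho01.
pose m v := h v - psi v; pose dm v := derive1 h v - dpsi v.
have dmP (v : R) : `|v| < rho0 -> is_derive v 1 m (dm v).
  move=> vr; have [|/is_derive_of_derivable dhv _] := dh v; first exact: lt_le_trans rho0r.
  apply: is_deriveB; rewrite /psi /dpsi; apply: is_derive_eq.
  by rewrite /GRing.scale /=; ring.
pose A v := a + c * (h v + psi v) - B * v * dpsi v.
have mE v : `|v| < rho0 -> B * v * h v * dm v = A v * m v + v ^+ 6 * S v.
  move=> vr; have := inv v (lt_le_trans vr rho0r); rewrite /invariance_equation => iE.
  rewrite -quartic_residual /A /m /dm mulrBr iE; ring.
have psile v : 0 < v < rho -> `|psi v| <= (`|p| + `|q|) * v /\ `|v * dpsi v| <= (2 * `|p| + 4 * `|q|) * v.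
  move=> vin; have [_ v1 _ _ _] := rhoP v vin; case/andP: vin => v0 _.
  have vn n : `|v ^+ n.+1| <= v.
    have v0' := ltW v0.
    by rewrite ger0_norm ?exprn_ge0// exprS ler_piMr// exprn_ile1.
  split.
    rewrite /psi mulrDl; apply: (le_trans (ler_normD _ _)).
    by rewrite (normrM p) (normrM q); apply: lerD; rewrite ler_wpM2l.
  have -> : v * dpsi v = 2 * p * v ^+ 2 + 4 * q * v ^+ 4 by rewrite /dpsi; ring.
  rewrite (mulrDl (2 * `|p|)); apply: (le_trans (ler_normD _ _)).
  rewrite (normrM (2 * p)) (normrM (4 * q)) (normrM _ p) (normrM _ q) !normr_nat.
  by apply: lerD; rewrite ler_wpM2l ?mulr_ge0.
have Aa v : 0 < v < rho -> `|A v - a| <= `|a| / 4.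
  move=> vin; have [vr v1 vA _ _] := rhoP v vin; have [ps1 ps2] := psile v vin.
  have v0 : 0 < v by case/andP: vin.
  have hv : `|h v| <= K2 * v.
    apply: (le_trans (h2 v vr)); rewrite ler_wpM2l// gtr0_norm// expr2.
    by rewrite ler_piMr// ltW.
  apply: (@le_trans _ _ (A0 * v)); last first.
    by apply: le_trans vA; rewrite ler_wpM2r ?(ltW v0)// lerDl.
  have -> : A v - a = c * (h v + psi v) - B * (v * dpsi v) by rewrite /A; ring.
  have -> : A0 * v = `|c| * (K2 * v + (`|p| + `|q|) * v) +
    `|B| * ((2 * `|p| + 4 * `|q|) * v) by rewrite /A0; ring.
  apply: (le_trans (ler_normB _ _)); rewrite (normrM c) (normrM B).
  apply: lerD; rewrite ler_wpM2l//.
  by apply: (le_trans (ler_normD _ _)); apply: lerD.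
(* When [|m|] is at least [M * v ^+ 6], the residual is at most [|a| / 4 * |m|]. Together with the
   deviation of [A v] it costs half of [m ^+ 2], and the other half remains in [big]. *)
pose M := 4 * S0 / `|a|.
have M0 : 0 <= M by rewrite divr_ge0// mulr_ge0.
have big v : 0 < v < rho -> M * v ^+ 6 <= `|m v| ->
    m v ^+ 2 / 2 <= (B * h v / a * v) * (m v * dm v).
  move=> vin mbig; have [vr v1 _ _ _] := rhoP v vin.
  have v0 : 0 < v by case/andP: vin.
  have -> : (B * h v / a * v) * (m v * dm v) = m v * (B * v * h v * dm v) / a.
    by field.
  rewrite mE//.
  have -> : m v * (A v * m v + v ^+ 6 * S v) / a =
    m v ^+ 2 + ((A v - a) * m v ^+ 2 + (v ^+ 6 * S v) * m v) / a by field.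
  suff : `|((A v - a) * m v ^+ 2 + (v ^+ 6 * S v) * m v) / a| <= m v ^+ 2 / 2.
    by rewrite ler_norml => /andP[]; lra.
  rewrite normrM normfV ler_pdivrMr//.
  have m2 : m v ^+ 2 = `|m v| ^+ 2 by rewrite real_normK ?num_real.
  have -> : m v ^+ 2 / 2 * `|a| = `|a| / 4 * m v ^+ 2 + (`|a| / 4 * `|m v|) * `|m v|.
    by rewrite m2; field.
  apply: (le_trans (ler_normD _ _)); rewrite (normrM (A v - a)) (normrM (_ * S v)) (normrM (_ ^+ 6)); apply: lerD.
    rewrite [`|m v ^+ 2|]ger0_norm ?sqr_ge0// ler_wpM2r ?sqr_ge0//; exact: Aa.
  rewrite ler_wpM2r// [`|v ^+ 6|]ger0_norm ?exprn_ge0 ?(ltW v0)//.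
  apply: (@le_trans _ _ (v ^+ 6 * S0)).
    by rewrite ler_wpM2l ?exprn_ge0 ?(ltW v0)// S0P// (ltW v0).
  apply: le_trans (ler_wpM2l _ mbig); last by rewrite divr_ge0.
  by rewrite le_eqVlt; apply/orP; left; apply/eqP; rewrite /M; field; rewrite normr_eq0.
have kP v : 0 < v < rho -> exists2 k, h v = v ^+ 2 * k & `|k - p| <= `|p| / 2.
  move=> vin; have [vr v1 _ vK _] := rhoP v vin; have v0 : 0 < v by case/andP: vin.
  have vn0 := lt0r_neq0 v0.
  exists (h v / v ^+ 2); first by field.
  have -> : h v / v ^+ 2 - p = (h v + b / a * v ^+ 2) / v ^+ 2.
    by rewrite /p; field; rewrite a0 vn0.
  rewrite normrM normfV [`|v ^+ 2|]gtr0_norm ?exprn_gt0// ler_pdivrMr ?exprn_gt0//.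
  apply: (le_trans (h3 v vr)); rewrite gtr0_norm// exprS mulrA.
  rewrite ler_wpM2r ?exprn_ge0 ?(ltW v0)//; apply: le_trans vK.
  by rewrite ler_wpM2r ?(ltW v0)// lerDl.
have psi0 : psi 0 = 0 by rewrite /psi !expr0n /= !mulr0 addr0.
have d2 (v : R) : `|v| < rho0 -> is_derive v 1 (fun v => m v ^+ 2) (2 * (m v * dm v)).
  move=> vr; have dmv := dmP v vr; apply: is_derive_eq.
  by rewrite /GRing.scale /=; ring.
(* Since [h v] has the sign of [p], [big] gives [m * dm] the sign of [B * p / a]. In the negative
   case [m ^+ 2] cannot rise above the threshold after starting from [m 0 = 0]. *)
have [sgn|sgn] := ltP (B * p / a) 0.
  exists rho, M; split=> //; first by rewrite rhogt0.
  move=> v vin; case/andP: (vin) => v0 vrho.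
  pose C := (M * v ^+ 6) ^+ 2.
  have inrho (s : R) : 0 <= s <= v -> `|s| < rho0.
    move=> /andP[s0 sv]; rewrite ger0_norm//.
    by have [/(le_lt_trans (ler_norm v)) + _ _ _ _] := rhoP v vin; apply: le_lt_trans.
  have : m v ^+ 2 <= C.
    apply: (@trap_right R (fun v => m v ^+ 2) (fun v => 2 * (m v * dm v)) 0 v C (C + m v ^+ 2 + 1)).
    - exact: ltW.
    - have := sqr_ge0 (m v); lra.
    - by move=> s sin; apply: d2; exact: inrho.
    - move=> s /andP[s0 sv] /andP[Cs _].
      have sgt0 : 0 < s.
        rewrite lt_neqAle s0 andbT; apply/eqP => sE.
        by move: Cs; rewrite -sE /m h0 psi0 subrr expr0n /= ltNge sqr_ge0.
      have sin : 0 < s < rho by rewrite sgt0 (le_lt_trans sv).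
      have mbig : M * s ^+ 6 <= `|m s|.
        rewrite -ler_sqr ?nnegrE ?mulr_ge0 ?exprn_ge0// real_normK ?num_real//.
        apply: le_trans (ltW Cs); rewrite ler_sqr ?nnegrE ?mulr_ge0 ?exprn_ge0 ?(ltW v0)//.
        by rewrite ler_wpM2l// lerXn2r// nnegrE ltW.
      have H := big s sin mbig.
      have [k kE /(ratio_bounds p0)/andP[kp1 kp2]] := kP s sin.
      have kneg : B * h s / a * s < 0.
        rewrite kE; have -> : B * (s ^+ 2 * k) / a * s = (B * p / a) * (s ^+ 3 * (k / p)).
          by field; rewrite a0 p0.
        rewrite nmulr_rlt0// mulr_gt0 ?exprn_gt0//.
        by apply: lt_le_trans kp1; rewrite divr_gt0.
      have : 0 <= m s ^+ 2 / 2 by rewrite divr_ge0// sqr_ge0.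
      move=> /le_trans /(_ H); rewrite nmulr_rge0// => H'.
      by rewrite mulr_ge0_le0.
    - by rewrite /m h0 psi0 subrr expr0n /= sqr_ge0.
  rewrite -[m v ^+ 2]real_normK ?num_real// ler_sqr ?nnegrE ?mulr_ge0 ?exprn_ge0 ?(ltW v0)//.
(* In the positive case [m ^+ 2] grows with [v], so it is controlled from the right end. Where [big]
   applies, [m * dm] is at least [m ^+ 2 / (4 * beta * v ^+ 3)], which near 0 is faster growth than
   that of any power of [v]; hence [P] is nondecreasing where it exceeds [C], and the bound at [v2]
   propagates down towards 0. *)
pose P v := m v ^+ 2 / v ^+ 12.
pose dP v := (2 * (m v * dm v) * v - 12 * m v ^+ 2) / v ^+ 13.
pose v2 := rho / 2.
have v2in : 0 < v2 < rho by rewrite /v2 divr_gt0//= ltr_pdivrMr// ltr_pMr// ltr1n.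
pose C := M ^+ 2 + P v2.
have P0 v : 0 < v -> 0 <= P v by move=> v0; rewrite divr_ge0 ?sqr_ge0 ?exprn_ge0// ltW.
have C0 : 0 <= C by rewrite addr_ge0 ?sqr_ge0// P0//; case/andP: v2in.
exists v2, (C + 1); split.
- by case/andP: v2in => -> v2r /=; exact: ltW (lt_le_trans v2r rhole1).
- by rewrite addr_ge0.
move=> v /andP[v0 vv2]; have v0' := ltW v0.
have dPP (s : R) : 0 < s < rho -> is_derive s 1 P (dP s).
  move=> sin; have [sr _ _ _ _] := rhoP s sin; have s0 : 0 < s by case/andP: sin.
  have d2s := d2 s sr; have sn0 := lt0r_neq0 s0.
  have dX : is_derive s 1 (fun s : R => s ^+ 12) (12 * s ^+ 11).
    by apply: is_derive_eq; rewrite /GRing.scale /=; ring.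
  have dV : is_derive s 1 (fun s : R => (s ^+ 12)^-1) (- (s ^+ 12) ^- 2 *: (12 * s ^+ 11)).
    by apply: (@is_deriveV R (fun s => s ^+ 12)); rewrite /= expf_neq0.
  by rewrite /P; apply: is_derive_eq; rewrite /dP /GRing.scale /=; field.
have : P v <= C.
  apply: (@trap_left R P dP v v2 C (C + P v + 1)); last by rewrite /C lerDr sqr_ge0.
  - exact: ltW.
  - by have := P0 v v0; lra.
  - move=> s /andP[vs sv2]; apply: dPP; apply/andP; split; first exact: lt_le_trans vs.
    by apply: (le_lt_trans sv2); case/andP: v2in.
  - move=> s /andP[vs sv2] /andP[CP _].
    have s0 : 0 < s by exact: lt_le_trans vs.
    have s0' := ltW s0.
    have sin : 0 < s < rho by rewrite s0 (le_lt_trans sv2)//; case/andP: v2in.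
    have mbig : M * s ^+ 6 <= `|m s|.
      rewrite -ler_sqr ?nnegrE ?mulr_ge0 ?exprn_ge0// real_normK ?num_real//.
      have -> : m s ^+ 2 = P s * s ^+ 12 by rewrite /P divfK// expf_neq0// lt0r_neq0.
      rewrite exprMn -exprM ler_wpM2r ?exprn_ge0//; apply: le_trans (ltW CP).
      by rewrite /C lerDl P0//; case/andP: v2in.
    have H := big s sin mbig.
    have [k kE /(ratio_bounds p0)/andP[kp1 kp2]] := kP s sin.
    have [_ s1 _ _ sb] := rhoP s sin.
    have betaE : beta = B * p / a by rewrite /beta ger0_norm.
    pose e := B * h s / a * s.
    have ele : e <= 2 * beta * s ^+ 3.
      rewrite /e kE; have -> : B * (s ^+ 2 * k) / a * s = (B * p / a) * (k / p) * s ^+ 3.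
        by field; rewrite a0 p0.
      rewrite ler_wpM2r ?exprn_ge0// -betaE mulrC ler_wpM2r ?(ltW beta0)//.
      by apply: (le_trans kp2); rewrite ler_pdivrMr// -natrM ler_nat.
    have H' : m s ^+ 2 / 2 <= e * (m s * dm s) by exact: H.
    have e0 : 0 < e.
      rewrite /e kE; have -> : B * (s ^+ 2 * k) / a * s = beta * (k / p) * s ^+ 3.
        by rewrite betaE; field; rewrite a0 p0.
      rewrite mulr_gt0 ?exprn_gt0// mulr_gt0//.
      by apply: lt_le_trans kp1; rewrite divr_gt0.
    have mdm0 : 0 <= m s * dm s.
      have : 0 <= e * (m s * dm s) by apply: le_trans H'; rewrite divr_ge0// sqr_ge0.
      by rewrite pmulr_rge0.
    rewrite /dP divr_ge0 ?exprn_ge0// subr_ge0.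
    have H2 : m s ^+ 2 / 2 <= 2 * beta * s ^+ 3 * (m s * dm s).
      by apply: (le_trans H'); rewrite ler_wpM2r.
    (* The factor [s / 12] is the one needed: [0 <= dP s] amounts to
       [m ^+ 2 / 2 <= s / 12 * (m * dm)]. *)
    have H3 : 2 * beta * s ^+ 3 * (m s * dm s) <= s / 12 * (m s * dm s).
      rewrite ler_wpM2r// -subr_ge0.
      have -> : s / 12 - 2 * beta * s ^+ 3 = s / 12 * (1 - 24 * beta * s * s) by field.
      rewrite mulr_ge0 ?divr_ge0// subr_ge0; apply: le_trans sb.
      by rewrite ler_piMr// !mulr_ge0// ltW.
    have : m s ^+ 2 / 2 <= s / 12 * (m s * dm s) by exact: le_trans H3.
    lra.
rewrite /P ler_pdivrMr ?exprn_gt0// => H.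
have C1 : 0 <= C + 1 by rewrite addr_ge0.
rewrite -ler_sqr ?nnegrE ?mulr_ge0 ?exprn_ge0// real_normK ?num_real//.
apply: (le_trans H); rewrite exprMn -exprM ler_wpM2r ?exprn_ge0//.
by nra.
Qed.

End Expansion.

(** * Stability and escape for scalar equations *)

Section ScalarStability.
Variable R : realType.

Lemma scalar_stable (f : R -> R) (rho : R) : 0 < rho ->
  (forall x, `|x| < rho -> x * f x <= 0) -> stable f 0.
Proof.
move=> rho0 fle e e0.
pose e1 := Num.min e rho.
have e10 : 0 < e1 by rewrite lt_min e0 rho0.
exists (e1 / 2); first by rewrite divr_gt0.
move=> J phi _ Ji J0 sol phi0 t Jt t0; rewrite subr0 in phi0.
have sq (x y : R) : 0 <= y -> (x ^+ 2 < y ^+ 2) = (`|x| < y).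
  by move=> y0; rewrite -[x ^+ 2]real_normK ?num_real// ltr_sqr ?nnegrE.
have dphi (s : R) : 0 <= s <= t -> is_derive s 1 (fun s => phi s ^+ 2) (2 * (phi s * f (phi s))).
  move=> st; have ds := sol s (Ji 0 t J0 Jt s st); apply: is_derive_eq.
  by rewrite /GRing.scale /=; ring.
have : phi t ^+ 2 <= (e1 / 2) ^+ 2.
  apply: (@trap_right R (fun s => phi s ^+ 2) (fun s => 2 * (phi s * f (phi s)))
    0 t ((e1 / 2) ^+ 2) (e1 ^+ 2)) => //.
  - by rewrite ltr_sqr ?nnegrE; lra.
  - move=> s _ /andP[_]; rewrite sq ?(ltW e10)// => se.
    rewrite pmulr_rle0//; apply: fle; apply: (lt_le_trans se).
    by rewrite ge_min lexx orbT.
  - by apply: ltW; rewrite sq// ltW// divr_gt0.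
have e12 : (e1 / 2) ^+ 2 < e ^+ 2.
  rewrite ltr_sqr ?nnegrE ?(ltW e0)//; last by lra.
  have : e1 <= e by rewrite ge_min lexx.
  lra.
by move=> /le_lt_trans /(_ e12); rewrite sq ?(ltW e0)// subr0.
Qed.

(** On the compact interval [[l, u]] inside []0, rho[] the field has a positive minimum [f m]. The
    clamped solution climbs at least at this speed, hence attains [e] within the time
    [(e - x0) / f m]. *)
Lemma escape_solution (f df : R -> R) (rho x0 e : R) : 0 < x0 -> x0 < e -> e < rho ->
  (forall x, 0 < x < rho -> 0 < f x) ->
  (forall x, 0 < x < rho -> is_derive x 1 f (df x) /\ {for x, continuous df}) ->
  exists (J : set R) (phi : R -> R) (t1 : R),
    [/\ open J, is_interval J /\ J 0, is_solution f J phi, phi 0 = x0 &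
      (forall t, J t -> 0 < phi t < rho) /\ [/\ J t1, 0 <= t1 & phi t1 = e]].
Proof.
move=> x00 x0e erho f0 dfP.
pose l := x0 / 2; pose u := (e + rho) / 2.
have lu : l <= u by rewrite /l /u; lra.
have inP x : l <= x <= u -> 0 < x < rho.
  by move=> /andP[lx xu]; apply/andP; split; move: lx xu; rewrite /l /u; lra.
have dfin (x : R) : l <= x <= u -> is_derive x 1 f (df x) by move=> /inP /dfP[].
have [K _ KP] : exists2 c, c \in `[l, u] & forall t, t \in `[l, u] -> `|df t| <= `|df c|.
  apply: (@EVT_max _ (fun x => `|df x|)) => //.
  apply: continuous_in_subspaceT => x; rewrite inE /= in_itv /= => /inP /dfP[_ cx].
  by apply: continuous_comp cx _; exact: norm_continuous.
have [m min mP] : exists2 c, c \in `[l, u] & forall t, t \in `[l, u] -> f c <= f t.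
  by apply: EVT_min => //; apply: within_cont_of_derive dfin.
have fm0 : 0 < f m by apply/f0/inP; move: min; rewrite in_itv.
have flip x y : l <= x <= u -> l <= y <= u -> `|f x - f y| <= `|df K| * `|x - y|.
  wlog xy : x y / y <= x.
    move=> H xin yin; have [xy|/ltW xy] := leP y x; first exact: H.
    by rewrite distrC [`|x - y|]distrC; exact: H.
  move=> /andP[lx xu] /andP[ly yu].
  have [|z /andP[yz zx] ->] := @MVT_closed _ f df y x xy.
    by move=> z /andP[yz zx]; apply: dfin; apply/andP; split; lra.
  by rewrite normrM ler_wpM2r// KP// in_itv /=; apply/andP; split; lra.
have [bl _] := bounded_lipschitz_comp1 lu (normr_ge0 _) flip.
(* The planar existence theorem is used with a constant second component. *)
have [phi [_ [phi0 _ dphi _]]] := picard_bounded_lipschitz bl (bounded_lipschitz_cst 0) x0 0.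
have cphi : continuous phi by move=> t; exact: (is_derive_continuous (dphi t)).
have gm t : f m <= f (clamp l u (phi t)) by apply: mP; rewrite in_itv /= clamp_in.
have incr s t : s <= t -> phi s + f m * (t - s) <= phi t.
  move=> st.
  have : f m * t - phi t <= f m * s - phi s.
    apply: (@nonincreasing_closed R (fun t => f m * t - phi t)
      (fun t => f m - f (clamp l u (phi t))) s t st) => y _; last by rewrite subr_le0.
    have dy := dphi y; apply: is_derive_eq; rewrite /GRing.scale /=; ring.
  lra.
have mono s t : s <= t -> phi s <= phi t.
  move=> st; apply: le_trans (incr s t st); rewrite lerDl mulr_ge0 ?subr_ge0//.
  exact: ltW.
pose T := (e - x0) / f m.
have T0 : 0 <= T by rewrite divr_ge0 ?subr_ge0 // ltW.
have [|t1 t1in phit1] := @IVT _ phi 0 T e T0 (continuous_subspaceT cphi).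
  have : phi 0 + f m * (T - 0) <= phi T by exact: incr.
  have -> : phi 0 + f m * (T - 0) = e by rewrite phi0 /T subr0 mulrC divfK ?gt_eqF//; ring.
  by move=> eT; rewrite ge_min le_max phi0 eT (ltW x0e) orbT.
exists (phi @^-1` `]l, u[%classic), phi, t1.
have JE t : (phi @^-1` `]l, u[%classic) t = (l < phi t < u) by rewrite /= in_itv.
split=> //.
- by apply: open_comp => [x _|]; [exact: cphi|exact: interval_open].
- split; last by rewrite JE phi0 /l /u; apply/andP; split; lra.
  move=> x y; rewrite !JE => /andP[lx _] /andP[_ yu] z /andP[xz zy].
  by rewrite JE (lt_le_trans lx (mono _ _ xz)) (le_lt_trans (mono _ _ zy) yu).
- move=> t; rewrite JE => /andP[lt tu].
  by have := dphi t; rewrite clamp_id// (ltW lt) ltW.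
- split; first by move=> t; rewrite JE => /andP[lt tu]; apply: inP; rewrite (ltW lt) ltW.
  split=> //; last by move: t1in; rewrite in_itv /= => /andP[].
  by rewrite JE phit1 /l /u; apply/andP; split; lra.
Qed.

Lemma scalar_unstable (f df : R -> R) (rho : R) : 0 < rho ->
  (forall x, 0 < x < rho -> 0 < f x) ->
  (forall x, 0 < x < rho -> is_derive x 1 f (df x) /\ {for x, continuous df}) ->
  unstable f 0.
Proof.
move=> rho0 f0 dfP st; have e0 : 0 < rho / 2 by rewrite divr_gt0.
have [d d0 H] := st _ e0.
pose x0 := Num.min (d / 2) (rho / 4).
have x00 : 0 < x0 by rewrite lt_min !divr_gt0.
have x0d : x0 <= d / 2 by rewrite ge_min lexx.
have x0r : x0 <= rho / 4 by rewrite ge_min lexx orbT.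
have x0e : x0 < rho / 2 by lra.
have er : rho / 2 < rho by lra.
have [J [phi [t1 [Jo [Ji J0] sol phi0 [_ [Jt1 t10 phit1]]]]]] :=
  escape_solution x00 x0e er f0 dfP.
have := H J phi Jo Ji J0 sol; rewrite subr0 phi0 gtr0_norm// => /(_ _ t1 Jt1 t10).
by rewrite subr0 phit1 gtr0_norm// ltxx => H'; suff : false by []; apply: H'; lra.
Qed.

End ScalarStability.

(** * Stability of the planar system *)

Section PlanarStability.
Variable R : realType.
Variables a B b c : R.
Hypotheses (a0 : a != 0) (B0 : B != 0).

Let q := b ^+ 2 / a ^+ 3 * (2 * B - c).
Let psi (v : R) := - (b / a) * v ^+ 2 + q * v ^+ 4.

Lemma graph_expansion (h : R -> R) (r : R) : invariant_graph a B b c h r ->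
  exists rho M : R, [/\ 0 < rho <= 1, rho <= r, 0 <= M &
    forall v, `|v| < rho -> `|h v - psi v| <= M * `|v| ^+ 6].
Proof.
move=> hr; have [r0 _ _ _] := hr; have [b0|b0] := eqVneq b 0.
  (* For [b = 0] the quadratic bound has constant zero, so [h] vanishes identically near 0. *)
  have [rho [K [rho01 rhor K0 h2 _]]] := graph_quadratic_bound a0 hr.
  exists rho, 0; split=> // v /h2; rewrite b0 normr0 mulr0 !mul0r normr_le0 => /eqP ->.
  have -> : psi v = 0 by rewrite /psi /q b0; field.
  by rewrite subrr normr0.
have [rp [Mp [/andP[rp0 rp1] Mp0 hp]]] := graph_expansion_right a0 B0 b0 hr.
have [rn [Mn [/andP[rn0 rn1] Mn0 hn]]] :=
  graph_expansion_right a0 B0 b0 (invariant_graph_reflect hr).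
exists (Num.min (Num.min rp rn) r), (Mp + Mn); split.
- by rewrite !lt_min rp0 rn0 r0 /= !ge_min rp1.
- by rewrite ge_min lexx orbT.
- exact: addr_ge0.
move=> v; rewrite !lt_min => /andP[/andP[vp vn] _].
have [v0|v0|v0] := ltgtP v 0.
- rewrite ltr0_norm// in vn *; have := hn (- v); rewrite opprK oppr_gt0 v0 => /(_ vn).
  have psiN : psi (- v) = psi v by rewrite /psi; ring.
  rewrite -/(psi _) psiN => /le_trans; apply.
  by rewrite ler_wpM2r ?lerDr// exprn_ge0// oppr_ge0 ltW.
- rewrite gtr0_norm// in vp *; have := hp v; rewrite v0 => /(_ vp) /le_trans; apply.
  by rewrite ler_wpM2r ?lerDl// exprn_ge0// ltW.
- have [_ [h0 _] _ _] := hr.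
  have p0 : psi 0 = 0 by rewrite /psi; ring.
  by rewrite v0 h0 p0 subrr normr0 mulr_ge0 ?exprn_ge0 ?addr_ge0.
Qed.

Lemma graph_bigO (h : R -> R) (r : R) : invariant_graph a B b c h r ->
  h = (fun v => - (b / a) * v ^+ 2 + b ^+ 2 / a ^+ 3 * (2 * B - c) * v ^+ 4)
      +O_ (0 : R) (fun v => v ^+ 5).
Proof.
move=> hr; have [rho [M [/andP[rho0 rho1] _ M0 hM]]] := graph_expansion hr.
apply/eqaddOP; exists M; split; first exact: num_real.
move=> k Mk; apply/nbhs_ballP; exists rho => //= v; rewrite /ball /= sub0r normrN => vr.
apply: (le_trans (hM v vr)); rewrite normrX.
apply: (@le_trans _ _ (M * `|v| ^+ 5)); last by rewrite ler_wpM2r ?exprn_ge0// ltW.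
by rewrite ler_wpM2l// exprSr ler_piMr ?exprn_ge0// (le_trans (ltW vr)).
Qed.

Lemma restricted_fieldE (h : R -> R) (x : R) :
  restricted_field (planar a B b c) h x = B * x * h x.
Proof. by rewrite /restricted_field /planar !row2E. Qed.

Lemma restricted_bound (h : R -> R) (r : R) : invariant_graph a B b c h r ->
  exists rho K : R, [/\ 0 < rho <= 1, rho <= r, 0 <= K & forall x, `|x| < rho ->
    `|B * x * h x - (- (B * b / a) * x ^+ 3)| <= K * `|x| ^+ 4].
Proof.
move=> hr; have [rho [M [/andP[rho0 rho1] rhor M0 hM]]] := graph_expansion hr.
exists rho, (`|B| * (M + `|q|)); split=> //.
- by rewrite rho0.
- by rewrite mulr_ge0// addr_ge0.
move=> x xr; have x1 : `|x| <= 1 by rewrite (le_trans (ltW xr)).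
have -> : B * x * h x - (- (B * b / a) * x ^+ 3) = B * (x * ((h x - psi x) + q * x ^+ 4)).
  by rewrite /psi; field.
rewrite normrM -[leRHS]mulrA ler_wpM2l// normrM.
apply: (@le_trans _ _ (1 * `|h x - psi x + q * x ^+ 4|)); first by rewrite ler_wpM2r.
rewrite mul1r mulrDl; apply: (le_trans (ler_normD _ _)); apply: lerD.
  apply: (le_trans (hM x xr)); rewrite ler_wpM2l//.
  by rewrite (_ : 6 = 4 + 2)%N// exprD ler_piMr ?exprn_ge0// exprn_ile1.
by rewrite normrM normrX.
Qed.

Lemma restricted_bigO (h : R -> R) (r : R) : invariant_graph a B b c h r ->
  restricted_field (planar a B b c) h
    = (fun x => - (B * b / a) * x ^+ 3) +O_ (0 : R) (fun x => x ^+ 4).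
Proof.
move=> hr; have [rho [K [/andP[rho0 rho1] _ K0 hK]]] := restricted_bound hr.
apply/eqaddOP; exists K; split; first exact: num_real.
move=> k Kk; apply/nbhs_ballP; exists rho => //= x; rewrite /ball /= sub0r normrN => xr.
have := hK x xr; rewrite -restricted_fieldE => H; apply: (le_trans H).
by rewrite normrX ler_wpM2r ?exprn_ge0// ltW.
Qed.

Lemma restricted_stable (h : R -> R) (r : R) : invariant_graph a B b c h r ->
  0 < B * b / a -> stable (restricted_field (planar a B b c) h) 0.
Proof.
move=> hr g0; have [rho [K [/andP[rho0 rho1] _ K0 hK]]] := restricted_bound hr.
pose rho' := Num.min rho (B * b / a / (K + 1)).
have K1 : 0 < K + 1 by rewrite ltr_wpDl.
apply: (@scalar_stable _ _ rho'); first by rewrite lt_min rho0 divr_gt0.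
move=> x; rewrite lt_min => /andP[xr]; rewrite ltr_pdivlMr// => xK.
have := hK x xr; rewrite restricted_fieldE ler_norml => /andP[h1 h2].
have xx : `|x * (B * x * h x - - (B * b / a) * x ^+ 3)| <= B * b / a * x ^+ 4.
  rewrite normrM; apply: (le_trans (ler_wpM2l (normr_ge0 x) (hK x xr))).
  have -> : `|x| * (K * `|x| ^+ 4) = (K * `|x|) * `|x| ^+ 4 by ring.
  have -> : x ^+ 4 = `|x| ^+ 4.
    by rewrite -normrX ger0_norm// (exprM x 2 2) sqr_ge0.
  rewrite ler_wpM2r ?exprn_ge0//; apply: le_trans (ltW xK).
  by rewrite mulrC ler_wpM2l// lerDl.
have -> : x * (B * x * h x) =
  x * (B * x * h x - - (B * b / a) * x ^+ 3) - B * b / a * x ^+ 4 by ring.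
by rewrite subr_le0; apply: le_trans xx; exact: ler_norm.
Qed.

Lemma restricted_positive (h : R -> R) (r : R) : invariant_graph a B b c h r ->
  B * b / a < 0 -> exists rho df, [/\ 0 < rho, rho <= r,
    forall x, 0 < x < rho -> 0 < B * x * h x &
    forall x, 0 < x < rho ->
      is_derive x 1 (fun x => B * x * h x) (df x) /\ {for x, continuous df}].
Proof.
move=> hr g0; have [rho [K [/andP[rho0 rho1] rhor K0 hK]]] := restricted_bound hr.
have [_ _ dh _] := hr.
pose rho' := Num.min rho (- (B * b / a) / (K + 1)).
have K1 : 0 < K + 1 by rewrite ltr_wpDl.
have rhole : rho' <= rho by rewrite ge_min lexx.
exists rho', (fun x => B * h x + B * x * derive1 h x); split.
- by rewrite lt_min rho0 divr_gt0// oppr_gt0.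
- exact: le_trans rhor.
- move=> x /andP[x0]; rewrite lt_min => /andP[xr]; rewrite ltr_pdivlMr// => xK.
  have := hK x; rewrite gtr0_norm// => /(_ xr); rewrite ler_norml => /andP[h1 _].
  have : 0 < x ^+ 3 * (- (B * b / a) - K * x).
    by rewrite mulr_gt0 ?exprn_gt0// subr_gt0; apply: le_lt_trans xK; lra.
  have -> : x ^+ 3 * (- (B * b / a) - K * x) = - (B * b / a) * x ^+ 3 - K * x ^+ 4 by ring.
  by lra.
- move=> x /andP[x0 xr]; have xr' : `|x| < r.
    by rewrite gtr0_norm// (lt_le_trans xr)// (le_trans rhole).
  have [dhx cdh] := dh x xr'; have dhx' := is_derive_of_derivable dhx.
  split; first by apply: is_derive_eq; rewrite /GRing.scale /=; ring.
  have ch := is_derive_continuous dhx'.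
  apply: cvgD; first by apply: cvgM => //; exact: cvg_cst.
  by apply: cvgM => //; apply: cvgM; [exact: cvg_cst|exact: cvg_id].
Qed.

Lemma restricted_unstable (h : R -> R) (r : R) : invariant_graph a B b c h r ->
  B * b / a < 0 -> unstable (restricted_field (planar a B b c) h) 0.
Proof.
move=> hr g0; have [rho [df [rho0 _ f0 dfP]]] := restricted_positive hr g0.
rewrite (_ : restricted_field _ _ = (fun x => B * x * h x)).
  exact: scalar_unstable f0 dfP.
by apply/funext => x; exact: restricted_fieldE.
Qed.

(** By the invariance equation, the escaping solution of the restricted field lifts to a solution on
    the graph. Continuity of [h] at 0 puts its starting point as near to the origin as desired. *)
Lemma planar_unstable (h : R -> R) (r : R) : invariant_graph a B b c h r ->
  B * b / a < 0 -> unstable (planar a B b c) 0.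
Proof.
move=> hr g0 st; have [rho [df [rho0 rhor f0 dfP]]] := restricted_positive hr g0.
have [r0 [h0 _] dh inv] := hr.
have [d d0 H] := st _ (divr_gt0 rho0 (ltr0n R 2)).
have ch : {for 0, continuous h}.
  by have [|/is_derive_of_derivable/is_derive_continuous] := dh 0; rewrite ?normr0.
have /nbhs_ballP[s /= s0 Hs] : \forall v \near (0 : R), `|h v| < d.
  by apply: near_ball_lt => //; rewrite h0 normr0.
pose x0 := Num.min (Num.min (d / 2) (s / 2)) (rho / 4).
have x00 : 0 < x0 by rewrite !lt_min !divr_gt0.
have x0d : x0 <= d / 2 by rewrite !ge_min lexx.
have x0s : x0 <= s / 2 by rewrite !ge_min lexx orbT.
have x0r : x0 <= rho / 4 by rewrite ge_min lexx orbT.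
have x0e : x0 < rho / 2 by lra.
have er : rho / 2 < rho by lra.
have [J [phi [t1 [Jo [Ji J0] sol phi0 [phir [Jt1 t10 phit1]]]]]] :=
  escape_solution x00 x0e er f0 dfP.
pose Phi t := row2 (phi t) (h (phi t)).
have solP : is_solution (planar a B b c) J Phi.
  move=> t Jt; have /andP[p0 pr] := phir t Jt; have dphi := sol t Jt.
  have pr' : `|phi t| < r by rewrite gtr0_norm// (lt_le_trans pr).
  rewrite /planar /Phi !row2E; apply: is_derive_row2.
  have <- := inv _ pr'; rewrite mulrC.
  apply: (@is_derive1_comp _ h phi) => //; apply: is_derive_of_derivable.
  by have [] := dh _ pr'.
have Phi0 : `|Phi 0 - 0| < d.
  rewrite subr0; apply: norm_row_lt => //; apply: ord2_cases; rewrite row2E phi0.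
    by rewrite gtr0_norm//; lra.
  by apply: Hs; rewrite /ball /= sub0r normrN gtr0_norm//; lra.
have := H J Phi Jo Ji J0 solP Phi0 t1 Jt1 t10; rewrite subr0.
rewrite ltNge; apply/negP; rewrite negbK.
have := norm_row_entry (Phi t1) 0; rewrite row2E phit1 gtr0_norm//.
by rewrite divr_gt0.
Qed.

(* [V = v^2 + K m^2] with [m = w + (b / a) v^2] is a strict Lyapunov function:
   [V' <= - g v^4 - K |a| m^2 + (cubic terms in (v^2, m))], where [g = B b / a]. *)
Lemma planar_stable : a < 0 -> 0 < B * b / a -> stable (planar a B b c) 0.
Proof.
move=> aneg; set g := B * b / a => g0 e e0.
(* This weight makes the cross term harmless: by the arithmetic-geometric inequality
   [2 B x m <= g x^2 + (B^2 / g) m^2], and [B^2 / g = K * - a], half of the negative term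
   [2 K a m^2]. *)
pose K := B ^+ 2 / (g * - a).
have K0 : 0 < K.
  have B2 : 0 < B ^+ 2 by rewrite exprn_even_gt0.
  by apply: divr_gt0 => //; rewrite mulr_gt0 ?oppr_gt0.
pose s := `|b / a|.
have s0 : 0 <= s by exact: normr_ge0.
pose E := `|c| + `|c| * s + 2 * g + 1.
have g0' := ltW g0; have K0' := ltW K0.
have E0 : 0 < E by rewrite /E ltr_wpDl// !addr_ge0// mulr_ge0.
(* [dl] bounds [|w|]. The cubic terms are at most [2 * K * dl * E * (2 * m ^+ 2 + x ^+ 2)], and the
   last two constraints absorb these two summands into what the cross term has left over. *)
pose dl := Num.min (e / 2) (Num.min (- a / (4 * E)) (g / (2 * K * E))).
have dl0 : 0 < dl.
  rewrite !lt_min; apply/andP; split; first exact: divr_gt0.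
  apply/andP; split; apply: divr_gt0; rewrite ?oppr_gt0//; first exact: mulr_gt0.
  by apply: mulr_gt0 => //; exact: mulr_gt0.
have dle : dl <= e / 2 by rewrite ge_min lexx.
have dla : 4 * E * dl <= - a.
  have E4 : 0 < 4 * E by exact: mulr_gt0.
  have : dl <= - a / (4 * E) by rewrite /dl !ge_min lexx !orbT.
  by rewrite (ler_pdivlMr _ _ E4); lra.
have dlg : 2 * K * E * dl <= g.
  have E4 : 0 < 2 * K * E by apply: mulr_gt0 => //; exact: mulr_gt0.
  have : dl <= g / (2 * K * E) by rewrite /dl !ge_min lexx !orbT.
  by rewrite (ler_pdivlMr _ _ E4) mulrC.
(* The level is such that [V v w < C2] confines the point: the first bound gives [|m| <= dl / 2],
   the second [s * v ^+ 2 <= dl / 2], hence [|w| <= dl], and the third gives [|v| < e]. *)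
pose C2 := Num.min (K * (dl / 2) ^+ 2) (Num.min (dl / (2 * (s + 1))) (e ^+ 2 / 2)).
have s1 : 0 < s + 1 by rewrite ltr_wpDl.
have C20 : 0 < C2.
  have dl2 : 0 < dl / 2 by exact: divr_gt0.
  rewrite !lt_min mulr_gt0 ?exprn_gt0//=; apply/andP; split.
    by apply: divr_gt0 => //; exact: mulr_gt0.
  by apply: divr_gt0 => //; exact: exprn_gt0.
pose V (v w : R) := v ^+ 2 + K * (w + b / a * v ^+ 2) ^+ 2.
have small v w : V v w < C2 -> `|w| <= dl /\ `|v| < e.
  rewrite !lt_min => /andP[V1 /andP[V2 V3]].
  have vV : v ^+ 2 <= V v w by rewrite lerDl mulr_ge0 ?sqr_ge0// ltW.
  have mV : K * (w + b / a * v ^+ 2) ^+ 2 <= V v w by rewrite lerDr sqr_ge0.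
  split; last first.
    rewrite -ltr_sqr ?nnegrE ?(ltW e0)// real_normK ?num_real//.
    by apply: (le_lt_trans vV); apply: (lt_trans V3); have := exprn_gt0 2 e0; lra.
  have m2 : `|w + b / a * v ^+ 2| <= dl / 2.
    rewrite -ler_sqr ?nnegrE ?divr_ge0 ?(ltW dl0)// real_normK ?num_real//.
    by rewrite -(ler_pM2l K0) (le_trans mV)// ltW.
  have sv : `|b / a * v ^+ 2| <= dl / 2.
    rewrite normrM [`|v ^+ 2|]ger0_norm ?sqr_ge0//.
    apply: (@le_trans _ _ ((s + 1) * (dl / (2 * (s + 1))))).
      by apply: ler_pM; rewrite ?sqr_ge0 ?lerDl// (le_trans vV)// ltW.
    by rewrite le_eqVlt; apply/orP; left; apply/eqP; field; exact: lt0r_neq0.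
  have -> : w = (w + b / a * v ^+ 2) - b / a * v ^+ 2 by ring.
  by apply: (le_trans (ler_normB _ _)); lra.
pose dV (v w : R) := 2 * B * v ^+ 2 * w +
  2 * K * (w + b / a * v ^+ 2) * (a * w + b * v ^+ 2 + c * w ^+ 2 + b / a * (2 * v * (B * v * w))).
have dVle v w : V v w < C2 -> dV v w <= 0.
  move=> /small[wdl _].
  set x := v ^+ 2; pose m := w + b / a * x.
  have x0 : 0 <= x by exact: sqr_ge0.
  have wE : w = m - b / a * x by rewrite /m; ring.
  have -> : dV v w = - g * x ^+ 2 * 2 + 2 * B * x * m + 2 * K * a * m ^+ 2 +
      2 * K * (m * w * (c * w + 2 * g * x)).
    by rewrite /dV /m /x /g; field.
  have cub : m * w * (c * w + 2 * g * x) <= dl * E * (2 * m ^+ 2 + x ^+ 2).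
    apply: (le_trans (ler_norm _)); rewrite !normrM.
    have wm : `|w| <= `|m| + s * x.
      rewrite {1}wE; apply: (le_trans (ler_normB _ _)).
      by rewrite (normrM (b / a)) [`|x|]ger0_norm.
    have l1 : `|c * w + 2 * g * x| <= E * (`|m| + x).
      apply: (le_trans (ler_normD _ _)).
      rewrite (normrM c) (normrM (2 * g)) [`|x|]ger0_norm// [`|2 * g|]ger0_norm; last exact: mulr_ge0.
      have := ler_wpM2l (normr_ge0 c) wm => H; rewrite /E.
      have : 0 <= (`|c| * s + 2 * g + 1) * `|m|.
        by apply: mulr_ge0 => //; rewrite !addr_ge0// mulr_ge0.
      have : 0 <= (`|c| + 1) * x by rewrite mulr_ge0// addr_ge0.
      move: H; lra.
    apply: (@le_trans _ _ (`|m| * dl * (E * (`|m| + x)))).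
      by apply: ler_pM => //; rewrite ?mulr_ge0// ler_wpM2l.
    have -> : `|m| * dl * (E * (`|m| + x)) = dl * E * (`|m| ^+ 2 + `|m| * x) by ring.
    rewrite ler_wpM2l ?mulr_ge0 ?(ltW dl0) ?(ltW E0)//.
    have := sqr_ge0 (`|m| - x); have := sqr_ge0 m; have := sqr_ge0 x.
    by rewrite -(real_normK (num_real m)); nra.
  have K2 : 2 * K * (m * w * (c * w + 2 * g * x)) <= - a * K * m ^+ 2 + g * x ^+ 2.
    apply: (le_trans (ler_wpM2l _ cub)); first by rewrite mulr_ge0// ltW.
    have -> : 2 * K * (dl * E * (2 * m ^+ 2 + x ^+ 2)) =
      (4 * E * dl) * (K * m ^+ 2) + (2 * K * E * dl) * x ^+ 2 by ring.
    have -> : - a * K * m ^+ 2 = - a * (K * m ^+ 2) by ring.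
    apply: lerD; last by rewrite ler_wpM2r ?sqr_ge0.
    by rewrite ler_wpM2r// mulr_ge0 ?sqr_ge0// ltW.
  have amgm : 2 * B * x * m <= g * x ^+ 2 + B ^+ 2 / g * m ^+ 2.
    rewrite -subr_ge0.
    have -> : g * x ^+ 2 + B ^+ 2 / g * m ^+ 2 - 2 * B * x * m = g * (x - B / g * m) ^+ 2.
      by field; exact: lt0r_neq0.
    by rewrite mulr_ge0 ?sqr_ge0// ltW.
  have KE : B ^+ 2 / g = K * - a.
    by rewrite /K; field; rewrite a0 (lt0r_neq0 g0).
  rewrite KE in amgm; move: K2 amgm; lra.
pose L := 1 + K * (1 + s) ^+ 2.
have L0 : 0 < L by rewrite ltr_pwDl// mulr_ge0 ?sqr_ge0// ltW.
(* For both coordinates below [d <= 1] one has [V <= L * d], so the solution starts at height at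
   most [C2 / 2]. The gap up to [C2] is the window in which [trap_right] needs the sign of [dV]. *)
pose d := Num.min 1 (C2 / (2 * L)).
have d0 : 0 < d by rewrite lt_min ltr01 divr_gt0// mulr_gt0.
exists d => // J phi _ Ji J0 sol; rewrite subr0 => phi0 t Jt t0; rewrite subr0.
have V0 : V (phi 0 0 0) (phi 0 0 1) <= C2 / 2.
  have v0 := le_lt_trans (norm_row_entry (phi 0) 0) phi0.
  have w0 := le_lt_trans (norm_row_entry (phi 0) 1) phi0.
  have d1 : d <= 1 by rewrite ge_min lexx.
  have v2 : phi 0 0 0 ^+ 2 <= d.
    rewrite -[_ ^+ 2]real_normK ?num_real// expr2.
    apply: (@le_trans _ _ (1 * d)); last by rewrite mul1r.
    by apply: ler_pM => //; [apply: ltW; exact: lt_le_trans d1|exact: ltW].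
  have m2 : (phi 0 0 1 + b / a * phi 0 0 0 ^+ 2) ^+ 2 <= (1 + s) ^+ 2 * d.
    have ml : `|phi 0 0 1 + b / a * phi 0 0 0 ^+ 2| <= (1 + s) * d.
      apply: (le_trans (ler_normD _ _)); rewrite mulrDl mul1r; apply: lerD; first exact: ltW.
      by rewrite normrM ler_wpM2l// ger0_norm ?sqr_ge0.
    rewrite -[X in X <= _]real_normK ?num_real//.
    apply: (@le_trans _ _ (((1 + s) * d) ^+ 2)).
      by rewrite ler_sqr ?nnegrE// mulr_ge0 ?addr_ge0// ltW.
    by rewrite exprMn ler_wpM2l ?sqr_ge0// expr2 ler_piMr// ltW.
  apply: (@le_trans _ _ (L * d)).
    rewrite /V /L mulrDl mul1r; apply: lerD => //.
    by rewrite -[leRHS]mulrA ler_wpM2l.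
  rewrite mulrC -ler_pdivlMr//; have -> : C2 / 2 / L = C2 / (2 * L) by field; exact: lt0r_neq0.
  by rewrite ge_min lexx orbT.
have : V (phi t 0 0) (phi t 0 1) <= C2 / 2.
  apply: (@trap_right R (fun t => V (phi t 0 0) (phi t 0 1))
     (fun t => dV (phi t 0 0) (phi t 0 1)) 0 t (C2 / 2) C2) => //.
  - by rewrite ltr_pdivrMr// mulr_natr mulr2n ltrDl.
  - move=> u uin; have [dv dw] := planar_solution sol (Ji 0 t J0 Jt u uin).
    by rewrite /V; apply: is_derive_eq; rewrite /dV /GRing.scale /=; ring.
  - by move=> u _ /andP[_]; exact: dVle.
move=> VC; have /small[wdl ve] : V (phi t 0 0) (phi t 0 1) < C2.
  by apply: (le_lt_trans VC); rewrite ltr_pdivrMr// mulr_natr mulr2n ltrDl.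
apply: norm_row_lt => //; apply: ord2_cases => //.
by apply: (le_lt_trans wdl); lra.
Qed.

End PlanarStability.

(** * Existence of the center manifold *)

Section SlowSolution.
Variable R : realType.
Variables al e : R.
Hypothesis al0 : al != 0.

(* With [T = 1 / v^2], the graph [h v = - (b / a) v^2 / (1 + k T)] is invariant
   iff [k' = slow_rhs T k], for [al = a^2 / (2 B b)] and [e = (c - 2 B) / (2 B)]. *)
Definition slow_rhs (T k : R) := al * (1 + k) ^+ 2 * k + e * (1 + k) * T^-1.

Let cl := @clamp R (- (1 / 2)) (1 / 2).
(** The truncation agrees with [slow_rhs] for [|k| <= 1 / 2] and [1 <= T]. The window for [k] also
    keeps [1 + k], the denominator of the graph, away from zero. *)
Definition slow_cut (T k : R) :=
  al * ((1 + cl k) * (1 + cl k)) * cl k + e * (1 + cl k) * (Num.max 1 T)^-1.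

Lemma bounded_lipschitz_inv_max : bounded_lipschitz (fun T _ : R => (Num.max 1 T)^-1).
Proof.
have m1 (x : R) : 1 <= Num.max 1 x by rewrite le_max lexx.
have m0 (x : R) : 0 < Num.max 1 x by exact: lt_le_trans (m1 x).
exists 1, 1; split=> //; last first.
  by move=> x _; rewrite ger0_norm ?invr_ge0 ?(ltW (m0 x))// invf_le1.
move=> x y x' y'; rewrite mul1r; apply: (@le_trans _ _ `|x - x'|); last by rewrite lerDl.
have -> : (Num.max 1 x)^-1 - (Num.max 1 x')^-1 =
    (Num.max 1 x' - Num.max 1 x) * ((Num.max 1 x)^-1 * (Num.max 1 x')^-1).
  by field; rewrite !gt_eqF.
rewrite normrM [X in _ * X]ger0_norm ?mulr_ge0 ?invr_ge0 ?(ltW (m0 _))//.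
apply: (@le_trans _ _ `|Num.max 1 x' - Num.max 1 x|).
  rewrite ler_piMr//; apply: mulr_ile1; rewrite ?invr_ge0 ?(ltW (m0 _))//; by rewrite invf_le1.
have [le1 le2] : x' - x <= `|x - x'| /\ x - x' <= `|x - x'|.
  by split; [rewrite distrC|]; exact: ler_norm.
rewrite ler_norml /Num.max; case: (ltP 1 x) => ?; case: (ltP 1 x') => ?;
by apply/andP; split; lra.
Qed.

Let half_itv : - (1 / 2) <= 1 / 2 :> R. Proof. by lra. Qed.

Lemma bounded_lipschitz_slow_cut : bounded_lipschitz slow_cut.
Proof.
have [_ blk] := bounded_lipschitz_clamp half_itv.
have blc (r : R) := bounded_lipschitz_cst r.
have bl1 := bounded_lipschitzD (blc 1) blk.
apply: (bounded_lipschitzD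
  (bounded_lipschitzM (bounded_lipschitzM (blc al) (bounded_lipschitzM bl1 bl1)) blk)
  (bounded_lipschitzM (bounded_lipschitzM (blc e) bl1) bounded_lipschitz_inv_max)).
Qed.

Lemma slow_cutE T k : 1 <= T -> `|k| <= 1 / 2 -> slow_cut T k = slow_rhs T k.
Proof.
move=> T1; rewrite ler_norml => kin.
by rewrite /slow_cut /slow_rhs /cl clamp_id// max_r// expr2.
Qed.

(** The equation depends on the time [T], which is made the first coordinate of an autonomous system
    with velocity 1. *)
Lemma slow_cut_solution T0 k0 : exists k : R -> R, k T0 = k0 /\
  forall T : R, is_derive T 1 k (slow_cut T (k T)).
Proof.
have [x [y [x0 y0 dx dy]]] :=
  picard_bounded_lipschitz (bounded_lipschitz_cst 1) bounded_lipschitz_slow_cut T0 k0.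
have xE t : x t = T0 + t.
  have : x t - t = x 0 - 0.
    apply: (@is_derive_0_is_cst R (fun t => x t - t)) => s.
    by have dxs := dx s; apply: is_derive_eq; rewrite subrr.
  by rewrite x0 => /eqP; rewrite subr_eq subr0 => /eqP.
exists (fun T => y (T - T0)); split; first by rewrite subrr.
move=> T; have := dy (T - T0); rewrite xE subrKC => dyT.
rewrite -[X in is_derive _ _ _ X]mulr1.
apply: (@is_derive1_comp _ y (fun T => T - T0)) => //.
by apply: is_derive_eq; rewrite subr0.
Qed.

Lemma slow_cut_dependence : exists2 M : R, 0 <= M &
  forall (k1 k2 : R -> R) (T0 T : R), T0 <= T ->
  (forall T : R, is_derive T 1 k1 (slow_cut T (k1 T))) ->
  (forall T : R, is_derive T 1 k2 (slow_cut T (k2 T))) ->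
  (k1 T - k2 T) ^+ 2 <= (k1 T0 - k2 T0) ^+ 2 * expR (M * (T - T0)).
Proof.
have [K [_ [K0 _ KL _]]] := bounded_lipschitz_slow_cut.
exists (2 * K); first by rewrite mulr_ge0.
move=> k1 k2 T0 T T0T dk1 dk2.
apply: (@expR_bound R (fun T => (k1 T - k2 T) ^+ 2)
  (fun T => 2 * ((k1 T - k2 T) * (slow_cut T (k1 T) - slow_cut T (k2 T))))) => // s _.
  have d1 := dk1 s; have d2 := dk2 s; apply: is_derive_eq.
  by rewrite /GRing.scale /=; ring.
rewrite -mulrA ler_wpM2l//; apply: (le_trans (ler_norm _)).
rewrite normrM -[X in _ <= K * X]real_normK ?num_real//.
have := KL s (k1 s) s (k2 s); rewrite subrr normr0 add0r => H.
by apply: (le_trans (ler_wpM2l (normr_ge0 _) H)); rewrite expr2 mulrCA.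
Qed.

(** In terms of [u = T * k], the main term of [al * (u ^+ 2)' / 2] is at least
    [al ^+ 2 * u ^+ 2 / 4]. Each of the other two terms is at most half of that, one because
    [8 / |al| <= T], the other because [12 * |e| / |al| <= |u|]. The summand [4 * C] makes
    [|u| <= 2 * C] imply [|k| <= 1 / 2]. *)
Let C := 12 * `|e| / `|al| + 1.
Let T0 := 8 / `|al| + 4 * C + 1.
Let nal : 0 < `|al|. Proof. by rewrite normr_gt0. Qed.
Let C1 : 1 <= C. Proof. by rewrite lerDr divr_ge0// mulr_ge0. Qed.
Let C0 : 0 < C. Proof. exact: lt_le_trans C1. Qed.
Let T0C : 4 * C <= T0.
Proof. by have : 0 <= 8 / `|al| by []; rewrite /T0; lra. Qed.
Let T01 : 1 <= T0.
Proof. by have : 0 <= 8 / `|al| by []; rewrite /T0; have := C1; lra. Qed.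

Let u2 (k : R -> R) (T : R) := (T * k T) ^+ 2.
Let du2 (k : R -> R) (T : R) := 2 * (T * k T) * (k T + T * slow_cut T (k T)).

Let is_derive_u2 (k : R -> R) (T : R) : (forall T : R, is_derive T 1 k (slow_cut T (k T))) ->
  is_derive T 1 (u2 k) (du2 k T).
Proof.
move=> dk; have dkT := dk T; rewrite /u2 /du2.
by apply: is_derive_eq; rewrite /GRing.scale /=; ring.
Qed.

Lemma slow_window (T k : R) : T0 <= T -> (T * k) ^+ 2 <= (2 * C) ^+ 2 -> `|k| <= 1 / 2.
Proof.
move=> T0T; rewrite -[_ ^+ 2]real_normK ?num_real// ler_sqr ?nnegrE ?mulr_ge0 ?(ltW C0)//.
have Tp : 0 < T by apply: lt_le_trans T0T; exact: lt_le_trans T01.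
rewrite normrM gtr0_norm// => H; rewrite -(ler_pM2l Tp).
by apply: (le_trans H); have := T0C; lra.
Qed.

(* Outside [|T k| <= C] the linear term [al k] dominates. *)
Lemma slow_sign (k : R -> R) (T : R) : T0 <= T ->
  C ^+ 2 < u2 k T < (2 * C) ^+ 2 -> 0 <= al * du2 k T.
Proof.
move=> T0T /andP[u1 u2'].
have Tp : 0 < T by apply: lt_le_trans T0T; exact: lt_le_trans T01.
have T1 : 1 <= T by exact: le_trans T0T.
have kh := slow_window T0T (ltW u2').
rewrite /du2 slow_cutE// /slow_rhs; move: u1; rewrite /u2.
set kT := k T in kh *; set u := T * kT => u1.
have Cu : C < `|u|.
  by rewrite -ltr_sqr ?nnegrE ?(ltW C0)// real_normK ?num_real.
have Tn := lt0r_neq0 Tp.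
have -> : al * (2 * u * (kT + T * (al * (1 + kT) ^+ 2 * kT + e * (1 + kT) / T))) =
  2 * (al * u ^+ 2 / T + al ^+ 2 * (1 + kT) ^+ 2 * u ^+ 2 + al * e * (1 + kT) * u).
  by rewrite /u; field.
rewrite mulr_ge0//.
have [k1 k2] : - (1 / 2) <= kT /\ kT <= 1 / 2 by apply/andP; rewrite -ler_norml.
have al2 : al ^+ 2 = `|al| ^+ 2 by rewrite real_normK ?num_real.
have u22 : u ^+ 2 = `|u| ^+ 2 by rewrite real_normK ?num_real.
have t1 : - (`|al| ^+ 2 / 8 * `|u| ^+ 2) <= al * u ^+ 2 / T.
  have : `|al * u ^+ 2 / T| <= `|al| ^+ 2 / 8 * `|u| ^+ 2.
    rewrite normrM normfV (gtr0_norm Tp) ler_pdivrMr//.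
    rewrite (normrM al) normrX.
    have -> : `|al| ^+ 2 / 8 * `|u| ^+ 2 * T = (`|al| * `|u| ^+ 2) * (`|al| / 8 * T) by ring.
    rewrite ler_peMr ?mulr_ge0//.
    have : `|al| / 8 * T0 <= `|al| / 8 * T by rewrite ler_wpM2l// divr_ge0.
    apply: le_trans; rewrite /T0.
    have -> : `|al| / 8 * (8 / `|al| + 4 * C + 1) = 1 + `|al| / 8 * (4 * C + 1).
      by field; rewrite gt_eqF.
    by rewrite lerDl mulr_ge0 ?divr_ge0// addr_ge0// mulr_ge0// ltW.
  by rewrite ler_norml => /andP[].
have t2 : `|al| ^+ 2 / 4 * `|u| ^+ 2 <= al ^+ 2 * (1 + kT) ^+ 2 * u ^+ 2.
  rewrite al2 u22 ler_wpM2r ?exprn_ge0// ler_wpM2l ?exprn_ge0//.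
  have -> : 4^-1 = (1 / 2) ^+ 2 :> R by field.
  by rewrite ler_sqr ?nnegrE; lra.
have t3 : - (`|al| * `|e| * (3 / 2) * `|u|) <= al * e * (1 + kT) * u.
  have : `|al * e * (1 + kT) * u| <= `|al| * `|e| * (3 / 2) * `|u|.
    rewrite !normrM ler_wpM2r// ler_wpM2l ?mulr_ge0// ger0_norm; lra.
  by rewrite ler_norml => /andP[].
have t4 : `|al| * `|e| * (3 / 2) * `|u| <= `|al| ^+ 2 / 8 * `|u| ^+ 2.
  have -> : `|al| ^+ 2 / 8 * `|u| ^+ 2 = `|al| * (`|al| / 8 * `|u|) * `|u| by ring.
  rewrite ler_wpM2r// -mulrA ler_wpM2l//.
  apply: (@le_trans _ _ (`|al| / 8 * C)); last by rewrite ler_wpM2l ?divr_ge0// ltW.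
  have -> : `|al| / 8 * C = `|e| * (3 / 2) + `|al| / 8.
    by rewrite /C; field; rewrite gt_eqF.
  by rewrite lerDl divr_ge0.
move: t1 t2 t3 t4; lra.
Qed.

Lemma bounded_cluster (x : nat -> R) (A : R) : (forall n, `|x n| <= A) ->
  exists l, forall d N, 0 < d -> exists2 n, (N <= n)%N & `|l - x n| < d.
Proof.
move=> xA; have [|l [_ lcl]] := @segment_compact R (- A) A (x @ \oo) _.
  by exists 0%N => // n _; rewrite /= in_itv /= -ler_norml.
exists l => d N d0.
have [|y [[n Nn <-] ly]] := lcl [set x n | n in [set n | (N <= n)%N]] (ball l d) _ (nbhsx_ballx _ _ d0).
  by exists N => // n Nn; exists n.
by exists n.
Qed.

(** The decay [C / T] is what makes the graph [C^1] at the origin. For [al < 0] the strip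
    [|T * k| <= C] attracts and the solution starting from zero stays in it; for [al > 0] it repels,
    and a solution that stays has to be selected. *)
Lemma slow_solution : exists (T0 C : R) (k : R -> R), [/\ 1 <= T0, 0 < C &
  forall T : R, T0 <= T -> [/\ is_derive T 1 k (slow_rhs T (k T)),
    `|k T| <= 1 / 2 & `|k T| <= C * T^-1]].
Proof.
suff [k dk kC] : exists2 k : R -> R, (forall T : R, is_derive T 1 k (slow_cut T (k T))) &
    forall T, T0 <= T -> u2 k T <= C ^+ 2.
  exists T0, C, k; split=> // T T0T.
  have Tp : 0 < T by apply: lt_le_trans T0T; exact: lt_le_trans T01.
  have uC := kC T T0T.
  have kh : `|k T| <= 1 / 2.
    apply: (slow_window T0T); apply: (le_trans uC).
    by rewrite ler_sqr ?nnegrE ?mulr_ge0 ?(ltW C0)//; have := C0; lra.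
  split=> //; first by rewrite -slow_cutE//; exact: le_trans T0T.
  move: uC; rewrite /u2 -[_ ^+ 2]real_normK ?num_real// ler_sqr ?nnegrE ?(ltW C0)//.
  by rewrite normrM gtr0_norm// ler_pdivlMr// mulrC.
have CC2 : C ^+ 2 < (2 * C) ^+ 2.
  by rewrite ltr_sqr ?nnegrE ?mulr_ge0 ?(ltW C0)//; have := C0; lra.
have [alneg|alpos] := ltP al 0.
  have [k [k0 dk]] := slow_cut_solution T0 0.
  exists k => // T T0T.
  apply: (@trap_right R (u2 k) (du2 k) T0 T (C ^+ 2) ((2 * C) ^+ 2)) => //.
  - by move=> s _; exact: is_derive_u2.
  - move=> s /andP[T0s _] win; have := slow_sign T0s win.
    by rewrite nmulr_rge0.
  - by rewrite /u2 k0 mulr0 expr0n /= sqr_ge0.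
have {}alpos : 0 < al by rewrite lt_neqAle eq_sym al0.
(* Shooting backwards: the solution that vanishes at [T0 + n] stays in the strip on [[T0, T0 + n]],
   because the strip attracts in reversed time. A cluster point [l] of the values at [T0] starts a
   solution that stays in it forever. *)
have back (n : nat) : exists k : R -> R,
    (forall T : R, is_derive T 1 k (slow_cut T (k T))) /\
    forall T, T0 <= T <= T0 + n%:R -> u2 k T <= C ^+ 2.
  have [k [k0 dk]] := slow_cut_solution (T0 + n%:R) 0.
  exists k; split=> // T /andP[T0T Tn].
  apply: (@trap_left R (u2 k) (du2 k) T (T0 + n%:R) (C ^+ 2) ((2 * C) ^+ 2)) => //.
  - by move=> s _; exact: is_derive_u2.
  - move=> s /andP[Ts _] win; have := slow_sign (le_trans T0T Ts) win.
    by rewrite pmulr_rge0.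
  - by rewrite /u2 k0 mulr0 expr0n /= sqr_ge0.
have [kn knP] := choice back.
have kn0 n : `|kn n T0| <= 1 / 2.
  have [_ /(_ T0)] := knP n; rewrite lexx lerDl ler0n => /(_ isT) H.
  by apply: (slow_window (lexx _)); apply: (le_trans H); exact: ltW.
have [l lP] := bounded_cluster kn0.
have [k [k0 dk]] := slow_cut_solution T0 l.
exists k => // T T0T.
have [M M0 dep] := slow_cut_dependence.
have Tp : 0 < T by apply: lt_le_trans T0T; exact: lt_le_trans T01.
rewrite /u2 -[X in X <= _]real_normK ?num_real// ler_sqr ?nnegrE ?(ltW C0)//.
apply/ler_addgt0Pl => d d0; rewrite addrC.
pose E := expR (M * (T - T0)).
have E0 : 0 < E by exact: expR_gt0.
have E1 : 1 <= E by rewrite /E -expR0 ler_expR mulr_ge0// subr_ge0.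
(* The tolerance at [T0] compensates both the Gronwall factor, since [E <= E ^+ 2], and the factor
   [T] in [T * k]; the index is taken large enough that [T <= T0 + n]. *)
have dE : 0 < d / (T * E) by rewrite divr_gt0// mulr_gt0.
have [n Nn ln] := lP (d / (T * E)) (Num.bound (T - T0)) dE.
have [dkn knC] := knP n.
have Tn : T0 <= T <= T0 + n%:R.
  rewrite T0T -lerBlDl ltW// (@lt_le_trans _ _ (Num.bound (T - T0))%:R)//.
    by rewrite archi_boundP// subr_ge0.
  by rewrite ler_nat.
have := knC T Tn; rewrite /u2 -[X in X <= _ -> _]real_normK ?num_real//.
rewrite ler_sqr ?nnegrE ?(ltW C0)// => uC.
have := dep k (kn n) T0 T T0T dk dkn; rewrite k0 -/E => H.
have close : `|k T - kn n T| <= d / T.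
  rewrite -ler_sqr ?nnegrE ?divr_ge0 ?(ltW d0) ?(ltW Tp)// real_normK ?num_real//.
  apply: (le_trans H); rewrite -[X in X * _]real_normK ?num_real//.
  apply: (@le_trans _ _ ((d / (T * E)) ^+ 2 * E ^+ 2)).
    apply: ler_pM; rewrite ?exprn_ge0 ?(ltW E0)//; last by rewrite expr2 ler_peMr// ltW.
    by rewrite ler_sqr ?nnegrE ?(ltW dE)// ltW.
  rewrite -exprMn le_eqVlt; apply/orP; left; apply/eqP; congr (_ ^+ 2); field.
  by rewrite !lt0r_neq0.
have -> : T * k T = T * kn n T + T * (k T - kn n T) by ring.
apply: (le_trans (ler_normD _ _)); apply: lerD => //.
rewrite (normrM T) (gtr0_norm Tp) mulrC -ler_pdivlMr//.
Qed.

End SlowSolution.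

(** * From the slow equation back to the graph *)

Section Existence.
Variable R : realType.
Variables a B b c : R.
Hypotheses (a0 : a != 0) (B0 : B != 0).

Lemma is_derive_quadratic_bound (h : R -> R) (r K : R) : 0 < r -> h 0 = 0 ->
  (forall v, `|v| < r -> `|h v| <= K * `|v| ^+ 2) -> is_derive (0 : R) 1 h 0.
Proof.
move=> r0 h0 hK.
have K0 : 0 <= K.
  have r2 : `|r / 2| < r by rewrite gtr0_norm ?divr_gt0//; lra.
  have := le_trans (normr_ge0 _) (hK _ r2).
  by rewrite pmulr_lge0// exprn_gt0// normr_gt0 lt0r_neq0// divr_gt0.
have H : (fun t => t^-1 *: (h (t *: 1 + 0) - h 0)) @ 0^' --> (0 : R).
  apply/cvgrPdist_le => /= e e0.
  pose d := Num.min r (e / (K + 1)).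
  have K1 : 0 < K + 1 by rewrite ltr_wpDl.
  have d0 : 0 < d by rewrite lt_min r0 divr_gt0.
  have : \forall t \near (0 : R)^', `|t| < d by exact: dnbhs0_lt.
  have : \forall t \near (0 : R)^', t != 0 by exact: nbhs_dnbhs_neq.
  apply: filterS2 => t t0; rewrite lt_min => /andP[tr].
  rewrite ltr_pdivlMr// => tK.
  rewrite sub0r normrN h0 subr0 addr0 /GRing.scale /= mulr1 normrM normfV.
  rewrite mulrC ler_pdivrMr ?normr_gt0//; apply: (le_trans (hK t tr)).
  rewrite expr2 mulrA ler_wpM2r//; apply: le_trans (ltW tK).
  by rewrite mulrC ler_wpM2l// lerDl.
apply: DeriveDef; first by apply/cvg_ex; exists 0; exact: H.
exact: cvg_lim H.
Qed.

Lemma exists_invariant_graph : exists h r, invariant_graph a B b c h r.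
Proof.
have [b0|b0] := eqVneq b 0.
  have d0 : derive1 (fun=> 0 : R) = (fun=> 0 : R).
    by apply/funext => v; rewrite derive1_cst.
  exists (fun=> 0), 1; split=> //.
  - by split=> //; rewrite d0.
  - move=> v _; split; first exact: derivable_cst.
    by rewrite d0; exact: cvg_cst.
  - by move=> v _; rewrite /invariance_equation b0 d0 expr0n /=; ring.
pose al := a ^+ 2 / (2 * B * b); pose e := (c - 2 * B) / (2 * B); pose kap := - (b / a).
have al0 : al != 0 by rewrite mulf_neq0 ?invr_neq0 ?expf_neq0// !mulf_neq0// pnatr_eq0.
have [T0 [C [k [T01 C0 kP]]]] := slow_solution e al0.
(* As [r <= 1], [|v| < r] gives [v ^+ 2 < r], so that [1 / v ^+ 2] lies beyond [T0]. *)
pose r := (T0 + 1)^-1.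
have T0p : 0 < T0 + 1 by lra.
have r0 : 0 < r by rewrite invr_gt0.
have r1 : r <= 1 by rewrite invf_le1//; lra.
have vT (v : R) : v != 0 -> `|v| < r -> T0 < (v ^+ 2)^-1.
  move=> v0 vr; have nv : 0 < `|v| by rewrite normr_gt0.
  have v2 : v ^+ 2 < r.
    rewrite -[_ ^+ 2]real_normK ?num_real// expr2.
    apply: (le_lt_trans _ vr); rewrite ler_piMl//; lra.
  have : r^-1 < (v ^+ 2)^-1 by rewrite ltf_pV2// posrE exprn_even_gt0.
  by rewrite /r invrK; lra.
pose L v := 1 + k ((v ^+ 2)^-1).
pose h v := kap * (v ^+ 2 / L v).
(* This is the derivative of [h] with [slow_rhs] inserted for that of [k]. The only quotient by [v]
   left is [k (1 / v^2) / v], which is of order [v] by the decay of [k]; hence [dh] tends to 0 at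
   the origin. *)
pose dh v := 2 * kap * (v / L v + al * (k ((v ^+ 2)^-1) / v) + e * (v / L v)).
have Lbound v : v != 0 -> `|v| < r -> 1 / 2 <= L v.
  move=> v0 vr; have [_ + _] := kP _ (ltW (vT v v0 vr)).
  by rewrite ler_norml /L => /andP[]; lra.
have kC v : v != 0 -> `|v| < r -> `|k ((v ^+ 2)^-1)| <= C * v ^+ 2.
  by move=> v0 vr; have [_ _] := kP _ (ltW (vT v v0 vr)); rewrite invrK.
have dhP (v : R) : v != 0 -> `|v| < r -> is_derive v 1 h (dh v).
  move=> v0 vr; have [dk _ _] := kP _ (ltW (vT v v0 vr)).
  have Lv := Lbound v v0 vr; have Ln : L v != 0 by rewrite lt0r_neq0//; lra.
  have dX : is_derive v 1 (fun v : R => v ^+ 2) (2 * v).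
    by apply: is_derive_eq; rewrite /GRing.scale /=; ring.
  have dV : is_derive v 1 (fun v : R => (v ^+ 2)^-1) (- (v ^+ 2) ^- 2 *: (2 * v)).
    by apply: (@is_deriveV R (fun s => s ^+ 2)); rewrite /= expf_neq0.
  have dK := @is_derive1_comp _ k (fun v : R => (v ^+ 2)^-1) v _ _ dk dV.
  have dL : is_derive v 1 L (slow_rhs al e (v ^+ 2)^-1 (k (v ^+ 2)^-1) * (- (v ^+ 2) ^- 2 *: (2 * v))).
    by rewrite /L -[X in is_derive _ _ _ X]add0r; exact: is_deriveD.
  have dLV := @is_deriveV R L v _ 1 Ln dL.
  apply: is_derive_eq; rewrite /dh /slow_rhs /GRing.scale /=.
  rewrite /L in Ln *; move: (k _) Ln => q Ln; field.
  by rewrite v0 Ln.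
have near_in (v : R) : v != 0 -> `|v| < r -> \forall s \near v, s != 0 /\ `|s| < r.
  move=> v0 vr.
  have : \forall s \near v, `|s| < r.
    by apply: (@norm_continuous R R v [set s | s < r]); exact: lt_nbhsl.
  have : \forall s \near v, 0 < `|s|.
    apply: (@norm_continuous R R v [set s | 0 < s]); apply: lt_nbhsr.
    by rewrite normr_gt0.
  by apply: filterS2 => s; rewrite normr_gt0.
have d1h (v : R) : v != 0 -> `|v| < r -> derive1 h v = dh v.
  by move=> v0 vr; rewrite derive1E; apply: derive_val; exact: dhP.
(* At [v = 0] the inverse takes its default value 0, so [L 0] is meaningless, but the factor
   [v ^+ 2] removes it. *)
have h0 : h 0 = 0 by rewrite /h expr0n /= mul0r mulr0.
have LV v : v != 0 -> `|v| < r -> `|(L v)^-1| <= 2.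
  move=> v0 vr; have Lv := Lbound v v0 vr.
  have Lp : 0 < L v by lra.
  by rewrite gtr0_norm ?invr_gt0// -[leRHS]invrK lef_pV2 ?posrE//; lra.
have dh0 : is_derive (0 : R) 1 h 0.
  apply: (@is_derive_quadratic_bound h r (`|kap| * 2)) => // v vr.
  have [->|v0] := eqVneq v 0; first by rewrite h0 normr0 expr0n /= mulr0.
  rewrite /h normrM -[leRHS]mulrA ler_wpM2l// normrM normrX mulrC ler_wpM2r ?exprn_ge0//.
  exact: LV.
have d1h0 : derive1 h 0 = 0 by rewrite derive1E; exact: derive_val.
exists h, r; split; [exact: r0|by split| |].
- move=> v vr; have [->|v0] := eqVneq v 0; last first.
    split; first by have [] := dhP v v0 vr.
    have cdh : {for v, continuous dh}.
      have [dk _ _] := kP _ (ltW (vT v v0 vr)).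
      have Lv := Lbound v v0 vr; have Ln : L v != 0 by rewrite lt0r_neq0//; lra.
      have cV : {for v, continuous (fun v : R => (v ^+ 2)^-1)}.
        apply: (@is_derive_continuous _ _ _ _ (- (v ^+ 2) ^- 2 *: (2 * v))).
        apply: (@is_deriveV R (fun s => s ^+ 2)); rewrite /= ?expf_neq0//.
        by apply: is_derive_eq; rewrite /GRing.scale /=; ring.
      have ck : {for v, continuous (fun v : R => k ((v ^+ 2)^-1))}.
        exact: (continuous_comp cV (is_derive_continuous dk)).
      have cL : {for v, continuous (fun v : R => (L v)^-1)}.
        by apply: cvgV => //; apply: cvgD => //; exact: cvg_cst.
      have cvL : {for v, continuous (fun v : R => v / L v)}.
        by apply: cvgM => //; exact: cvg_id.
      apply: cvgM; first exact: cvg_cst.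
      apply: cvgD; last by apply: cvgM => //; exact: cvg_cst.
      apply: cvgD => //; apply: cvgM; first exact: cvg_cst.
      apply: cvgM => //; apply: cvgV => //; exact: cvg_id.
    suff : (derive1 h) x @[x --> v] --> derive1 h v by [].
    rewrite (d1h _ v0 vr); apply: cvg_trans cdh.
    by apply: near_eq_cvg; apply: filterS (near_in v v0 vr) => s [s0 sr]; rewrite d1h.
  split; first by case: dh0.
  suff : (derive1 h) x @[x --> 0] --> derive1 h 0 by [].
  rewrite d1h0; apply/cvgrPdist_le => /= d d0.
  pose K := `|2 * kap| * (2 + `|al| * C + `|e| * 2).
  have K0 : 0 <= K by rewrite mulr_ge0// !addr_ge0// mulr_ge0// ltW.
  have K1 : 0 < K + 1 by rewrite ltr_wpDl.
  apply/nbhs_ballP; exists (Num.min r (d / (K + 1))).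
    by rewrite /= lt_min r0 divr_gt0.
  move=> {v vr} v; rewrite /ball /= !sub0r !normrN lt_min => /andP[vr].
  rewrite ltr_pdivlMr// => vK.
  have [->|v0] := eqVneq v 0; first by rewrite d1h0 normr0 ltW.
  rewrite (d1h _ v0 vr); apply: (@le_trans _ _ (K * `|v|)); last first.
    by apply: le_trans (ltW vK); rewrite mulrC ler_wpM2l// lerDl.
  have vL : `|v / L v| <= 2 * `|v|.
    by rewrite normrM mulrC ler_wpM2r// LV.
  rewrite /dh normrM -[leRHS]mulrA ler_wpM2l//.
  apply: (le_trans (ler_normD _ _)); rewrite [leRHS]mulrDl; apply: lerD.
    apply: (le_trans (ler_normD _ _)); rewrite [leRHS]mulrDl; apply: lerD => //.
    rewrite normrM -[leRHS]mulrA ler_wpM2l// normrM normfV ler_pdivrMr ?normr_gt0//.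
    rewrite -mulrA -expr2 real_normK ?num_real//; exact: kC.
  by rewrite normrM -[leRHS]mulrA ler_wpM2l.
- move=> v vr; rewrite /invariance_equation; have [->|v0] := eqVneq v 0.
    by rewrite h0 expr0n /=; ring.
  have Lv := Lbound v v0 vr; have Ln : L v != 0 by rewrite lt0r_neq0//; lra.
  rewrite (d1h _ v0 vr) /dh /h.
  have -> : k ((v ^+ 2)^-1) = L v - 1 by rewrite /L; ring.
  rewrite /al /e /kap; field.
  by rewrite ?a0 ?b0 ?B0 ?v0 ?Ln.
Qed.

End Existence.

(** * Calculus on row vectors *)

Section RowCalculus.
Variable R : realType.

Lemma is_derive_along (V W : normedModType R) (f : V -> W) (x v : V) (d : W) :
  is_derive (0 : R) 1 (fun t => f (t *: v + x)) d -> is_derive x v f d.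
Proof.
move=> [df dE]; apply: DeriveDef; first exact/derivable1P.
rewrite -dE /derive; set g1 := fun h => h^-1 *: _; set g2 := fun h => h^-1 *: _.
suff -> : g1 = g2 by [].
by apply/funext => h; rewrite /g1 /g2 /= addr0 scale0r add0r [_%:A]mulr1.
Qed.

Lemma ord3_cases (P : 'I_3 -> Prop) : P 0 -> P 1 -> P 2 -> forall i, P i.
Proof.
move=> P0 P1 P2 [[|[|[|m]]] i] //.
- by have -> : Ordinal i = 0 by apply: val_inj.
- by have -> : Ordinal i = 1 by apply: val_inj.
- by have -> : Ordinal i = 2 by apply: val_inj.
Qed.

Lemma row3E0 (a b c : R) : row3 a b c 0 0 = a. Proof. by rewrite mxE. Qed.
Lemma row3E1 (a b c : R) : row3 a b c 0 1 = b. Proof. by rewrite mxE. Qed.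
Lemma row3E2 (a b c : R) : row3 a b c 0 2 = c. Proof. by rewrite mxE. Qed.
Definition row3E := (row3E0, row3E1, row3E2).

Lemma row3_eta (q : 'rV[R]_3) : q = row3 (q 0 0) (q 0 1) (q 0 2).
Proof. by apply/rowP; apply: ord3_cases; rewrite row3E. Qed.

Lemma row3D (a b c a' b' c' : R) :
  row3 a b c + row3 a' b' c' = row3 (a + a') (b + b') (c + c').
Proof. by apply/rowP; apply: ord3_cases; rewrite mxE !row3E. Qed.

Lemma row3Z (k a b c : R) : k *: row3 a b c = row3 (k * a) (k * b) (k * c).
Proof. by apply/rowP; apply: ord3_cases; rewrite mxE !row3E. Qed.

Lemma is_derive_row3 (V : normedModType R) (f g h : V -> R) (x v : V) (df dg dh : R) :
  is_derive x v f df -> is_derive x v g dg -> is_derive x v h dh ->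
  is_derive x v (fun s => row3 (f s) (g s) (h s)) (row3 df dg dh).
Proof.
move=> fd gd hd; apply: is_derive_row; apply: ord3_cases; rewrite row3E;
by under eq_fun do rewrite row3E.
Qed.

Lemma is_derive_translate (f : R -> R) (x d : R) :
  is_derive x 1 f d -> is_derive (0 : R) 1 (fun t => f (t + x)) d.
Proof.
move=> fd; rewrite -[d]mulr1; apply: (@is_derive1_comp _ f (fun t => t + x)).
  by rewrite add0r.
by apply: is_derive_eq; rewrite addr0.
Qed.

Lemma delta_row3 (t : R) (q : 'rV[R]_3) :
  [/\ t *: delta_mx 0 0 + q = row3 (t + q 0 0) (q 0 1) (q 0 2),
      t *: delta_mx 0 1 + q = row3 (q 0 0) (t + q 0 1) (q 0 2) &
      t *: delta_mx 0 2 + q = row3 (q 0 0) (q 0 1) (t + q 0 2)].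
Proof.
by split; apply/rowP; apply: ord3_cases; rewrite row3E !mxE /= ?(mulr1, mulr0, add0r).
Qed.

Lemma delta_row2 (t : R) (q : 'rV[R]_2) :
  (t *: delta_mx 0 0 + q = row2 (t + q 0 0) (q 0 1)) *
  (t *: delta_mx 0 1 + q = row2 (q 0 0) (t + q 0 1)).
Proof.
by split; apply/rowP; apply: ord2_cases; rewrite row2E !mxE /= ?(mulr1, mulr0, add0r).
Qed.

Variables (f g h : R -> R -> R -> R).
Let F (q : 'rV[R]_3) := row3 (f (q 0 0) (q 0 1) (q 0 2)) (g (q 0 0) (q 0 1) (q 0 2))
  (h (q 0 0) (q 0 1) (q 0 2)).

Lemma partial0_row3 (x y l df dg dh : R) :
  is_derive x 1 (fun x => f x y l) df -> is_derive x 1 (fun x => g x y l) dg ->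
  is_derive x 1 (fun x => h x y l) dh ->
  is_derive (row3 x y l) (delta_mx 0 0) F (row3 df dg dh).
Proof.
move=> fd gd hd; apply: is_derive_along; rewrite /F.
have E (t : R) : t *: delta_mx 0 0 + row3 x y l = row3 (t + x) y l.
  by have [-> _ _] := delta_row3 t (row3 x y l); rewrite !row3E.
under eq_fun => t do rewrite E !row3E.
by apply: is_derive_row3; [exact: (is_derive_translate fd)|
  exact: (is_derive_translate gd)|exact: (is_derive_translate hd)].
Qed.

Lemma partial1_row3 (x y l df dg dh : R) :
  is_derive y 1 (fun y => f x y l) df -> is_derive y 1 (fun y => g x y l) dg ->
  is_derive y 1 (fun y => h x y l) dh ->
  is_derive (row3 x y l) (delta_mx 0 1) F (row3 df dg dh).
Proof.
move=> fd gd hd; apply: is_derive_along; rewrite /F.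
have E (t : R) : t *: delta_mx 0 1 + row3 x y l = row3 x (t + y) l.
  by have [_ -> _] := delta_row3 t (row3 x y l); rewrite !row3E.
under eq_fun => t do rewrite E !row3E.
by apply: is_derive_row3; [exact: (is_derive_translate fd)|
  exact: (is_derive_translate gd)|exact: (is_derive_translate hd)].
Qed.

Lemma partial2_row3 (x y l df dg dh : R) :
  is_derive l 1 (fun l => f x y l) df -> is_derive l 1 (fun l => g x y l) dg ->
  is_derive l 1 (fun l => h x y l) dh ->
  is_derive (row3 x y l) (delta_mx 0 2) F (row3 df dg dh).
Proof.
move=> fd gd hd; apply: is_derive_along; rewrite /F.
have E (t : R) : t *: delta_mx 0 2 + row3 x y l = row3 x y (t + l).
  by have [_ _ ->] := delta_row3 t (row3 x y l); rewrite !row3E.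
under eq_fun => t do rewrite E !row3E.
by apply: is_derive_row3; [exact: (is_derive_translate fd)|
  exact: (is_derive_translate gd)|exact: (is_derive_translate hd)].
Qed.

End RowCalculus.

(** * Jacobians and second-order Taylor polynomials *)

Section Jacobian.
Variable R : realType.

Lemma linearizationE (n : nat) (G : 'rV[R]_n.+1 -> 'rV[R]_n.+1) (p : 'rV[R]_n.+1) i j :
  differentiable G p -> linearization G p i j = partial j G p 0 i.
Proof.
move=> dG; rewrite /partial deriveEjacobian// /linearization [LHS]mxE.
by rewrite -rowE [RHS]mxE.
Qed.

Lemma differentiable_row3 (V : normedModType R) (f g h : V -> R) (x : V) :
  differentiable f x -> differentiable g x -> differentiable h x ->
  differentiable (fun s => row3 (f s) (g s) (h s)) x.
Proof.
move=> df dg dh.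
have -> : (fun s => row3 (f s) (g s) (h s)) = (fun s => f s *: row3 1 0 0) +
    (fun s => g s *: row3 0 1 0) + (fun s => h s *: row3 0 0 1).
  by apply/funext => s /=; rewrite /= !fctE !row3Z !row3D !(mulr1, mulr0, addr0, add0r).
by apply: differentiableD; [apply: differentiableD|]; exact: differentiableZl.
Qed.

Lemma differentiable_row2 (V : normedModType R) (f g : V -> R) (x : V) :
  differentiable f x -> differentiable g x ->
  differentiable (fun s => row2 (f s) (g s)) x.
Proof.
move=> df dg.
have -> : (fun s => row2 (f s) (g s)) = (fun s => f s *: row2 1 0) +
    (fun s => g s *: row2 0 1).
  apply/funext => s /=; rewrite !fctE; apply/rowP; apply: ord2_cases;
  by rewrite row2E !mxE /= !(mulr1, mulr0, addr0, add0r).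
by apply: differentiableD; exact: differentiableZl.
Qed.

Lemma sum_ord3 (V : nmodType) (s : 'I_3 -> V) : \sum_i s i = s 0 + s 1 + s 2.
Proof.
rewrite !big_ord_recl big_ord0 addr0 addrA.
by congr (s _ + s _ + s _); apply: val_inj.
Qed.

Lemma sum2_ord3 (V : nmodType) (s : 'I_3 -> 'I_3 -> V) : \sum_j \sum_k s j k =
  (s 0 0 + s 0 1 + s 0 2) + (s 1 0 + s 1 1 + s 1 2) + (s 2 0 + s 2 1 + s 2 2).
Proof. by rewrite sum_ord3; congr (_ + _ + _); exact: sum_ord3. Qed.

Lemma taylor2_row3 (G : 'rV[R]_3 -> 'rV[R]_3) (p : 'rV[R]_3) (dx dy dl : R) :
  let P := fun j k => partial j (partial k G) p in
  taylor2 G p (row3 dx dy dl) = G p + (dx *: partial 0 G p + dy *: partial 1 G p + dl *: partial 2 G p)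
  + 2^-1 *: (((dx * dx) *: P 0 0 + (dx * dy) *: P 0 1 + (dx * dl) *: P 0 2)
    + ((dy * dx) *: P 1 0 + (dy * dy) *: P 1 1 + (dy * dl) *: P 1 2)
    + ((dl * dx) *: P 2 0 + (dl * dy) *: P 2 1 + (dl * dl) *: P 2 2)).
Proof.
move=> P; set d := row3 dx dy dl.
have d0 : d 0 0 = dx by exact: row3E0.
have d1 : d 0 1 = dy by exact: row3E1.
have d2 : d 0 2 = dl by exact: row3E2.
have e1 := sum_ord3 (fun j => d 0 j *: partial j G p).
have e2 := sum2_ord3 (fun j k => (d 0 j * d 0 k) *: partial j (partial k G) p).
rewrite d0 d1 d2 in e1 e2.
exact: (f_equal2 (fun u v => G p + u + 2^-1 *: v) e1 e2).
Qed.

Lemma taylor2_eval (G : 'rV[R]_3 -> 'rV[R]_3) (p : 'rV[R]_3) (dx dy dl : R)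
    (v v0 v1 v2 v00 v10 v20 v01 v11 v21 v02 v12 v22 : 'rV[R]_3) :
  let P := fun j k => partial j (partial k G) p in
  G p = v -> partial 0 G p = v0 -> partial 1 G p = v1 -> partial 2 G p = v2 ->
  P 0 0 = v00 -> P 1 0 = v10 -> P 2 0 = v20 -> P 0 1 = v01 -> P 1 1 = v11 ->
  P 2 1 = v21 -> P 0 2 = v02 -> P 1 2 = v12 -> P 2 2 = v22 ->
  taylor2 G p (row3 dx dy dl) = v + (dx *: v0 + dy *: v1 + dl *: v2)
  + 2^-1 *: (((dx * dx) *: v00 + (dx * dy) *: v01 + (dx * dl) *: v02)
    + ((dy * dx) *: v10 + (dy * dy) *: v11 + (dy * dl) *: v12)
    + ((dl * dx) *: v20 + (dl * dy) *: v21 + (dl * dl) *: v22)).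
Proof.
by move=> P <- <- <- <- <- <- <- <- <- <- <- <- <-; exact: taylor2_row3.
Qed.

Lemma char_poly_tr (K : comNzRingType) (n : nat) (A : 'M[K]_n) :
  char_poly A^T = char_poly A.
Proof.
rewrite /char_poly -[RHS]det_tr; congr (\det _).
by apply/matrixP => i j; rewrite !mxE eq_sym.
Qed.

End Jacobian.

(** * Second-order expansion of the field *)

Section CubicField.
Variable R : realType.
Variables (e2 xi a1 a2 a3 : R) (I : set R) (D D1 Z Z1 E E1 : R -> R).
Hypothesis Iopen : open I.
Hypothesis dD : forall l : R, I l -> is_derive l 1 D (D1 l).
Hypothesis dZ : forall l : R, I l -> is_derive l 1 Z (Z1 l).
Hypothesis dE : forall l : R, I l -> is_derive l 1 E (E1 l).

(* [D] and [E = D / z'] are arbitrary functions of [lambda] in this section;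
   [fXx], [fXy], ... are the partial derivatives of the components [fX], [fY]. *)
Definition fB x y l := - (4 / 3) - 2 * xi * l * y ^+ 2 * Z l + a1 * x ^+ 2
  + a2 * (x + Z l) ^+ 2 + a3 * (1 - y ^+ 2).
Definition fX x y l := - (x - e2 * l * y ^+ 2) * D l + 3 / 2 * (x + 6 * xi * Z l) * fB x y l.
Definition fY x y l := y * (2 - 1 / 2 * l * x) * D l + 3 / 2 * y * fB x y l.
Definition fL x (y : R) l := x * E l.

Definition fBx x (y : R) l := 2 * a1 * x + 2 * a2 * (x + Z l).
Definition fBy (x : R) y l := - 4 * xi * l * y * Z l - 2 * a3 * y.
Definition fBl x y l := - 2 * xi * y ^+ 2 * (Z l + l * Z1 l) + 2 * a2 * (x + Z l) * Z1 l.

Definition fXx x y l := - D l + 3 / 2 * fB x y l + 3 / 2 * (x + 6 * xi * Z l) * fBx x y l.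
Definition fXy x y l := 2 * e2 * l * y * D l + 3 / 2 * (x + 6 * xi * Z l) * fBy x y l.
Definition fXl x y l := e2 * y ^+ 2 * D l - (x - e2 * l * y ^+ 2) * D1 l
  + 9 * xi * Z1 l * fB x y l + 3 / 2 * (x + 6 * xi * Z l) * fBl x y l.
Definition fYx x y l := - (1 / 2) * l * y * D l + 3 / 2 * y * fBx x y l.
Definition fYy x y l := (2 - 1 / 2 * l * x) * D l + 3 / 2 * fB x y l + 3 / 2 * y * fBy x y l.
Definition fYl x y l := - (1 / 2) * x * y * D l + y * (2 - 1 / 2 * l * x) * D1 l
  + 3 / 2 * y * fBl x y l.

Definition cubic_field (q : 'rV[R]_3) := row3 (fX (q 0 0) (q 0 1) (q 0 2))
  (fY (q 0 0) (q 0 1) (q 0 2)) (fL (q 0 0) (q 0 1) (q 0 2)).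

Lemma is_derive_fBx (x y l : R) : is_derive x 1 (fun x => fB x y l) (fBx x y l).
Proof. by rewrite /fB /fBx; apply: is_derive_eq; rewrite /GRing.scale /=; ring. Qed.
Lemma is_derive_fBy (x y l : R) : is_derive y 1 (fun y => fB x y l) (fBy x y l).
Proof. by rewrite /fB /fBy; apply: is_derive_eq; rewrite /GRing.scale /=; ring. Qed.
Lemma is_derive_fBl (x y l : R) : I l -> is_derive l 1 (fun l => fB x y l) (fBl x y l).
Proof.
move=> Il; have dZl := dZ Il; rewrite /fB /fBl; apply: is_derive_eq.
by rewrite /GRing.scale /=; ring.
Qed.

Lemma cubic_partial0 (q : 'rV[R]_3) : partial 0 cubic_field q =
  row3 (fXx (q 0 0) (q 0 1) (q 0 2)) (fYx (q 0 0) (q 0 1) (q 0 2)) (E (q 0 2)).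
Proof.
apply: derive_val; rewrite {1}(row3_eta q).
have dB := is_derive_fBx (q 0 0) (q 0 1) (q 0 2).
apply: partial0_row3; rewrite /fX /fY /fL /fXx /fYx; apply: is_derive_eq;
by rewrite /GRing.scale /=; field.
Qed.

Lemma cubic_partial1 (q : 'rV[R]_3) : partial 1 cubic_field q =
  row3 (fXy (q 0 0) (q 0 1) (q 0 2)) (fYy (q 0 0) (q 0 1) (q 0 2)) 0.
Proof.
apply: derive_val; rewrite {1}(row3_eta q).
have dB := is_derive_fBy (q 0 0) (q 0 1) (q 0 2).
apply: partial1_row3; rewrite /fX /fY /fL /fXy /fYy; apply: is_derive_eq;
by rewrite /GRing.scale /=; field.
Qed.

Lemma cubic_partial2 (q : 'rV[R]_3) : I (q 0 2) -> partial 2 cubic_field q =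
  row3 (fXl (q 0 0) (q 0 1) (q 0 2)) (fYl (q 0 0) (q 0 1) (q 0 2)) (q 0 0 * E1 (q 0 2)).
Proof.
move=> Il; apply: derive_val; rewrite {1}(row3_eta q).
have dB := is_derive_fBl (q 0 0) (q 0 1) Il.
have dDl := dD Il; have dZl := dZ Il; have dEl := dE Il.
apply: partial2_row3; rewrite /fX /fY /fL /fXl /fYl; apply: is_derive_eq;
by rewrite /GRing.scale /=; field.
Qed.

Variables (xs ls D2 Z2 E2 : R).
Hypothesis Ils : I ls.
Hypothesis dD1 : is_derive ls 1 D1 D2.
Hypothesis dZ1 : is_derive ls 1 Z1 Z2.
Hypothesis dE1 : is_derive ls 1 E1 E2.
Hypothesis D0 : D ls = 0.
Hypothesis E0 : E ls = 0.
Hypothesis B0 : fB xs 0 ls = 0.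
Let p := row3 xs 0 ls.
Let s := xs + 6 * xi * Z ls.
Let bx := fBx xs 0 ls.

Lemma near_I (q : 'rV[R]_3) : I (q 0 2) -> \forall q' \near q, I ((q' : 'rV[R]_3) 0 2).
Proof.
move=> Iq; apply: (@coord_continuous R 1 3 0 2 q I).
by apply: open_nbhs_nbhs; split.
Qed.

(** Coefficients such as [m1], here and in the next two lemmas, multiply [dl] in the Taylor
    polynomial. They disappear on [u = 0], so only their existence is recorded. *)
Lemma cubic_second0 : exists m1 : R,
  [/\ partial 0 (partial 0 cubic_field) p = row3 (3 * bx + 3 * s * (a1 + a2)) 0 0,
      partial 1 (partial 0 cubic_field) p = row3 0 (3 / 2 * bx) 0 &
      partial 2 (partial 0 cubic_field) p = row3 m1 0 (E1 ls)].
Proof.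
have -> : partial 0 cubic_field = fun q => row3 (fXx (q 0 0) (q 0 1) (q 0 2))
    (fYx (q 0 0) (q 0 1) (q 0 2)) (E (q 0 2)).
  by apply/funext => q; exact: cubic_partial0.
have dDl := dD Ils; have dZl := dZ Ils; have dEl := dE Ils.
have [m1 Hm1] : exists m1, is_derive ls 1 (fun l => fXx xs 0 l) m1.
  have dB := is_derive_fBl xs 0 Ils.
  rewrite /fXx /fBx; eexists; typeclasses eauto.
have dB0 := is_derive_fBx xs 0 ls; have dB1 := is_derive_fBy xs 0 ls.
have H1 : is_derive xs 1 (fun x => fXx x 0 ls) (3 * bx + 3 * s * (a1 + a2)).
  rewrite /fXx /fBx; apply: is_derive_eq.
  by rewrite /GRing.scale /= /bx /s /fBx; field.
have H2 : is_derive xs 1 (fun x => fYx x 0 ls) 0.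
  by rewrite /fYx /fBx; apply: is_derive_eq; rewrite /GRing.scale /=; field.
have H3 : is_derive (0 : R) 1 (fun y => fXx xs y ls) 0.
  by rewrite /fXx /fBx; apply: is_derive_eq; rewrite /GRing.scale /= /fBy; field.
have H4 : is_derive (0 : R) 1 (fun y => fYx xs y ls) (3 / 2 * bx).
  by rewrite /fYx /fBx; apply: is_derive_eq; rewrite /GRing.scale /= D0 /bx /fBx; field.
have H5 : is_derive ls 1 (fun l => fYx xs 0 l) 0.
  by rewrite /fYx /fBx; apply: is_derive_eq; rewrite /GRing.scale /=; field.
have C0 (t v : R) := is_derive_cst (E ls) t v.
exists m1; split; apply: derive_val.
- exact: (@partial0_row3 _ fXx fYx (fun _ _ l => E l) _ _ _ _ _ _ H1 H2 (C0 _ _)).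
- exact: (@partial1_row3 _ fXx fYx (fun _ _ l => E l) _ _ _ _ _ _ H3 H4 (C0 _ _)).
- exact: (@partial2_row3 _ fXx fYx (fun _ _ l => E l) _ _ _ _ _ _ Hm1 H5 dEl).
Qed.

Lemma cubic_second1 : exists m2 : R,
  [/\ partial 0 (partial 1 cubic_field) p = row3 0 (3 / 2 * bx) 0,
      partial 1 (partial 1 cubic_field) p = row3 (3 * s * (- 2 * xi * ls * Z ls - a3)) 0 0 &
      partial 2 (partial 1 cubic_field) p = row3 0 m2 0].
Proof.
have -> : partial 1 cubic_field = fun q => row3 (fXy (q 0 0) (q 0 1) (q 0 2))
    (fYy (q 0 0) (q 0 1) (q 0 2)) 0.
  by apply/funext => q; exact: cubic_partial1.
have dDl := dD Ils; have dZl := dZ Ils.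
have [m2 Hm2] : exists m2, is_derive ls 1 (fun l => fYy xs 0 l) m2.
  have dB := is_derive_fBl xs 0 Ils.
  rewrite /fYy /fBy; eexists; typeclasses eauto.
have dB0 := is_derive_fBx xs 0 ls; have dB1 := is_derive_fBy xs 0 ls.
have H1 : is_derive xs 1 (fun x => fXy x 0 ls) 0.
  by rewrite /fXy /fBy; apply: is_derive_eq; rewrite /GRing.scale /=; field.
have H2 : is_derive xs 1 (fun x => fYy x 0 ls) (3 / 2 * bx).
  rewrite /fYy /fBy; apply: is_derive_eq.
  by rewrite /GRing.scale /= D0 /bx; field.
have H3 : is_derive (0 : R) 1 (fun y => fXy xs y ls) (3 * s * (- 2 * xi * ls * Z ls - a3)).
  rewrite /fXy /fBy; apply: is_derive_eq.
  by rewrite /GRing.scale /= D0 /s; field.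
have H4 : is_derive (0 : R) 1 (fun y => fYy xs y ls) 0.
  rewrite /fYy /fBy; apply: is_derive_eq.
  by rewrite /GRing.scale /= /fBy; field.
have H5 : is_derive ls 1 (fun l => fXy xs 0 l) 0.
  by rewrite /fXy /fBy; apply: is_derive_eq; rewrite /GRing.scale /=; field.
have C0 (t v : R) := is_derive_cst (0 : R) t v.
exists m2; split; apply: derive_val.
- exact: (@partial0_row3 _ fXy fYy (fun _ _ _ => 0) _ _ _ _ _ _ H1 H2 (C0 _ _)).
- exact: (@partial1_row3 _ fXy fYy (fun _ _ _ => 0) _ _ _ _ _ _ H3 H4 (C0 _ _)).
- exact: (@partial2_row3 _ fXy fYy (fun _ _ _ => 0) _ _ _ _ _ _ H5 Hm2 (C0 _ _)).
Qed.

Lemma cubic_second2 : exists n1 n2 n3 : R,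
  [/\ partial 0 (partial 2 cubic_field) p = row3 n1 0 (E1 ls),
      partial 1 (partial 2 cubic_field) p = row3 0 n2 0 &
      partial 2 (partial 2 cubic_field) p = row3 n3 0 (xs * E2)].
Proof.
pose G (q : 'rV[R]_3) := row3 (fXl (q 0 0) (q 0 1) (q 0 2))
  (fYl (q 0 0) (q 0 1) (q 0 2)) (q 0 0 * E1 (q 0 2)).
(* The formula for the [lambda] derivative holds only over [I]; as [I] is open, it holds near [p],
   which suffices for a further derivative. *)
have nearG : \forall q \near p, G q = partial 2 cubic_field q.
  have : I (p 0 2) by rewrite row3E.
  by move/near_I; apply: filterS => q Iq; rewrite cubic_partial2.
have PE j v : is_derive p (delta_mx 0 j) G v -> partial j (partial 2 cubic_field) p = v.
  by move=> dG; apply: derive_val; apply: near_eq_is_derive dG.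
have dDl := dD Ils; have dZl := dZ Ils.
have [n1 Hn1] : exists d, is_derive xs 1 (fun x => fXl x 0 ls) d.
  have dB := is_derive_fBx xs 0 ls.
  rewrite /fXl /fBl; eexists; typeclasses eauto.
have [n2 Hn2] : exists d, is_derive (0 : R) 1 (fun y => fYl xs y ls) d.
  rewrite /fYl /fBl; eexists; typeclasses eauto.
have [n3 Hn3] : exists d, is_derive ls 1 (fun l => fXl xs 0 l) d.
  have dB := is_derive_fBl xs 0 Ils.
  rewrite /fXl /fBl; eexists; typeclasses eauto.
have dB1 := is_derive_fBy xs 0 ls.
have H1 : is_derive xs 1 (fun x => fYl x 0 ls) 0.
  by rewrite /fYl /fBl; apply: is_derive_eq; rewrite /GRing.scale /=; field.
have H2 : is_derive xs 1 (fun x => x * E1 ls) (E1 ls).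
  by apply: is_derive_eq; rewrite /GRing.scale /=; ring.
have H3 : is_derive (0 : R) 1 (fun y => fXl xs y ls) 0.
  rewrite /fXl /fBl; apply: is_derive_eq.
  by rewrite /GRing.scale /= /fBy; field.
have H4 : is_derive ls 1 (fun l => fYl xs 0 l) 0.
  by rewrite /fYl /fBl; apply: is_derive_eq; rewrite /GRing.scale /=; field.
have H5 : is_derive ls 1 (fun l => xs * E1 l) (xs * E2).
  by apply: is_derive_eq; rewrite /GRing.scale /=; ring.
have C0 (t v : R) := is_derive_cst (xs * E1 ls) t v.
exists n1, n2, n3; split; apply: PE.
- exact: (@partial0_row3 _ fXl fYl (fun x _ l => x * E1 l) _ _ _ _ _ _ Hn1 H1 H2).
- exact: (@partial1_row3 _ fXl fYl (fun x _ l => x * E1 l) _ _ _ _ _ _ H3 Hn2 (C0 _ _)).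
- exact: (@partial2_row3 _ fXl fYl (fun x _ l => x * E1 l) _ _ _ _ _ _ Hn3 H4 H5).
Qed.

Lemma cubic_field0 : cubic_field p = 0.
Proof.
rewrite /cubic_field /p !row3E /fX /fY /fL D0 E0 B0 !mulr0 !addr0.
by apply/rowP; apply: ord3_cases; rewrite row3E mxE.
Qed.

Lemma cubic_first :
  [/\ partial 0 cubic_field p = row3 (3 / 2 * s * bx) 0 0,
      partial 1 cubic_field p = 0 &
      partial 2 cubic_field p = row3 (fXl xs 0 ls) 0 (xs * E1 ls)].
Proof.
have Ip : I (p 0 2) by rewrite row3E.
rewrite cubic_partial0 cubic_partial1 cubic_partial2// /p !row3E.
rewrite /fXx /fYx /fXy /fYy /fYl /fBy /fBl D0 E0 B0; split.
- by rewrite /s /bx; congr (row3 _ _ _); ring.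
- by apply/rowP; apply: ord3_cases; rewrite row3E mxE; ring.
- by congr (row3 _ _ _); ring.
Qed.

(** What matters is the divisibility of the second component by [dy] and of the third by [dl]: [y']
    has the factor [y], and [E] vanishes at [ls]. The two invariant submanifolds come from this. *)
Lemma cubic_taylor : exists m n q r : R, forall dx dy dl : R,
  taylor2 cubic_field p (row3 dx dy dl) = row3
    (3 / 2 * s * bx * dx + fXl xs 0 ls * dl
     + (3 / 2 * bx + 3 / 2 * s * (a1 + a2)) * dx ^+ 2
     + 3 / 2 * s * (- 2 * xi * ls * Z ls - a3) * dy ^+ 2 + dl * (m * dx + n * dl))
    (dy * (3 / 2 * bx * dx + q * dl))
    (dl * (xs * E1 ls + E1 ls * dx + r * dl)).
Proof.
have [m1 [P00 P10 P20]] := cubic_second0.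
have [m2 [P01 P11 P21]] := cubic_second1.
have [n1 [n2 [n3 [P02 P12 P22]]]] := cubic_second2.
have [P0 P1 P2] := cubic_first.
exists ((m1 + n1) / 2), (n3 / 2), ((m2 + n2) / 2), (xs * E2 / 2) => dx dy dl.
rewrite (taylor2_eval dx dy dl cubic_field0 P0 P1 P2 P00 P10 P20 P01 P11 P21 P02 P12 P22).
rewrite scaler0 !row3Z addr0 add0r !row3D row3Z row3D.
by congr (row3 _ _ _); field.
Qed.

Lemma cubic_differentiable : differentiable cubic_field p.
Proof.
have dc (i : 'I_3) : differentiable (fun q : 'rV[R]_3 => q 0 i) p by exact: differentiable_coord.
have dcomp (f : R -> R) d : is_derive ls 1 f d ->
    differentiable (fun q : 'rV[R]_3 => f (q 0 2)) p.
  move=> [df _]; apply: (@differentiable_comp _ _ _ _ (fun q : 'rV[R]_3 => q 0 2) f) => //.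
  by rewrite row3E; exact/derivable1_diffP.
have dDc := dcomp _ _ (dD Ils); have dZc := dcomp _ _ (dZ Ils); have dEc := dcomp _ _ (dE Ils).
have c (k : R) : differentiable (fun _ : 'rV[R]_3 => k) p by exact: differentiable_cst.
have dN (f : 'rV[R]_3 -> R) : differentiable f p -> differentiable (fun q : 'rV[R]_3 => - f q : R) p.
  exact: differentiableN.
have dA (f g : 'rV[R]_3 -> R) : differentiable f p -> differentiable g p ->
  differentiable (fun q : 'rV[R]_3 => f q + g q : R) p by exact: differentiableD.
have dM (f g : 'rV[R]_3 -> R) : differentiable f p -> differentiable g p ->
  differentiable (fun q : 'rV[R]_3 => f q * g q : R) p by exact: differentiableM.
have dX (f : 'rV[R]_3 -> R) : differentiable f p -> differentiable (fun q : 'rV[R]_3 => f q ^+ 2 : R) p.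
  by move=> df; exact: dM.
have dB : differentiable (fun q : 'rV[R]_3 => fB (q 0 0) (q 0 1) (q 0 2)) p.
  rewrite /fB; do ![exact: dc|exact: c|exact: dZc|apply dX|apply dM|apply dN|apply dA].
apply: (@differentiable_row3 _ _ (fun q : 'rV[R]_3 => fX (q 0 0) (q 0 1) (q 0 2))
  (fun q : 'rV[R]_3 => fY (q 0 0) (q 0 1) (q 0 2)) (fun q : 'rV[R]_3 => fL (q 0 0) (q 0 1) (q 0 2)));
  rewrite /fX /fY /fL.
- do ![exact: dc|exact: c|exact: dZc|exact: dDc|exact: dB|apply dX|apply dM|apply dN|apply dA].
- do ![exact: dc|exact: c|exact: dZc|exact: dDc|exact: dB|apply dX|apply dM|apply dN|apply dA].
- exact: dM.
Qed.

Lemma cubic_linearization i j :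
  linearization cubic_field p i j = partial j cubic_field p 0 i.
Proof. exact: (linearizationE _ _ cubic_differentiable). Qed.

End CubicField.

(** * The system in the variables (u, v, w) *)

Section QuadraticSystem.
Variable R : realType.
Variables a B b c al1 al2 be ga1 ga2 : R.

(** The coefficients [al1], [al2], [be], [ga1] and [ga2] stay arbitrary: each comes with a factor
    [u] and drops out on [u = 0], while on [v = 0] the surviving ones enter only at second order. *)
Definition quadratic_uvw (q : 'rV[R]_3) : 'rV[R]_3 :=
  let u := q 0 0 in let v := q 0 1 in let w := q 0 2 in
  row3 (u * (- a + al1 * u + al2 * w)) (v * (B * w + be * u))
    (a * w + b * v ^+ 2 + c * w ^+ 2 + u * (ga1 * u + ga2 * w)).

Lemma quadratic_uvw_invariant :
  invariant_set quadratic_uvw [set q | q 0 1 = 0] /\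
  invariant_set quadratic_uvw [set q | q 0 0 = 0].
Proof.
split=> J phi _ Ji J0 sol _ /= phi0 t Jt.
  apply: (@zero_linear R (fun t => phi t 0 1) (fun t => B * phi t 0 2 + be * phi t 0 0) J) => // x Jx.
    have := is_derive_component 1 (sol x Jx); rewrite row3E.
    by rewrite mulrC.
  have c0 := is_derive_continuous (is_derive_component 0 (sol x Jx)).
  have c2 := is_derive_continuous (is_derive_component 2 (sol x Jx)).
  by apply: cvgD; apply: cvgM => //; exact: cvg_cst.
apply: (@zero_linear R (fun t => phi t 0 0) (fun t => - a + al1 * phi t 0 0 + al2 * phi t 0 2) J) => // x Jx.
  have := is_derive_component 0 (sol x Jx); rewrite row3E.
  by rewrite mulrC.
have c0 := is_derive_continuous (is_derive_component 0 (sol x Jx)).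
have c2 := is_derive_continuous (is_derive_component 2 (sol x Jx)).
apply: cvgD; last by apply: cvgM => //; exact: cvg_cst.
by apply: cvgD; [exact: cvg_cst|apply: cvgM => //; exact: cvg_cst].
Qed.

Lemma field_u0_quadratic : field_u0 quadratic_uvw = planar a B b c.
Proof.
apply/funext => q; rewrite /field_u0 /quadratic_uvw !row3E /planar.
by congr row2; ring.
Qed.

Lemma partial0_row2 (f g : R -> R -> R) (q : 'rV[R]_2) (df dg : R) :
  is_derive (q 0 0) 1 (fun v => f v (q 0 1)) df ->
  is_derive (q 0 0) 1 (fun v => g v (q 0 1)) dg ->
  is_derive q (delta_mx 0 0) (fun q : 'rV[R]_2 => row2 (f (q 0 0) (q 0 1)) (g (q 0 0) (q 0 1)))
    (row2 df dg).
Proof.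
move=> fd gd; apply: is_derive_along.
have E (t : R) : t *: delta_mx 0 0 + q = row2 (t + q 0 0) (q 0 1) by case: (delta_row2 t q).
under eq_fun => t do rewrite E !row2E.
by apply: is_derive_row2; [exact: (is_derive_translate fd)|exact: (is_derive_translate gd)].
Qed.

Lemma partial1_row2 (f g : R -> R -> R) (q : 'rV[R]_2) (df dg : R) :
  is_derive (q 0 1) 1 (fun w => f (q 0 0) w) df ->
  is_derive (q 0 1) 1 (fun w => g (q 0 0) w) dg ->
  is_derive q (delta_mx 0 1) (fun q : 'rV[R]_2 => row2 (f (q 0 0) (q 0 1)) (g (q 0 0) (q 0 1)))
    (row2 df dg).
Proof.
move=> fd gd; apply: is_derive_along.
have E (t : R) : t *: delta_mx 0 1 + q = row2 (q 0 0) (t + q 0 1) by case: (delta_row2 t q).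
under eq_fun => t do rewrite E !row2E.
by apply: is_derive_row2; [exact: (is_derive_translate fd)|exact: (is_derive_translate gd)].
Qed.

Lemma planar_partial0 : partial 0 (planar a B b c) =
  fun q => row2 (B * q 0 1) (2 * b * q 0 0).
Proof.
apply/funext => q; apply: derive_val.
apply: (@partial0_row2 (fun v w => B * v * w) (fun v w => a * w + b * v ^+ 2 + c * w ^+ 2)).
  by apply: is_derive_eq; rewrite /GRing.scale /=; ring.
by apply: is_derive_eq; rewrite /GRing.scale /=; ring.
Qed.

Lemma planar_partial1 : partial 1 (planar a B b c) =
  fun q => row2 (B * q 0 0) (a + 2 * c * q 0 1).
Proof.
apply/funext => q; apply: derive_val.
apply: (@partial1_row2 (fun v w => B * v * w) (fun v w => a * w + b * v ^+ 2 + c * w ^+ 2)).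
  by apply: is_derive_eq; rewrite /GRing.scale /=; ring.
by apply: is_derive_eq; rewrite /GRing.scale /=; ring.
Qed.

Lemma planar_coefs : [/\ coefBv (planar a B b c) = B, coefBw (planar a B b c) = b &
  coefCw (planar a B b c) = c].
Proof.
rewrite /coefBv /coefBw /coefCw planar_partial0 planar_partial1.
have -> : partial 0 (fun q : 'rV[R]_2 => row2 (B * q 0 0) (a + 2 * c * q 0 1)) 0 = row2 B 0.
  apply: derive_val; apply: (@partial0_row2 (fun v w => B * v) (fun v w => a + 2 * c * w)).
    by apply: is_derive_eq; rewrite /GRing.scale /=; ring.
  by apply: is_derive_eq; rewrite /GRing.scale /=; ring.
have -> : partial 0 (fun q : 'rV[R]_2 => row2 (B * q 0 1) (2 * b * q 0 0)) 0 = row2 0 (2 * b).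
  apply: derive_val; apply: (@partial0_row2 (fun v w => B * w) (fun v w => 2 * b * v)).
    by apply: is_derive_eq; rewrite /GRing.scale /=; ring.
  by apply: is_derive_eq; rewrite /GRing.scale /=; ring.
have -> : partial 1 (fun q : 'rV[R]_2 => row2 (B * q 0 0) (a + 2 * c * q 0 1)) 0 = row2 0 (2 * c).
  apply: derive_val; apply: (@partial1_row2 (fun v w => B * v) (fun v w => a + 2 * c * w)).
    by apply: is_derive_eq; rewrite /GRing.scale /=; ring.
  by apply: is_derive_eq; rewrite /GRing.scale /=; ring.
by rewrite !row2E; split=> //; field.
Qed.

Let fu (u w : R) := u * (- a + al1 * u + al2 * w).
Let fw (u w : R) := a * w + c * w ^+ 2 + u * (ga1 * u + ga2 * w).

Lemma field_v0_quadratic : field_v0 quadratic_uvw =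
  fun q => row2 (fu (q 0 0) (q 0 1)) (fw (q 0 0) (q 0 1)).
Proof.
apply/funext => q; rewrite /field_v0 /quadratic_uvw !row3E.
by congr row2; rewrite /fw; ring.
Qed.

Lemma field_v0_littleo : field_v0 quadratic_uvw =
  linear_saddle_field a +o_ (0 : 'rV[R]_2) id.
Proof.
apply/eqaddoP => e e0; rewrite field_v0_quadratic.
pose K := `|al1| + `|al2| + (`|c| + `|ga1| + `|ga2|).
have K0 : 0 <= K by rewrite !addr_ge0.
have K1 : 0 < K + 1 by rewrite ltr_wpDl.
apply/nbhs_ballP; exists (e / (K + 1)); first by rewrite /= divr_gt0.
move=> q; rewrite -ball_normE /= sub0r normrN ltr_pdivlMr// => qK.
set u := q 0 0; set w := q 0 1.
have uq : `|u| <= `|q| by exact: norm_row_entry.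
have wq : `|w| <= `|q| by exact: norm_row_entry.
have qe : K * `|q| <= e by apply: le_trans (ltW qK); rewrite mulrC ler_wpM2l// lerDl.
have prod (k x y : R) : `|x| <= `|q| -> `|y| <= `|q| -> `|k * (x * y)| <= `|k| * (`|q| * `|q|).
  by move=> xq yq; rewrite !normrM ler_wpM2l// ler_pM.
have -> : ((fun q : 'rV[R]_2 => row2 (fu (q 0 0) (q 0 1)) (fw (q 0 0) (q 0 1))) - linear_saddle_field a) q
    = row2 (al1 * (u * u) + al2 * (u * w)) (c * (w * w) + ga1 * (u * u) + ga2 * (u * w)).
  rewrite !fctE /linear_saddle_field; apply/rowP; apply: ord2_cases.
    by rewrite !mxE /= /fu -/u -/w; ring.
  by rewrite !mxE /= /fw -/u -/w; ring.
have qq0 : 0 <= `|q| * `|q| by exact: mulr_ge0.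
apply: (@le_trans _ _ (K * (`|q| * `|q|))); last first.
  by rewrite mulrA ler_wpM2r.
apply: norm_row_le; first by exact: mulr_ge0.
apply: ord2_cases; rewrite row2E.
  apply: (@le_trans _ _ ((`|al1| + `|al2|) * (`|q| * `|q|))).
    rewrite [leRHS]mulrDl; apply: (le_trans (ler_normD _ _)).
    by apply: lerD; exact: prod.
  by rewrite ler_wpM2r// lerDl !addr_ge0.
apply: (@le_trans _ _ ((`|c| + `|ga1| + `|ga2|) * (`|q| * `|q|))).
  rewrite [leRHS]mulrDl (mulrDl `|c|); apply: (le_trans (ler_normD _ _)).
  apply: lerD; last exact: prod.
  by apply: (le_trans (ler_normD _ _)); apply: lerD; exact: prod.
by rewrite ler_wpM2r// lerDr addr_ge0.
Qed.

Lemma field_v0_saddle : a != 0 -> planar_saddle (field_v0 quadratic_uvw) 0.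
Proof.
move=> a0; rewrite field_v0_quadratic; split.
  rewrite /critical_point; apply/rowP; apply: ord2_cases; rewrite row2E !mxE.
    by rewrite /fu; ring.
  by rewrite /fw; ring.
set G : 'rV[R]_2 -> 'rV[R]_2 := fun q : 'rV[R]_2 => row2 _ _.
have dG : differentiable G 0.
  have dc (i : 'I_2) : differentiable (fun q : 'rV[R]_2 => q 0 i) 0 by exact: differentiable_coord.
  have dk (k : R) : differentiable (fun _ : 'rV[R]_2 => k) 0 by exact: differentiable_cst.
  have dA (f g : 'rV[R]_2 -> R) : differentiable f 0 -> differentiable g 0 ->
    differentiable (fun q : 'rV[R]_2 => f q + g q : R) 0 by exact: differentiableD.
  have dM (f g : 'rV[R]_2 -> R) : differentiable f 0 -> differentiable g 0 ->
    differentiable (fun q : 'rV[R]_2 => f q * g q : R) 0 by exact: differentiableM.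
  apply: (@differentiable_row2 _ _ (fun q : 'rV[R]_2 => fu (q 0 0) (q 0 1))
    (fun q : 'rV[R]_2 => fw (q 0 0) (q 0 1))); rewrite /fu /fw ?expr2.
    by do ![exact: dc|exact: dk|apply dM|apply dA].
  have -> : (fun q : 'rV[R]_2 => a * q 0 1 + c * q 0 1 ^+ 2 + q 0 0 * (ga1 * q 0 0 + ga2 * q 0 1))
      = (fun q => a * q 0 1 + c * (q 0 1 * q 0 1) + q 0 0 * (ga1 * q 0 0 + ga2 * q 0 1)) by [].
  by do ![exact: dc|exact: dk|apply dM|apply dA].
have P0 : partial 0 G 0 = row2 (- a) 0.
  apply: derive_val; apply: (@partial0_row2 fu fw); rewrite /fu /fw !mxE.
    by apply: is_derive_eq; rewrite /GRing.scale /=; ring.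
  by apply: is_derive_eq; rewrite /GRing.scale /=; ring.
have P1 : partial 1 G 0 = row2 0 a.
  apply: derive_val; apply: (@partial1_row2 fu fw); rewrite /fu /fw !mxE.
    by apply: is_derive_eq; rewrite /GRing.scale /=; ring.
  by apply: is_derive_eq; rewrite /GRing.scale /=; ring.
have LE i j : linearization G 0 i j = partial j G 0 0 i by exact: linearizationE.
have ev1 : eigenvalue (linearization G 0) (- a).
  apply/eigenvalueP; exists (delta_mx 0 0); last first.
    by apply/eqP => /rowP /(_ 0); rewrite !mxE /= => /eqP; rewrite oner_eq0.
  rewrite -rowE; apply/rowP; apply: ord2_cases; rewrite [LHS]mxE LE ?P0 ?P1 row2E !mxE /=.
    by rewrite mulr1.
  by rewrite mulr0.
have ev2 : eigenvalue (linearization G 0) a.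
  apply/eigenvalueP; exists (delta_mx 0 1); last first.
    by apply/eqP => /rowP /(_ 1); rewrite !mxE /= => /eqP; rewrite oner_eq0.
  rewrite -rowE; apply/rowP; apply: ord2_cases; rewrite [LHS]mxE LE ?P0 ?P1 row2E !mxE /=.
    by rewrite mulr0.
  by rewrite mulr1.
have [alt|age] := ltP a 0; first by exists a, (- a); rewrite oppr_gt0.
have {}age : 0 < a by rewrite lt_neqAle eq_sym a0.
by exists (- a), a; rewrite oppr_lt0.
Qed.

End QuadraticSystem.

(** * Solutions of the linear saddle *)

Section LinearSaddle.
Variables (R : realType) (a : R).

Lemma exponential_solution (f : R -> R) (k : R) :
  (forall t : R, is_derive t 1 f (k * f t)) -> f = (fun t => f 0 * expR (k * t)).
Proof.
move=> df; apply/funext => t.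
have : f t * expR (- k * t) = f 0 * expR (- k * 0).
  apply: (@is_derive_0_is_cst R (fun t => f t * expR (- k * t))) => s.
  by have dfs := df s; apply: is_derive_eq; rewrite /GRing.scale /=; ring.
rewrite mulr0 expR0 mulr1 => <-.
by rewrite -mulrA -expRD mulNr addNr expR0 mulr1.
Qed.

Lemma linear_saddle_solution (u0 w0 : R) (phi : R -> 'rV[R]_2) :
  is_solution (linear_saddle_field a) setT phi /\ phi 0 = row2 u0 w0 <->
  phi = (fun t => row2 (u0 * expR (- a * t)) (w0 * expR (a * t))).
Proof.
split=> [[sol phi0]|->].
  apply/funext => t; rewrite [LHS]row2_eta.
  have d0 (s : R) : is_derive s 1 (fun t => phi t 0 0) (- a * phi s 0 0).
    by have := is_derive_component 0 (sol s I); rewrite row2E.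
  have d1 (s : R) : is_derive s 1 (fun t => phi t 0 1) (a * phi s 0 1).
    by have := is_derive_component 1 (sol s I); rewrite row2E.
  have := congr1 (fun f => f t) (exponential_solution d0).
  have := congr1 (fun f => f t) (exponential_solution d1).
  by rewrite /= phi0 !row2E => -> ->.
split; last by rewrite !mulr0 expR0 !mulr1.
move=> t _; rewrite /linear_saddle_field !row2E; apply: is_derive_row2;
by apply: is_derive_eq; rewrite /GRing.scale /=; ring.
Qed.

End LinearSaddle.

(** * The critical point *)

Section QuadraticG.
Variable R : realType.
Variables (eps xi wm z0 : R).
Hypothesis heps : eps = 1 \/ eps = -1.
Hypothesis hpos : 0 < eps * xi * (1 - 6 * xi).
Hypothesis hlead : 1 - 4 * xi - wm != 0.
Hypothesis hz : z0 ^+ 2 = 1 / (6 * eps * xi * (1 - 6 * xi)).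

Lemma eps_sq : eps * eps = 1.
Proof. by case: heps => ->; ring. Qed.

Lemma eps_neq0 : eps != 0.
Proof. by case: heps => ->; rewrite ?oppr_eq0 oner_eq0. Qed.

Lemma xi_neq0 : xi != 0.
Proof. by apply: contraTneq hpos => ->; rewrite mulr0 mul0r ltxx. Qed.

Lemma onem6xi_neq0 : 1 - 6 * xi != 0.
Proof. by apply: contraTneq hpos => ->; rewrite mulr0 ltxx. Qed.

Lemma z0_neq0 : z0 != 0.
Proof.
apply/eqP => z00; move: hz; rewrite z00 expr0n /= => /esym/eqP.
by rewrite mul1r invr_eq0 -!mulrA mulf_eq0 pnatr_eq0 /= mulrA gt_eqF.
Qed.

Lemma sqr_z0E : 6 * eps * xi * (1 - 6 * xi) * z0 ^+ 2 = 1.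
Proof.
by rewrite hz; field; rewrite eps_neq0 xi_neq0 onem6xi_neq0.
Qed.

Definition gA := eps * (1 - 4 * xi - wm).
Definition gb := 4 * eps * xi * (1 - 3 * wm) * z0.
Definition gc := 2 * xi / (1 - 6 * xi) * (1 - 3 * wm).

Lemma gA_neq0 : gA != 0.
Proof. by rewrite mulf_neq0// eps_neq0. Qed.

(** Once [z0 ^+ 2] is inserted, the bracket [(1 - 3 wm) / 3 - (1 - 4 xi - wm)] appears; it equals
    [- (2 / 3) * (1 - 6 xi)] and cancels the denominator. *)
Lemma discriminant : gb ^+ 2 - 4 * gA * gc = - (16 / 3) * eps * xi * (1 - 3 * wm).
Proof.
have e0 := eps_neq0; have x0 := xi_neq0; have s0 := onem6xi_neq0.
have -> : gb ^+ 2 = 16 * (eps * eps) * xi ^+ 2 * (1 - 3 * wm) ^+ 2 * z0 ^+ 2.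
  by rewrite /gb; ring.
rewrite hz eps_sq.
have -> : 1 / (6 * eps * xi * (1 - 6 * xi)) = eps / (6 * xi * (1 - 6 * xi)).
  rewrite -[X in X / _]eps_sq; field; by rewrite e0 x0 s0.
by rewrite /gA /gc; field; rewrite x0 s0.
Qed.

Lemma gpoly_horner (x : R) : (gpoly eps xi wm z0).[x] = gA * x ^+ 2 + gb * x + gc.
Proof. by rewrite /gpoly !hornerE. Qed.

Lemma completed_square (x : R) : gA * x ^+ 2 + gb * x + gc = 0 ->
  (2 * gA * x + gb) ^+ 2 = - (16 / 3) * eps * xi * (1 - 3 * wm).
Proof.
move=> gx; rewrite -discriminant.
have -> : (2 * gA * x + gb) ^+ 2 = 4 * gA * (gA * x ^+ 2 + gb * x + gc) + (gb ^+ 2 - 4 * gA * gc) by ring.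
by rewrite gx mulr0 add0r.
Qed.

Local Notation toC := (real_complex R).

(** Working over [R[i]] makes the quadratic formula valid for either sign of the discriminant;
    reality of the roots is a separate question. *)
Lemma gpoly_root_complex (x : R[i]) : root (map_poly toC (gpoly eps xi wm z0)) x <->
  let pre := toC (2 * eps * (1 - 4 * xi - wm))^-1 in
  let lin := toC (- 4 * eps * xi * (1 - 3 * wm) * z0) in
  let sq := sqrtC (toC (- (16 / 3) * eps * xi * (1 - 3 * wm))) in
  x = pre * (lin + sq) \/ x = pre * (lin - sq).
Proof.
set A := toC gA; set b := toC gb; set c := toC gc.
have gE : root (map_poly toC (gpoly eps xi wm z0)) x = (A * x ^+ 2 + b * x + c == 0).
  rewrite /gpoly !rmorphD /= !map_polyZ /= map_polyXn map_polyX map_polyC /= rootE.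
  by rewrite !hornerE.
move=> /=; set sq := sqrtC _.
have sqE : sq ^+ 2 = b ^+ 2 - 4 * A * c.
  have E4 : toC (4 * gA * gc) = 4 * A * c.
    by rewrite /A /c -(rmorph_nat toC 4) -!rmorphM.
  by rewrite sqrtCK -discriminant rmorphB /= E4 rmorphXn.
have A0 : A != 0 by rewrite fmorph_eq0 gA_neq0.
have preE : toC (2 * eps * (1 - 4 * xi - wm))^-1 = (2 * A)^-1.
  by rewrite fmorphV -mulrA -/gA /A -(rmorph_nat toC 2) -rmorphM.
have linE : toC (- 4 * eps * xi * (1 - 3 * wm) * z0) = - b.
  by rewrite /b -rmorphN; congr toC; rewrite /gb; ring.
rewrite gE preE linE.
have A2 : 2 * A != 0 by rewrite mulf_neq0// pnatr_eq0.
have fact : 4 * A * (A * x ^+ 2 + b * x + c) = (2 * A * x - (- b + sq)) * (2 * A * x - (- b - sq)).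
  have -> : (2 * A * x - (- b + sq)) * (2 * A * x - (- b - sq)) = (2 * A * x + b) ^+ 2 - sq ^+ 2 by ring.
  by rewrite sqE; ring.
have solve y : (2 * A * x - y == 0) = (x == (2 * A)^-1 * y).
  by rewrite subr_eq0 [RHS]eq_sym (can2_eq (mulKf A2) (mulVKf A2)) eq_sym.
have -> : (A * x ^+ 2 + b * x + c == 0) =
    (x == (2 * A)^-1 * (- b + sq)) || (x == (2 * A)^-1 * (- b - sq)).
  rewrite -!solve -mulf_eq0 -fact mulf_eq0 mulf_eq0 (negbTE A0) orbF.
  by rewrite pnatr_eq0.
by split=> [/orP[/eqP|/eqP]|[->|->]]; [left|right|rewrite eqxx|rewrite eqxx orbT].
Qed.

Lemma gpoly_real_root (x : R[i]) : wm < 1 / 3 ->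
  root (map_poly toC (gpoly eps xi wm z0)) x -> x \is Num.real -> eps * xi < 0.
Proof.
move=> wm3 + /complex_realP[k xk]; rewrite xk fmorph_root rootE gpoly_horner => /eqP gk.
have := completed_square gk => sq.
have := sqr_ge0 (2 * gA * k + gb); rewrite sq => d0.
have w0 : 0 < 1 - 3 * wm by lra.
rewrite lt_neqAle mulf_neq0 ?eps_neq0 ?xi_neq0//= leNgt; apply/negP => ex.
have : 0 < (eps * xi) * (1 - 3 * wm) by exact: mulr_gt0.
by move: d0; lra.
Qed.

End QuadraticG.

(** * The cosmological field at the critical point *)

Section CosmologicalField.
Variable R : realType.
Variables (eps xi wm : R) (I : set R) (z : R -> R) (ls : R).
Hypothesis heps : eps = 1 \/ eps = -1.
Hypothesis Iopen : open I.
Hypothesis Iint : is_interval I.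
Hypothesis zsmooth : smooth_on I z.
Hypothesis dz_neq0 : forall t, I t -> derive1 z t != 0.
Hypothesis hpos : 0 < eps * xi * (1 - 6 * xi).
Hypothesis hlead : 1 - 4 * xi - wm != 0.
Hypothesis Ils : I ls.
Hypothesis hls : z ls ^+ 2 = 1 / (6 * eps * xi * (1 - 6 * xi)).

Definition ka1 := eps * (1 - 6 * xi) * (1 - wm).
Definition ka2 := 2 * eps * xi * (1 - 3 * wm).
Definition kD (l : R) := 1 - 6 * eps * xi * (1 - 6 * xi) * z l ^+ 2.
Definition kE (l : R) := kD l * (derive1 z l)^-1.
Definition kD1 (l : R) := - 12 * eps * xi * (1 - 6 * xi) * z l * derive1 z l.
Definition kE1 (l : R) := kD1 l * (derive1 z l)^-1
  - kD l * ((derive1 z l)^-1 * (derive1 z l)^-1) * derive1n 2 z l.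

Lemma field_cubic : field eps xi wm z =
  cubic_field (eps / 2) xi ka1 ka2 (1 + wm) kD z kE.
Proof.
by apply/funext => q; rewrite /field /cubic_field; congr row3; rewrite /fL /kE mulrA.
Qed.

Lemma is_derive_z (l : R) : I l -> is_derive l 1 z (derive1 z l).
Proof. by move=> Il; apply: is_derive_of_derivable; exact: (@zsmooth 0%N _ Il). Qed.

Lemma is_derive_z1 (l : R) : I l -> is_derive l 1 (derive1 z) (derive1n 2 z l).
Proof. by move=> Il; apply: is_derive_of_derivable; exact: (@zsmooth 1%N _ Il). Qed.

Lemma is_derive_z2 (l : R) : I l -> is_derive l 1 (derive1n 2 z) (derive1n 3 z l).
Proof. by move=> Il; apply: is_derive_of_derivable; exact: (@zsmooth 2%N _ Il). Qed.

Lemma is_derive_kD (l : R) : I l -> is_derive l 1 kD (kD1 l).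
Proof.
move=> /is_derive_z dz; rewrite /kD /kD1; apply: is_derive_eq.
by rewrite /GRing.scale /=; ring.
Qed.

Lemma is_derive_z1V (l : R) : I l ->
  is_derive l 1 (fun l => (derive1 z l)^-1) (- (derive1 z l) ^- 2 *: derive1n 2 z l).
Proof.
move=> Il; apply: is_deriveV; first exact: dz_neq0.
exact: is_derive_z1.
Qed.

Lemma is_derive_kE (l : R) : I l -> is_derive l 1 kE (kE1 l).
Proof.
move=> Il; have dD := is_derive_kD Il; have dV := is_derive_z1V Il.
have z0 := dz_neq0 Il; rewrite /kE; apply: is_derive_eq.
by rewrite /kE1 /GRing.scale /=; field.
Qed.

Lemma is_derive_kD1 (l : R) : I l -> exists d, is_derive l 1 kD1 d.
Proof.
move=> Il; have dz := is_derive_z Il; have dz1 := is_derive_z1 Il.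
rewrite /kD1; eexists; typeclasses eauto.
Qed.

Lemma is_derive_kE1 (l : R) : I l -> exists d, is_derive l 1 kE1 d.
Proof.
move=> Il; have [d dD1] := is_derive_kD1 Il; have dD := is_derive_kD Il.
have dV := is_derive_z1V Il; have dz2 := is_derive_z2 Il.
rewrite /kE1; eexists; typeclasses eauto.
Qed.

Lemma kD_ls : kD ls = 0.
Proof. by rewrite /kD (sqr_z0E heps hpos hls) subrr. Qed.

Lemma kE_ls : kE ls = 0.
Proof. by rewrite /kE kD_ls mul0r. Qed.

(** As [kD] vanishes at [ls], only [D' / z'] survives, and there [z'] cancels. *)
Lemma kE1_ls : kE1 ls = - 12 * eps * xi * (1 - 6 * xi) * z ls.
Proof.
have z1 := dz_neq0 Ils.
by rewrite /kE1 kD_ls /kD1; field.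
Qed.

Let z0n : z ls != 0. Proof. exact: (z0_neq0 hpos hls). Qed.
Let xin : xi != 0. Proof. exact: (xi_neq0 hpos). Qed.
Let s6n : 1 - 6 * xi != 0. Proof. exact: (onem6xi_neq0 hpos). Qed.
Let epsn : eps != 0. Proof. exact: (eps_neq0 heps). Qed.

(** On [y = 0] the function [B] is a quadratic in [x] which at [l = ls] becomes [g]: roots of [g]
    are the points of the axis where [B] vanishes together with [D]. *)
Lemma fB_axis (x l : R) : fB xi ka1 ka2 (1 + wm) z x 0 l =
  gA eps xi wm * x ^+ 2 + gb eps xi wm (z l) * x + (ka2 * z l ^+ 2 - (1 - 3 * wm) / 3).
Proof. by rewrite /fB /gA /gb /ka1 /ka2; field. Qed.

Lemma gc_ls : ka2 * z ls ^+ 2 - (1 - 3 * wm) / 3 = gc xi wm.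
Proof. by rewrite hls /ka2 /gc; field; rewrite ?epsn ?xin ?s6n. Qed.

(** The numerator of [weff] equals [D / 3 + B]. This gives a meaning to the value 1/3 at the
    critical point, where [D] and [B] both vanish. *)
Lemma weff_decomposition (q : 'rV[R]_3) : Dfun eps xi z q != 0 ->
  weff eps xi wm z q = 1 / 3 + Bfun eps xi wm z q / Dfun eps xi z q.
Proof.
move=> D0; apply: (mulfI D0); rewrite /weff mulVKf//.
have -> : Dfun eps xi z q * (1 / 3 + Bfun eps xi wm z q / Dfun eps xi z q) =
  Dfun eps xi z q / 3 + Bfun eps xi wm z q by field.
by rewrite /Bfun /Dfun; field.
Qed.

Lemma z_injective_near_ls (l : R) : I l -> ls < l -> z l != z ls.
Proof.
move=> Il lsl.
have [|c cin zE] := @MVT_closed _ z (derive1 z) ls l (ltW lsl).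
  by move=> x xin'; apply: is_derive_z; exact: Iint Ils Il x xin'.
rewrite -subr_eq0 zE; apply: mulf_neq0; last by rewrite subr_eq0 gt_eqF.
exact: (dz_neq0 (Iint Ils Il cin)).
Qed.

Variable xs : R.
Hypothesis gxs : (gpoly eps xi wm (z ls)).[xs] = 0.
Let p := row3 xs 0 ls.
Let F := field eps xi wm z.
Let a := 12 * eps * xi * (1 - 6 * xi) * z ls * xs.
Let A := gA eps xi wm.
Let bz := gb eps xi wm (z ls).
Let bx := 2 * A * xs + bz.

Lemma g_xs : A * xs ^+ 2 + bz * xs + gc xi wm = 0.
Proof. by rewrite -gpoly_horner. Qed.

Lemma fB_p : fB xi ka1 ka2 (1 + wm) z xs 0 ls = 0.
Proof. by rewrite fB_axis gc_ls; exact: g_xs. Qed.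

Lemma fBx_p : fBx ka1 ka2 z xs 0 ls = bx.
Proof. by rewrite /fBx /bx /A /bz /gA /gb /ka1 /ka2; ring. Qed.

(** Division of [(x + 6 xi z) * g'(x)] by [g(x)]: at a root only the remainder is left. Its constant
    term vanishes by the value of [z ls ^+ 2], and its linear term is
    [8 * eps * xi * (1 - 6 * xi) * z ls * xs]. *)
Lemma eigenvalue_a : 3 / 2 * (xs + 6 * xi * z ls) * bx = a.
Proof.
have -> : 3 / 2 * (xs + 6 * xi * z ls) * bx = 3 / 2 *
   (2 * (A * xs ^+ 2 + bz * xs + gc xi wm) + (12 * xi * z ls * A - bz) * xs
    + (6 * xi * (z ls * bz) - 2 * gc xi wm)) by rewrite /bx; ring.
have -> : z ls * bz = 2 / 3 * (1 - 3 * wm) / (1 - 6 * xi).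
  have -> : z ls * bz = 4 * eps * xi * (1 - 3 * wm) * z ls ^+ 2 by rewrite /bz /gb; ring.
  by rewrite hls; field; rewrite ?epsn ?xin ?s6n.
by rewrite g_xs /a /A /bz /gA /gb /gc; field.
Qed.

Lemma Dfun_p : Dfun eps xi z p = 0.
Proof. by rewrite /Dfun row3E; exact: kD_ls. Qed.

Lemma Bfun_p : Bfun eps xi wm z p = 0.
Proof. by rewrite /Bfun !row3E; exact: fB_p. Qed.

Lemma field_critical : critical_point F p.
Proof. by rewrite /critical_point /F field_cubic; apply: cubic_field0; [exact: kD_ls|exact: kE_ls|exact: fB_p]. Qed.

(** Membership in the closure keeps the limit from being vacuous. Points of [S] near [p] lie on the
    curve [x = X l], [y = 0], where [X l] is the root of [B] that continues [xs]. *)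
Lemma closure_radiation :
  let S := [set q : 'rV[R]_3 | [/\ I (q 0 2), Dfun eps xi z q != 0 & Bfun eps xi wm z q = 0]] in
  closure S p /\ weff eps xi wm z q @[q --> within S (nbhs p)] --> (1 / 3 : R).
Proof.
move=> S; split; last first.
  have : \forall q \near within S (nbhs p), (1 / 3 : R) = weff eps xi wm z q.
    rewrite near_withinE; apply: nearW => q [_ D0 B0].
    by rewrite weff_decomposition// B0 mul0r addr0.
  by move=> /near_eq_cvg H; apply: cvg_trans H _; exact: cvg_cst.
pose b l := gb eps xi wm (z l); pose cc l := ka2 * z l ^+ 2 - (1 - 3 * wm) / 3.
pose disc l := b l ^+ 2 - 4 * A * cc l.
have A0 : A != 0 by exact: gA_neq0.
have cz : {for ls, continuous z} by exact: is_derive_continuous (is_derive_z Ils).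
have dz := is_derive_z Ils.
have [db Hb] : exists d, is_derive ls 1 b d by rewrite /b /gb; eexists; typeclasses eauto.
have [dc Hc] : exists d, is_derive ls 1 disc d.
  by rewrite /disc /cc; eexists; typeclasses eauto.
have cb := is_derive_continuous Hb; have cdisc := is_derive_continuous Hc.
have disc_ls : disc ls = bx ^+ 2.
  rewrite /disc /cc gc_ls /b -/bz /bx -[RHS]addr0 -[X in _ = _ + X](mulr0 (4 * A)) -[X in _ = _ + 4 * A * X]oppr0 -g_xs.
  by ring.
have disc_ls' : disc ls = - (16 / 3) * eps * xi * (1 - 3 * wm).
  by rewrite /disc /cc gc_ls; exact: discriminant.
(* Real roots persist near [ls]: either [1 - 3 * wm = 0] and the discriminant vanishes identically,
   or it is nonzero at [ls], where it equals a square, and so stays positive nearby. *)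
have near_disc : \forall l \near ls, 0 <= disc l.
  have [w3|w3] := eqVneq (1 - 3 * wm) 0.
    have H l : 0 <= disc l.
      by rewrite /disc /b /cc /gb /ka2 w3 !(mulr0, mul0r) subrr mulr0 subr0 sqr_ge0.
    by near=> l; exact: H.
  have d0 : 0 < disc ls.
    rewrite lt_neqAle {2}disc_ls sqr_ge0 andbT eq_sym disc_ls'.
    by rewrite !mulf_neq0// oppr_eq0 mulf_neq0// ?invr_neq0// pnatr_eq0.
  have : \forall l \near ls, 0 < disc l.
    by apply: (cdisc [set r | 0 < r]); exact: lt_nbhsr.
  by apply: filterS => l /ltW.
have [sg sg1 sgE] : exists2 sg : R, sg ^+ 2 = 1 & bx = sg * Num.sqrt (disc ls).
  rewrite disc_ls sqrtr_sqr; have [bx0|bx0] := leP 0 bx.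
    by exists 1; [rewrite expr1n|rewrite mul1r ger0_norm].
  by exists (-1); [rewrite sqrrN expr1n|rewrite mulN1r ltr0_norm// opprK].
(* The sign [sg] selects the branch of the square root that passes through [xs]. *)
pose X l := (2 * A)^-1 * (sg * Num.sqrt (disc l) - b l).
have A2 : 2 * A != 0 by rewrite mulf_neq0// pnatr_eq0.
have Xls : X ls = xs.
  by rewrite /X -sgE /bx /b -/bz; field.
have XB l : 0 <= disc l -> fB xi ka1 ka2 (1 + wm) z (X l) 0 l = 0.
  move=> dl; rewrite fB_axis -/A -/(b l) -/(cc l).
  have -> : A * X l ^+ 2 + b l * X l + cc l =
      (4 * A)^-1 * (sg ^+ 2 * Num.sqrt (disc l) ^+ 2 - disc l).
    by rewrite /X; set sq := Num.sqrt (disc l); rewrite /disc; field.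
  by rewrite sg1 sqr_sqrtr// mul1r subrr mulr0.
have cX : {for ls, continuous X}.
  have csq : {for ls, continuous (fun l => Num.sqrt (disc l))}.
    exact: (continuous_comp cdisc (@sqrt_continuous R _)).
  apply: cvgM; first exact: cvg_cst.
  by apply: cvgB => //; apply: cvgM => //; exact: cvg_cst.
pose P l := row3 (X l) 0 l.
have PE : P = fun l => X l *: row3 1 0 0 + l *: row3 0 0 1.
  by apply/funext => l; rewrite !row3Z row3D !(mulr1, mulr0, addr0, add0r).
have cP : {for ls, continuous P}.
  rewrite PE; apply: cvgD; first by apply: cvgZr_tmp; exact: cX.
  by apply: cvgZr_tmp; exact: cvg_id.
move=> U Up.
have nU : \forall l \near ls, U (P l).
  by apply: cP; rewrite /P Xls.
have nI : \forall l \near ls, I l by exact: open_nbhs_nbhs.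
(* [D = 0] would force [z l = z ls] or [z l = - z ls]. Injectivity of [z] to the right of [ls]
   excludes the first, this common sign the second. *)
have nz : \forall l \near ls, 0 < z l * z ls.
  have czz : {for ls, continuous (fun l => z l * z ls)}.
    by apply: cvgM => //; exact: cvg_cst.
  apply: (czz [set r | 0 < r]); apply: lt_nbhsr.
  by rewrite -expr2 exprn_even_gt0.
have /nbhs_ballP[d /= d0 Hd] : \forall l \near ls, [/\ U (P l), I l, 0 <= disc l & 0 < z l * z ls].
  by near=> l; split; near: l.
have [|Ul Il dl zl] := Hd (ls + d / 2).
  by rewrite /ball /= opprD addNKr normrN gtr0_norm ?divr_gt0//; lra.
exists (P (ls + d / 2)); split=> //; split.
- by rewrite row3E.
- rewrite /Dfun row3E; apply/negP => /eqP D0.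
  have zz : z (ls + d / 2) ^+ 2 = z ls ^+ 2.
    have k0 : 6 * eps * xi * (1 - 6 * xi) != 0 by rewrite !mulf_neq0// pnatr_eq0.
    apply: (mulfI k0); rewrite (sqr_z0E heps hpos hls).
    by move/eqP: D0; rewrite subr_eq0 => /eqP.
  have : (z (ls + d / 2) - z ls) * (z (ls + d / 2) + z ls) == 0.
    by rewrite -subr_sqr zz subrr.
  rewrite mulf_eq0 subr_eq0 (negbTE (z_injective_near_ls Il _)) /=; last by lra.
  rewrite addr_eq0 => /eqP zN; move: zl; rewrite zN mulNr -expr2.
  by rewrite ltNge oppr_le0 sqr_ge0.
- by rewrite /Bfun !row3E; exact: XB.
Unshelve. all: by end_near. Qed.

Let Xl := fXl (eps / 2) xi ka1 ka2 (1 + wm) kD kD1 z (derive1 z) xs 0 ls.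

Lemma xs_kE1 : xs * kE1 ls = - a.
Proof. by rewrite kE1_ls /a; ring. Qed.

Lemma field_partials : [/\ partial 0 F p = row3 a 0 0, partial 1 F p = 0 &
  partial 2 F p = row3 Xl 0 (- a)].
Proof.
have [P0 P1 P2] := cubic_first (eps / 2) is_derive_kD is_derive_z is_derive_kE Ils kD_ls kE_ls fB_p.
rewrite /F field_cubic /p P0 P1 P2 fBx_p xs_kE1; split=> //.
by congr row3; exact: eigenvalue_a.
Qed.

Lemma field_linearization i j : linearization F p i j = partial j F p 0 i.
Proof.
rewrite /F field_cubic.
exact: (cubic_linearization (eps / 2) xi ka1 ka2 (1 + wm) is_derive_kD is_derive_z is_derive_kE xs Ils).
Qed.

(** The linearization is upper triangular; its transpose has the lower triangular shape required by
    [char_poly_trig]. *)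
Lemma field_eigenvalues : eigenvalues_are (linearization F p) [:: - a; 0; a].
Proof.
have [P0 P1 P2] := field_partials.
rewrite /eigenvalues_are -char_poly_tr char_poly_trig.
  have d (i : 'I_3) : (linearization F p)^T i i = partial i F p 0 i.
    by rewrite mxE field_linearization.
  rewrite !big_ord_recl big_ord0 !big_cons big_nil !d.
  have -> : lift ord0 (ord0 : 'I_2) = 1 :> 'I_3 by apply: val_inj.
  have -> : lift ord0 (lift ord0 (ord0 : 'I_1)) = 2 :> 'I_3 by apply: val_inj.
  have -> : ord0 = 0 :> 'I_3 by apply: val_inj.
  rewrite P0 P1 P2 !row3E mxE !mulr1.
  by ring.
apply/is_trig_mxP => i j; rewrite mxE field_linearization.
move: i j; apply: ord3_cases; apply: ord3_cases => // _; rewrite ?P0 ?P1 ?P2 ?row3E ?mxE//.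
Qed.

Lemma field_non_hyperbolic : non_hyperbolic F p.
Proof.
have [P0 P1 P2] := field_partials.
split; first exact: field_critical.
(* Eigenvectors are row vectors here, so this one only needs the row of [y'] to vanish. *)
exists 0 => //; apply/eigenvalueP; exists (delta_mx 0 1); last first.
  by apply/eqP => /rowP /(_ 1); rewrite !mxE /= => /eqP; rewrite oner_eq0.
rewrite -rowE scale0r; apply/rowP => j; rewrite [LHS]mxE [LHS]mxE [RHS]mxE field_linearization.
by move: j; apply: ord3_cases; rewrite ?P0 ?P1 ?P2 ?row3E ?mxE.
Qed.

Let cB := 3 / 2 * bx.
Let cb := 3 / 2 * (xs + 6 * xi * z ls) * (- 2 * xi * ls * z ls - (1 + wm)).
Let cC := 3 / 2 * bx + 3 / 2 * (xs + 6 * xi * z ls) * (ka1 + ka2).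

Lemma field_uvw_quadratic : a != 0 -> exists al1 al2 be ga1 ga2 : R,
  field_uvw F p = quadratic_uvw a cB cb cC al1 al2 be ga1 ga2.
Proof.
move=> a0; have [P0 P1 P2] := field_partials.
have [D2 dD2] := is_derive_kD1 Ils; have [E2 dE2] := is_derive_kE1 Ils.
have [m [n [q [r T]]]] := cubic_taylor (eps / 2) Iopen is_derive_kD is_derive_z is_derive_kE
  Ils dD2 (is_derive_z1 Ils) dE2 kD_ls kE_ls fB_p.
rewrite -field_cubic -/F -/p -/Xl fBx_p xs_kE1 eigenvalue_a in T.
set ch := chi F p.
(* The denominator of [chi] is [a - (- a)]. Hence the linear part of [w'] is
   [a dx + 2 a ch dl - a ch dl = a w]; the coefficients below come from inserting
   [dx = w - ch u]. *)
have XE : Xl = 2 * a * ch.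
  rewrite /ch /chi !field_linearization P0 P2 !row3E; field.
  by rewrite opprK -mulr2n mulrn_eq0.
exists (r - kE1 ls * ch), (kE1 ls), (q - cB * ch),
  (cC * ch ^+ 2 - m * ch + n + ch * (r - kE1 ls * ch)), (- 2 * cC * ch + m + ch * kE1 ls).
apply/funext => t; rewrite /field_uvw -/ch /of_uvw T /to_uvw !row3E /quadratic_uvw XE.
by congr row3; rewrite /cB /cb /cC; ring.
Qed.

(** [a] is a multiple of [cB], so the results on the planar system that assume [B != 0] apply as
    soon as [a != 0]. *)
Lemma cB_neq0 : a != 0 -> cB != 0.
Proof.
apply: contraNneq => cB0; rewrite -eigenvalue_a.
by have -> : 3 / 2 * (xs + 6 * xi * z ls) * bx = (xs + 6 * xi * z ls) * cB;
  [rewrite /cB; ring|rewrite cB0 mulr0].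
Qed.

(** Since [a = (xs + 6 xi z) * cB], the factor [a] cancels and with it all dependence on [xs]. The
    stated form then follows from [eps = 6 xi (1 - 6 xi) z^2], which uses [eps ^+ 2 = 1]. *)
Lemma stability_coefficient : a != 0 ->
  cB * cb / a = - eps * (ls / (2 * (1 - 6 * xi) * z ls)) - 3 / 2 * (1 + wm).
Proof.
move=> a0.
have -> : cB * cb = a * (3 / 2 * (- 2 * xi * ls * z ls - (1 + wm))).
  by rewrite -eigenvalue_a /cB /cb; ring.
rewrite mulrAC mulfV// mul1r.
have key : eps = 6 * xi * (1 - 6 * xi) * z ls ^+ 2.
  by have := sqr_z0E heps hpos hls; case: heps => -> H; lra.
by rewrite key; field; rewrite ?s6n ?z0n.
Qed.

End CosmologicalField.

(** * Assembly of the assertions (i), (ii) and (iii) *)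

Theorem mainTheorem7 (R : realType) (eps xi wm : R) (I : set R) (z : R -> R)
    (ls : R)
    (heps : eps = 1 \/ eps = -1)
    (Iopen : open I) (Iint : is_interval I)
    (zsmooth : smooth_on I z)
    (dz_neq0 : forall t, I t -> derive1 z t != 0)
    (hpos : 0 < eps * xi * (1 - 6 * xi))
    (hlead : 1 - 4 * xi - wm != 0)
    (Ils : I ls)
    (hls : z ls ^+ 2 = 1 / (6 * eps * xi * (1 - 6 * xi))) :
  let g := gpoly eps xi wm (z ls) in
  let gC := map_poly (real_complex R) g in
  (* (i) *)
  [/\ forall x : R[i], root gC x <->
        let pre := real_complex R (2 * eps * (1 - 4 * xi - wm))^-1 in
        let lin := real_complex R (- 4 * eps * xi * (1 - 3 * wm) * z ls) in
        let sq := sqrtC (real_complex R (- (16 / 3) * eps * xi * (1 - 3 * wm))) in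
        x = pre * (lin + sq) \/ x = pre * (lin - sq),
      wm < 1 / 3 ->
        (forall x : R[i], root gC x -> x \is Num.real -> eps * xi < 0) /\
        (0 < xi -> forall x : R[i], root gC x -> x \is Num.real -> eps = -1) &
      forall xs : R, g.[xs] = 0 ->
        let F := field eps xi wm z in
        let p := row3 xs 0 ls in
        let a := 12 * eps * xi * (1 - 6 * xi) * z ls * xs in
        (* (ii) *)
        [/\ critical_point F p,
            (* the effective equation of state parameter *)
            [/\ Dfun eps xi z p = 0, Bfun eps xi wm z p = 0,
                forall q : 'rV[R]_3, I (q 0 2) -> Dfun eps xi z q != 0 ->
                  weff eps xi wm z q
                    = 1 / 3 + Bfun eps xi wm z q / Dfun eps xi z q &
                let S := [set q : 'rV[R]_3 | [/\ I (q 0 2),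
                            Dfun eps xi z q != 0 & Bfun eps xi wm z q = 0]] in
                closure S p /\
                weff eps xi wm z q @[q --> within S (nbhs p)] --> (1 / 3 : R)],
            eigenvalues_are (linearization F p) [:: - a; 0; a],
            non_hyperbolic F p &
            (* (iii) *)
            a != 0 ->
            let G := field_uvw F p in
            let Gv0 := field_v0 G in
            let Gu0 := field_u0 G in
            let Bv := coefBv Gu0 in
            let Bw := coefBw Gu0 in
            let Cw := coefCw Gu0 in
            [/\ invariant_set G [set q : 'rV[R]_3 | q 0 1 = 0] /\
                invariant_set G [set q : 'rV[R]_3 | q 0 0 = 0],
                (* on v = 0 *)
                [/\ Gv0 = linear_saddle_field a +o_ (0 : 'rV[R]_2) id,
                    forall (u0 w0 : R) (phi : R -> 'rV[R]_2),
                      is_solution (linear_saddle_field a) setT phi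
                        /\ phi 0 = row2 u0 w0 <->
                      phi = (fun t => row2 (u0 * expR (- a * t))
                                           (w0 * expR (a * t))) &
                    planar_saddle Gv0 0],
                (* on u = 0 *)
                forall v w : R, Gu0 (row2 v w)
                  = row2 (Bv * v * w) (a * w + Bw * v ^+ 2 + Cw * w ^+ 2),
                (* the center manifold *)
                (exists h, center_manifold Gu0 h) /\
                (forall h, center_manifold Gu0 h ->
                  [/\ h = (fun v => - (Bw / a) * v ^+ 2
                             + Bw ^+ 2 / a ^+ 3 * (2 * Bv - Cw) * v ^+ 4)
                          +O_ (0 : R) (fun v => v ^+ 5),
                      restricted_field Gu0 h
                        = (fun eta => - (Bv * Bw / a) * eta ^+ 3)
                          +O_ (0 : R) (fun eta => eta ^+ 4),
                      Bv * Bw / a < 0 -> unstable (restricted_field Gu0 h) 0 &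
                      0 < Bv * Bw / a -> stable (restricted_field Gu0 h) 0]) &
                [/\ Bv * Bw / a = - eps * (ls / (2 * (1 - 6 * xi) * z ls))
                                  - 3 / 2 * (1 + wm),
                    Bv * Bw / a < 0 -> unstable Gu0 0 &
                    0 < Bv * Bw / a -> a < 0 -> stable Gu0 0]]]].
Proof.
move=> g gC; split.
- by move=> x; exact: gpoly_root_complex.
- move=> wm3; split; first by move=> x gx xR; exact: (gpoly_real_root heps hpos hls wm3 gx xR).
  move=> xi0 x gx xR; case: (heps) => // e1.
  have := gpoly_real_root heps hpos hls wm3 gx xR.
  by rewrite e1 mul1r ltNge ltW.
move=> xs gxs F p a; split.
- exact: field_critical.
- split.
  + exact: Dfun_p.
  + exact: Bfun_p.
  + by move=> q _; exact: weff_decomposition.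
  + exact: closure_radiation.
- exact: (field_eigenvalues heps zsmooth dz_neq0 hpos Ils hls gxs).
- exact: (field_non_hyperbolic heps zsmooth dz_neq0 hpos Ils hls gxs).
move=> a0 G Gv0 Gu0 Bv Bw Cw.
have [al1 [al2 [be [ga1 [ga2 GE]]]]] :=
  field_uvw_quadratic heps Iopen zsmooth dz_neq0 hpos Ils hls gxs a0.
have B0 := cB_neq0 heps hpos hls gxs a0.
have sc := stability_coefficient heps hpos hls gxs a0.
move: GE B0 sc; set cB := 3 / 2 * _; set cb := 3 / 2 * _ * _; set cC := _ + 3 / 2 * _ * _.
move=> GE B0 sc.
have {}GE : G = quadratic_uvw a cB cb cC al1 al2 be ga1 ga2 by exact: GE.
have Gu0E : Gu0 = planar a cB cb cC by rewrite /Gu0 GE field_u0_quadratic.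
have Gv0E : Gv0 = field_v0 (quadratic_uvw a cB cb cC al1 al2 be ga1 ga2) by rewrite /Gv0 GE.
have [BvE BwE CwE] := planar_coefs a cB cb cC.
have {}BvE : Bv = cB by rewrite /Bv Gu0E.
have {}BwE : Bw = cb by rewrite /Bw Gu0E.
have {}CwE : Cw = cC by rewrite /Cw Gu0E.
clearbody Bv Bw Cw; clearbody Gu0 Gv0; clearbody G; subst G Gu0 Gv0 Bv Bw Cw.
have [h0 [r0 hr0]] := exists_invariant_graph cb cC a0 B0.
split.
- exact: quadratic_uvw_invariant.
- split; first exact: field_v0_littleo.
    exact: linear_saddle_solution.
  exact: field_v0_saddle.
- by move=> v w; rewrite /planar !row2E.
- split; first by exists h0; exact: center_manifold_of_graph hr0.
  move=> h /graph_of_center_manifold[r hr]; split.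
  + exact: (graph_bigO a0 B0 hr).
  + exact: (restricted_bigO a0 B0 hr).
  + exact: (restricted_unstable a0 B0 hr).
  + exact: (restricted_stable a0 B0 hr).
- split; first exact: sc.
  + exact: (planar_unstable a0 B0 hr0).
  + by move=> g0 aneg; exact: planar_stable.
Qed.
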